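(* Let $n$ be a positive integer. For any $3$-colouring of the hyperedges of the complete $3$-uniform hypergraph on $n$ vertices (that is, any map $c:\binom{V}{3}\to\{1,2,3\}$ with $|V|=n$), there exists a $2$-coloured matching of size $$m(n)=\left\lfloor \frac{4(n+1)}{13}\right\rfloor .$$
   Context: A matching is a set of pairwise disjoint hyperedges ($3$-element subsets of $V$); its size is the number of its hyperedges. A matching is $2$-coloured if its hyperedges use at most $2$ of the $3$ colours. *)

(* Defs.v *)
From mathcomp Require Import all_boot.

Set Implicit Arguments.
Unset Strict Implicit.
Unset Printing Implicit Defensive.

(* [trivIset] ignores empty blocks, but no member of [M] is empty here. *)
Definition matching3 (V : finType) (M : {set {set V}}) : bool :=
  [forall e in M, #|e| == 3] && trivIset M.

(* A colouring is given as a function on all of {set V}; only its values on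
   3-element sets are ever used, so this is the same as a map on triples. *)
Definition two_coloured (V : finType) (c : {set V} -> 'I_3)
    (M : {set {set V}}) : bool :=
  #|c @: M| <= 2.

(* Main.v *)
Require Import Defs.
From HB Require Import structures.
From mathcomp Require Import all_boot zify.
From Stdlib Require Import BinPos BinNat Btauto.

(** Some matching of the required size avoids one of the three colours. Write
    [n] for the number of vertices. If a colour can be avoided by a matching with
    [n %/ 3] triples, there is nothing to do. Otherwise there is a set [G] of
    vertices and some [j] with [4 * #|G| <= 13 * j] such that each of the three
    colours is avoided by a matching of size [j] inside [G]
    ([exists_gadget]); removing [G] and arguing by induction gives the theorem
    ([avoiding_matching]).

    To find [G], take a minimal set [U] on which no colour can be avoided by a
    matching of maximal size, and suppose that it contains no such [G]. Then
    [#|U| = 3 * m], and a perfect matching of a part and one of its complement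
    never avoid the same colour ([dual]). Each six-point set has a colour present
    in all its pairs of complementary triples, as six points would do for [G] with
    [j = 2] ([dominated]); for [m > 4], each pair of points misses a colour, as the
    remaining [3 * m - 2] points would do with [j = m - 1] ([missed]).

    Let [F] be a smallest proper subset of [U] whose perfect matchings can avoid
    exactly one colour [k]. No triple of [F] is coloured [k]
    ([no_minimal_counterexample]), and [U] has a perfect matching consisting of one
    triple of a colour [i], inside [F], of triples of the third colour [t] in the
    rest of [F], and of triples coloured [t] or [k] outside [F]. A union of that
    single triple with other triples of this matching therefore has no perfect
    matching avoiding [i]. With the previous constraints, this already contradicts
    the colouring of nine, twelve or fifteen well-chosen points
    ([neutral_refuted], [neutral_with_block_refuted],
    [two_coloured_part_refuted]).

    These last contradictions are finite but long case analyses on the colours of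
    the triples. They are recorded as certificates, lists of clauses each of which
    follows from earlier ones by unit propagation, which a boolean function
    checks ([check]); its soundness is [check_sound]. *)

Set Implicit Arguments.
Unset Strict Implicit.
Unset Printing Implicit Defensive.

(** * Matchings inside a set of vertices *)

Section Matchings.
Variable V : finType.
Implicit Types (P Q : pred {set V}) (F G e : {set V}).

(** [mt P F j]: the set [F] contains [j] pairwise disjoint triples satisfying [P].
    A recursive boolean definition, one triple being removed from [F] at a time. *)
Fixpoint mt P F j : bool :=
  if j is j'.+1 then
    [exists e : {set V}, [&& e \subset F, #|e| == 3, P e & mt P (F :\: e) j']]
  else true.

Lemma mtP P F j :
  reflect (exists e, [/\ e \subset F, #|e| = 3, P e & mt P (F :\: e) j])
          (mt P F j.+1).
Proof.
apply: (iffP existsP) => [[e /and4P[? /eqP ? ? ?]]|[e [eF e3 Pe M]]]; exists e => //.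
by rewrite eF e3 eqxx Pe.
Qed.

Lemma mt_sub P Q F G j : F \subset G ->
    (forall e, e \subset F -> #|e| = 3 -> P e -> Q e) ->
  mt P F j -> mt Q G j.
Proof.
elim: j F G => // j IH F G FG PQ /mtP[e [eF e3 Pe M]].
apply/mtP; exists e; split=> //; first exact: subset_trans FG.
  exact: PQ.
apply: IH M; first exact: setSD.
by move=> f fF; apply: PQ; apply: subset_trans fF (subsetDl _ _).
Qed.

Lemma mt_subset P F G j : F \subset G -> mt P F j -> mt P G j.
Proof. by move=> FG; apply: mt_sub. Qed.

Lemma mt_weaken P Q F j : (forall e, P e -> Q e) -> mt P F j -> mt Q F j.
Proof. by move=> PQ; apply: mt_sub => // e _ _; apply: PQ. Qed.

Lemma mt_union P F G j k :
  [disjoint F & G] -> mt P F j -> mt P G k -> mt P (F :|: G) (j + k).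
Proof.
elim: j F => [|j IH] F dFG; first by move=> _; apply/mt_subset/subsetUr.
move=> /mtP[e [eF e3 Pe M]] MG; apply/mtP; exists e; split=> //.
  exact: subset_trans eF (subsetUl _ _).
apply: mt_subset (IH (F :\: e) _ M MG); last first.
  by apply: disjointWl dFG; apply: subsetDl.
rewrite setDUl setUS // subsetD subxx /= disjoint_sym.
by apply: disjointWl dFG.
Qed.

Lemma disjointsD F G : [disjoint F & G :\: F].
Proof. by rewrite -setI_eq0 setDE setICA setICr setI0. Qed.

Lemma mt_compl P F G j k :
  F \subset G -> mt P F j -> mt P (G :\: F) k -> mt P G (j + k).
Proof.
move=> FG M N; apply: mt_subset (mt_union (disjointsD F G) M N).
by rewrite subUset FG subsetDl.
Qed.

Lemma mt_edge P e : #|e| = 3 -> P e -> mt P e 1.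
Proof. by move=> e3 Pe; apply/mtP; exists e; split. Qed.

Lemma mt_add P F e j : e \subset F -> #|e| = 3 -> P e ->
  mt P (F :\: e) j -> mt P F j.+1.
Proof. by move=> eF e3 Pe M; apply/mtP; exists e. Qed.

Lemma mt_le P F j k : k <= j -> mt P F j -> mt P F k.
Proof.
elim: j k F => [|j IH] [|k] F // kj /mtP[e [eF e3 Pe M]].
by apply: (mt_add eF e3 Pe); apply: IH M.
Qed.

Lemma mt_card P F j : mt P F j -> 3 * j <= #|F|.
Proof.
elim: j F => // j IH F /mtP[e [eF e3 Pe /IH]].
by rewrite cardsD (setIidPr eF) e3; have := subset_leq_card eF; rewrite e3; lia.
Qed.

(** A matching splits along any predicate [Q]; the two parts live on disjoint
    vertex sets that they cover exactly. *)
Lemma mt_split P Q F j : mt P F j -> exists F1 F2 a b,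
  [/\ F1 :|: F2 \subset F, [disjoint F1 & F2], a + b = j,
      #|F1| = 3 * a /\ mt (predI P Q) F1 a &
      #|F2| = 3 * b /\ mt (predI P (predC Q)) F2 b].
Proof.
elim: j F => [|j IH] F.
  move=> _; exists set0, set0, 0, 0; split; rewrite ?cards0 ?setU0 ?sub0set //.
  by rewrite -setI_eq0 setI0.
move=> /mtP[e [eF e3 Pe /IH [F1 [F2 [a [b [FF d ab [c1 M1] [c2 M2]]]]]]]].
have /andP[_ dFe] : (F1 :|: F2 \subset F) && [disjoint F1 :|: F2 & e] by rewrite -subsetD.
have de G : G \subset F1 :|: F2 -> [disjoint e & G].
  by move=> GF; rewrite disjoint_sym; apply: disjointWl dFe.
have [de1 de2] : [disjoint e & F1] /\ [disjoint e & F2].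
  by rewrite !de ?subsetUl ?subsetUr.
have sub G : G \subset F1 :|: F2 -> e :|: G \subset F.
  by move=> GF; rewrite subUset eF (subset_trans GF) // (subset_trans FF) ?subsetDl.
case: (boolP (Q e)) => Qe.
  exists (e :|: F1), F2, a.+1, b; split=> //.
  - by rewrite -setUA sub.
  - by rewrite -setI_eq0 setIUl setU_eq0 !setI_eq0 de2.
  - by rewrite addSn ab.
  - split; last by apply: (@mt_union _ _ _ 1) => //; apply: mt_edge; rewrite //= Pe.
    by rewrite cardsU (disjoint_setI0 de1) cards0 e3 c1; clear; lia.
exists F1, (e :|: F2), a, b.+1; split=> //.
- by rewrite setUCA sub.
- by rewrite disjoint_sym -setI_eq0 setIUl setU_eq0 !setI_eq0 de1 disjoint_sym.
- by rewrite addnS ab.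
- split; last by apply: (@mt_union _ _ _ 1) => //; apply: mt_edge; rewrite //= Pe.
  by rewrite cardsU (disjoint_setI0 de2) cards0 e3 c2; clear; lia.
Qed.

Lemma mt_matching P F j : mt P F j ->
  exists M : {set {set V}}, [/\ matching3 M, cover M \subset F, #|M| = j &
    forall e, e \in M -> P e].
Proof.
elim: j F => [|j IH] F.
  move=> _; exists set0; split; rewrite ?cards0 /cover ?big_set0 ?sub0set //.
  - apply/andP; split; first by apply/forallP=> e; rewrite inE.
    by rewrite /trivIset /cover !big_set0 cards0.
  - by move=> e; rewrite inE.
move=> /mtP[e [eF e3 Pe /IH[M [/andP[M3 tM] cM <- PM]]]].
have dis f : f \in M -> [disjoint e & f].
  move=> fM; rewrite disjoint_sym; have := subset_trans (bigcup_sup f fM) cM.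
  by rewrite subsetD => /andP[].
have eM : e \notin M.
  apply/negP => /dis; rewrite -setI_eq0 setIid => /eqP e0.
  by rewrite e0 cards0 in e3.
exists (e |: M); split.
- apply/andP; split.
    apply/forallP => f; apply/implyP; rewrite !inE => /orP[/eqP->|]; first exact/eqP.
    by apply/implyP; have /forallP := M3; apply.
  apply/trivIsetP => f g; rewrite !inE.
  move=> /orP[/eqP->|fM] /orP[/eqP->|gM]; rewrite ?eqxx // => ne.
  + exact: dis.
  + by rewrite disjoint_sym dis.
  + by move/trivIsetP: tM => /(_ f g fM gM ne).
- rewrite /cover bigcup_setU big_set1 subUset eF.
  exact: subset_trans cM (subsetDl _ _).
- by rewrite cardsU1 eM.
- by move=> f; rewrite !inE => /orP[/eqP->|/PM].
Qed.
End Matchings.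

(** * Refutation certificates *)

(** A binary number encodes a set of indices: bit [i] tells whether [i] belongs
    to it. [pop] is the cardinal, [disj] and [sub] are disjointness and
    inclusion. *)
Fixpoint bits (p : positive) : bitseq :=
  match p with
  | xH => [:: true] | xO p => false :: bits p | xI p => true :: bits p
  end.

Fixpoint pop (p : positive) : nat :=
  match p with xH => 1 | xO p => pop p | xI p => (pop p).+1 end.

Fixpoint disj (p q : positive) : bool :=
  match p, q with
  | xH, xO _ | xO _, xH => true
  | xO p, xO q | xO p, xI q | xI p, xO q => disj p q
  | _, _ => false
  end.

Fixpoint sub (p q : positive) : bool :=
  match p, q with
  | xH, xI _ | xH, xH => true
  | xO p, xO q | xO p, xI q | xI p, xI q => sub p q
  | _, _ => false
  end.

Lemma count_bits p : count id (bits p) = pop p.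
Proof. by elim: p => //= p ->. Qed.

Lemma nth_lor p q i :
  nth false (bits (Pos.lor p q)) i = nth false (bits p) i || nth false (bits q) i.
Proof.
elim: p q i => [p IH|p IH|] [q|q|] [|i] //=; rewrite ?nth_nil ?orbF //; exact: IH.
Qed.

Lemma disjP p q i : disj p q -> nth false (bits p) i -> ~~ nth false (bits q) i.
Proof.
elim: p q i => [p IH|p IH|] [q|q|] [|i] //=; rewrite ?nth_nil //; exact: IH.
Qed.

Lemma subP p q i : sub p q -> nth false (bits p) i -> nth false (bits q) i.
Proof.
elim: p q i => [p IH|p IH|] [q|q|] [|i] //=; rewrite ?nth_nil //; exact: IH.
Qed.

Lemma pop_lor p q : disj p q -> pop (Pos.lor p q) = pop p + pop q.
Proof.
by elim: p q => [p IH|p IH|] [q|q|] //= d; rewrite ?addn0 ?addn1 ?IH ?addSn ?addnS.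
Qed.

HB.instance Definition _ := hasDecEq.Build positive Pos.eqb_spec.

(** A literal [(m, s)] says that the colour attached to the mask [m] belongs to
    the set [s] of colours, where [s] is a mask too: 1, 2 and 4 are the three
    singletons and 7 is the set of all colours. The colour attached to a triple
    is its colour; to a six-point set, a colour [i] such that each of its
    complementary pairs of triples has a triple coloured [i]; to a pair of
    points, a colour absent from the triples containing that pair. *)
Definition lit := (positive * N)%type.

(** A clause is the disjunction of its literals. *)
Definition clause := seq lit.

Definition L (m : positive) (s : N) : lit := (m, s).

(** Names of the clauses that a step may use. [D e f i]: if neither of
    the disjoint triples [e] and [f] is coloured [i], then [i] is not attached to
    their union. [P p t i]: if [i] is attached to the pair [p], then the triple [t]
    containing [p] is not coloured [i]. [E i es]: one of the disjoint triples
    [es], whose union has no perfect matching avoiding [i], is coloured [i].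
    [C k]: the clause derived [k + 1] steps before. *)
Inductive ref :=
  | D of positive & positive & N
  | P of positive & positive & N
  | E of N & seq positive
  | C of nat.

Arguments L _%_positive _%_num.
Arguments D (_ _)%_positive _%_num.
Arguments P (_ _)%_positive _%_num.
Arguments E _%_num _%_positive.

(** Finite maps from masks to sets of colours, the default value being 7. *)
Inductive tree := Leaf | Node of tree & N & tree.

Fixpoint get (t : tree) (p : positive) : N :=
  match t, p with
  | Leaf, _ => 7%num
  | Node _ d _, xH => d
  | Node l _ _, xO p => get l p
  | Node _ _ r, xI p => get r p
  end.

Fixpoint put (t : tree) (p : positive) (d : N) : tree :=
  match t, p with
  | Leaf, xH => Node Leaf d Leaf
  | Leaf, xO p => Node (put Leaf p d) 7%num Leaf
  | Leaf, xI p => Node Leaf 7%num (put Leaf p d)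
  | Node l _ r, xH => Node l d r
  | Node l e r, xO p => Node (put l p d) e r
  | Node l e r, xI p => Node l e (put r p d)
  end.

Lemma get_put t p d q : get (put t p d) q = if Pos.eqb q p then d else get t q.
Proof.
elim: p t q => [p IH|p IH|] [|l e r] [q|q|] //=; rewrite ?IH //=.
Qed.

Definition restrict (t : tree) (l : lit) : tree :=
  put t l.1 (N.land (get t l.1) l.2).

Definition neg (l : lit) : lit := (l.1, N.lxor 7 l.2).

(** Unit propagation: each clause in turn must have at most one literal that is
    still possible, which is then imposed, until a clause has none. *)
Fixpoint propagate (t : tree) (cls : seq clause) : bool :=
  if cls is cl :: cls' then
    match [seq l <- cl | N.land (get t l.1) l.2 != 0%num] with
    | [::] => true
    | [:: l] => propagate (restrict t l) cls'
    | _ => false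
    end
  else false.

(** [n] is the number of points, [usep] tells whether every pair of points misses
    a colour, [nopm] lists the pairs [(u, i)] such that [u] has no perfect
    matching avoiding the colour [i], and [facts] lists the initial literals,
    all about triples. *)
Section Checker.
Variables (n : nat) (usep : bool) (nopm : seq lit) (facts : seq lit).

(** A mask that encodes a triple of points. *)
Definition triple (p : positive) : bool := (pop p == 3) && (size (bits p) <= n).

Definition single (i : N) : bool := i \in [:: 1; 2; 4]%num.

(** The union of a list of triples, if they are pairwise disjoint. *)
Fixpoint union (es : seq positive) : option positive :=
  match es with
  | [::] => None
  | [:: e] => if triple e then Some e else None
  | e :: es' =>
      if union es' is Some u then
        if triple e && disj e u then Some (Pos.lor e u) else None
      else None
  end.

Definition clause_of (ds : seq clause) (r : ref) : option clause :=
  match r with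
  | D e f i =>
      if [&& triple e, triple f, disj e f & single i]
      then Some [:: (Pos.lor e f, N.lxor 7 i); (e, i); (f, i)] else None
  | P p t i =>
      if [&& usep, pop p == 2, triple t, sub p t & single i]
      then Some [:: (p, N.lxor 7 i); (t, N.lxor 7 i)] else None
  | E i es =>
      if union es is Some u then
        if single i && ((u, i) \in nopm) then Some [seq (e, i) | e <- es] else None
      else None
  | C k => if k < size ds then Some (nth [::] ds k) else None
  end.

(** A certificate is a list of derived clauses, each with the clauses from which
    propagation refutes its negation; the empty clause must be reached. *)
Fixpoint check (ds : seq clause) (pf : seq (clause * seq ref)) : bool :=
  if pf is (cl, rs) :: pf' then
    let cs := [seq clause_of ds r | r <- rs] in
    all isSome cs &&
    (propagate (foldl restrict (foldl restrict Leaf facts) (map neg cl)) (pmap id cs) &&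
     (nilp cl || check (cl :: ds) pf'))
  else false.

(** The points outside [u] are covered by disjoint triples of [fs] with a known
    colour, other than [i]. The triples are taken greedily, in the order of
    [fs]. *)
Fixpoint closes (fs : seq lit) (u : positive) (i : N) : bool :=
  if fs is (k, d) :: fs' then
    if disj k u then [&& single d, d != i & closes fs' (Pos.lor k u) i]
    else closes fs' u i
  else pop u == n.

(** A checked certificate, together with the verification that each entry [(u, i)]
    of [closed] has [i] in [cols] and satisfies [closes]: the set [u] then has no
    perfect matching avoiding [i] as soon as the points not in the list have one
    while the whole vertex set has none. *)
Definition valid (cols : seq N) (closed : seq lit) (pf : seq (clause * seq ref)) : bool :=
  [&& check [::] pf, all (fun f => triple f.1) facts &
      all (fun l => [&& l.2 \in cols, single l.2, size (bits l.1) <= n &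
        closes facts l.1 l.2])
          closed].
End Checker.

(** * Soundness of certificates *)

(** [vs] lists the points of [U] that the masks speak of, and [cs] the colours. *)
Section Soundness.
Variables (V : finType) (c : {set V} -> 'I_3) (U : {set V}) (vs : seq V).
Variable cs : seq 'I_3.
Hypothesis vs_uniq : uniq vs.
Hypothesis vsU : {subset vs <= U}.
Hypotheses (cs_size : size cs = 3) (cs_uniq : uniq cs).

Lemma cs_all i : i \in cs.
Proof.
have le : size (enum 'I_3) <= size cs by rewrite size_enum_ord cs_size.
have [_ e] := uniq_min_size cs_uniq (fun x _ => mem_enum 'I_3 x) le.
by rewrite e mem_enum.
Qed.

(** The triples whose colour is not [i]. *)
Definition av (i : 'I_3) : pred {set V} := fun e => c e != i.

(** The set of points encoded by a mask. *)
Definition sv (m : positive) : {set V} := [set x in mask (bits m) vs].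

Lemma in_sv m x : (x \in sv m) = (x \in vs) && nth false (bits m) (index x vs).
Proof. by rewrite inE in_mask. Qed.

Lemma sv_sub m : sv m \subset U.
Proof. by apply/subsetP=> x; rewrite in_sv => /andP[/vsU]. Qed.

Lemma card_sv m : size (bits m) <= size vs -> #|sv m| = pop m.
Proof.
move=> le; rewrite cardsE (card_uniqP _) ?mask_uniq // -count_bits.
elim: (bits m) vs le => [|b bs IH] [|x s] //= le.
by case: b; rewrite /= IH.
Qed.

Lemma sv_lor p q : sv (Pos.lor p q) = sv p :|: sv q.
Proof. by apply/setP=> x; rewrite in_setU !in_sv nth_lor andb_orr. Qed.

Lemma sv_disj p q : disj p q -> [disjoint sv p & sv q].
Proof.
move=> d; rewrite -setI_eq0; apply/eqP/setP=> x; rewrite in_setI !in_sv inE.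
by apply/negP=> /andP[/andP[-> /(disjP d)/negbTE->]].
Qed.

Lemma sv_subset p q : sub p q -> sv p \subset sv q.
Proof. by move=> s; apply/subsetP=> x; rewrite !in_sv => /andP[-> /(subP s)]. Qed.

(** [i] may be attached to [A], which is a triple, a six-point set or a pair. *)
Definition tv (A : {set V}) (i : 'I_3) : bool :=
  if #|A| == 3 then c A == i
  else if #|A| == 6 then ~~ mt (av i) A 2
  else [forall z in U :\: A, c (z |: A) != i].

(** The position in [cs] of the colour attached to [m]. The reduction modulo 3
    only makes it a position when no colour may be attached. *)
Definition kappa (m : positive) : nat := find (tv (sv m)) cs %% 3.

(** The truth of a literal. *)
Definition sat (l : lit) : bool := N.testbit l.2 (N.of_nat (kappa l.1)).

(** All the constraints recorded in [t] hold. *)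
Definition ok (t : tree) := forall p, sat (p, get t p).

Lemma kappa_lt m : kappa m < 3. Proof. by rewrite ltn_mod. Qed.

Lemma sat7 m : sat (m, 7%num).
Proof. by rewrite /sat /=; case: (kappa m) (kappa_lt m) => [|[|[|]]]. Qed.

Lemma sat_land m s t : sat (m, N.land s t) = sat (m, s) && sat (m, t).
Proof. by rewrite /sat /= N.land_spec. Qed.

Lemma sat_neg l : sat (neg l) = ~~ sat l.
Proof.
have s7 := sat7 l.1; rewrite /sat in s7 *.
rewrite -[(neg l).2]/(N.lxor 7 l.2) N.lxor_spec s7.
by case: N.testbit.
Qed.

Lemma ok_restrict t l : ok t -> sat l -> ok (restrict t l).
Proof.
move=> ot sl p; rewrite get_put; case: (Pos.eqb_spec p l.1) => [->|_]; last exact: ot.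
by rewrite sat_land ot; case: l sl.
Qed.

Lemma propagate_sound t cls : ok t -> all (has sat) cls -> propagate t cls -> False.
Proof.
elim: cls t => // cl cls IH t ot /= /andP[/hasP[l lcl sl] allc].
have : l \in [seq l <- cl | N.land (get t l.1) l.2 != 0%num].
  rewrite mem_filter lcl andbT; apply/eqP=> e0.
  have : sat (l.1, N.land (get t l.1) l.2) by rewrite sat_land ot; case: l sl {lcl e0}.
  by rewrite e0 /sat /=.
case: [seq _ <- _ | _] => [//|l' [|//]]; rewrite inE => /eqP <-.
by apply: IH => //; apply: ok_restrict.
Qed.

Lemma ok_foldl t ls : ok t -> all sat ls -> ok (foldl restrict t ls).
Proof.
by elim: ls t => //= l ls IH t ot /andP[sl sls]; apply: IH => //; apply: ok_restrict.
Qed.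

Lemma kappaP m i : tv (sv m) i -> tv (sv m) (nth ord0 cs (kappa m)).
Proof.
move=> h; have hh : has (tv (sv m)) cs by apply/hasP; exists i => //; apply: cs_all.
have lt : find (tv (sv m)) cs < 3 by rewrite -[X in _ < X]cs_size -has_find.
by rewrite /kappa modn_small ?nth_find.
Qed.

(** The position denoted by a singleton. *)
Definition cidx (i : N) : nat := if i == 1%num then 0 else if i == 2%num then 1 else 2.

Lemma sat1 m i : single i -> sat (m, i) = (kappa m == cidx i).
Proof.
rewrite /single /sat !inE => /or3P[] /eqP ->; rewrite /=;
by case: (kappa m) (kappa_lt m) => [|[|[|]]].
Qed.

Lemma sat1N m i : single i -> sat (m, N.lxor 7 i) = (kappa m != cidx i).
Proof. by move=> ii; rewrite -sat1 // -sat_neg. Qed.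

(** The colours denoted by a singleton and by a set. *)
Definition col (i : N) : 'I_3 := nth ord0 cs (cidx i).

Definition cols (d : N) : seq 'I_3 :=
  [seq nth ord0 cs k | k <- iota 0 3 & N.testbit d (N.of_nat k)].

Variables (usep : bool) (nopm : seq lit) (facts : seq lit).
Let n := size vs.
Hypothesis HD : forall S : {set V}, S \subset U -> #|S| = 6 ->
  exists i, ~~ mt (av i) S 2.
Hypothesis HP : usep -> forall A : {set V}, A \subset U -> #|A| = 2 ->
  exists i, [forall z in U :\: A, c (z |: A) != i].
Hypothesis HN : forall i u, (u, i) \in nopm -> ~~ mt (av (col i)) (sv u) (pop u %/ 3).
Hypothesis HF : forall p d, (p, d) \in facts -> triple n p && (c (sv p) \in cols d).

Lemma card_triple e : triple n e -> #|sv e| = 3.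
Proof. by move=> /andP[/eqP <- le]; apply: card_sv. Qed.

Lemma kappa_triple e : triple n e -> c (sv e) = nth ord0 cs (kappa e).
Proof.
move=> te; have := @kappaP e (c (sv e)).
by rewrite /tv card_triple //= !eqxx => /(_ isT)/eqP.
Qed.

Lemma cidx_lt i : cidx i < size cs.
Proof. by rewrite cs_size /cidx; case: ifP => // _; case: ifP. Qed.

Lemma sat_triple e i : triple n e -> single i -> sat (e, i) = (c (sv e) == col i).
Proof.
move=> te si; rewrite sat1 // kappa_triple // nth_uniq ?cs_size ?kappa_lt //.
by rewrite -cs_size cidx_lt.
Qed.

Lemma size_lor p q : size (bits (Pos.lor p q)) = maxn (size (bits p)) (size (bits q)).
Proof. by elim: p q => [p IH|p IH|] [q|q|] //=; rewrite ?IH ?maxnSS ?maxn0 ?max0n. Qed.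

Lemma unionP es u : union n es = Some u ->
  [/\ pop u = 3 * size es, all (triple n) es &
     forall Q, all (fun e => Q (sv e)) es -> mt Q (sv u) (size es)].
Proof.
elim: es u => [|e es IH] u //.
case: es IH => [|e' es] IH.
  rewrite /=; case: ifP => // te [<-]; split; rewrite ?te //.
    by have /andP[/eqP->] := te.
  by move=> Q; rewrite andbT => Qe; apply: mt_edge => //; apply: card_triple.
change (union n [:: e, e' & es]) with (if union n (e' :: es) is Some u then
        if triple n e && disj e u then Some (Pos.lor e u) else None
      else None).
case eu: (union n (e' :: es)) => [v|//]; case: ifP => // /andP[te dev] [<-].
have [pv tv' M] := IH _ eu; split.
- by rewrite pop_lor // pv; have /andP[/eqP-> _] := te; rewrite -mulnS.
- by rewrite [all _ _]/= te; exact: tv'.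
- move=> Q /andP[Qe Qes]; rewrite sv_lor; apply: (@mt_union _ _ _ _ 1).
  + exact: sv_disj.
  + by apply: mt_edge => //; apply: card_triple.
  + exact: M.
Qed.

Lemma clause_of_sound ds r cl : all (has sat) ds -> clause_of n usep nopm ds r = Some cl ->
  has sat cl.
Proof.
move=> sds; case: r => [e f i|p t i|i es|k] /=.
- case: ifP => // /and4P[te tf def si] [<-] /=.
  rewrite sat1N // !sat_triple // orbF.
  case: eqP => //= k6; apply/negPn/negP; rewrite negb_or => /andP[ce cf].
  have c6 : #|sv (Pos.lor e f)| = 6.
    by rewrite sv_lor cardsU (disjoint_setI0 (sv_disj def)) cards0 !card_triple.
  have [j nj] := HD (sv_sub _) c6.
  have := @kappaP (Pos.lor e f) j; rewrite /tv c6 /= k6 => /(_ nj) /negP[].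
  rewrite sv_lor; apply: (@mt_union _ _ _ _ 1 1); first exact: sv_disj.
    by apply: mt_edge => //; apply: card_triple.
  by apply: mt_edge => //; apply: card_triple.
- case: ifP => // /and5P[up /eqP p2 tt pt si] [<-] /=.
  have lp : size (bits p) <= n.
    apply: leq_trans (_ : size (bits t) <= n); last by have /andP[] := tt.
    by elim: (p) (t) pt => [q IH|q IH|] [r|r|] //=; rewrite ltnS; exact: IH.
  have cp : #|sv p| = 2 by rewrite card_sv.
  rewrite !sat1N // orbF; case: eqP => //= kp.
  have [j nj] := HP up (sv_sub p) cp.
  have := @kappaP p j; rewrite /tv cp /= kp => /(_ nj) /forallP H.
  rewrite -sat1 // sat_triple //.
  have [z zt zp] : exists2 z, z \in sv t & z \notin sv p.
    apply/subsetPn/negP=> /subset_leq_card; by rewrite cp card_triple.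
  have -> : sv t = z |: sv p.
    apply/esym/eqP; rewrite eqEcard subUset sub1set zt sv_subset //=.
    by rewrite card_triple // cardsU1 zp cp.
  have := H z; rewrite in_setD zp (subsetP (sv_sub t)) //.
- case eu: union => [u|//]; case: ifP => // /andP[si inn] [<-].
  have [pu tes M] := unionP eu.
  apply/negPn/negP => /hasPn ns; have /negP[] := HN inn.
  rewrite pu mulKn //; apply: M; apply/allP=> e ein.
  by rewrite /av -sat_triple ?(allP tes) // ns //; apply: map_f.
- by case: ifP => // lk [<-]; apply: (allP sds); apply: mem_nth.
Qed.

Lemma sat_fact p d : (p, d) \in facts -> sat (p, d).
Proof.
move=> /HF /andP[tp /mapP[k]]; rewrite mem_filter mem_iota => /andP[b kl].
rewrite kappa_triple // => /eqP; rewrite nth_uniq ?cs_size ?kappa_lt // => /eqP kk.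
by rewrite /sat /= kk.
Qed.

Lemma cidx_inj i j : single i -> single j -> col i = col j -> i = j.
Proof.
move=> si sj /eqP; rewrite nth_uniq ?cidx_lt //; move: si sj; rewrite /single !inE.
by do 2![case/or3P=> /eqP ->].
Qed.

Lemma sv_full u : pop u = n -> size (bits u) <= n -> sv u = [set x in vs].
Proof.
move=> pu su; apply/eqP; rewrite eqEcard; apply/andP; split.
  by apply/subsetP=> x; rewrite in_sv inE => /andP[].
by rewrite card_sv // pu cardsE (card_uniqP _).
Qed.

(** From a matching avoiding [i] outside the list, known triples make one outside
    [u], with [k] more triples if [u] and these triples exhaust the list. *)
Lemma closes_sound fs u i r : {subset fs <= facts} -> single i -> size (bits u) <= n ->
    closes n fs u i -> mt (av (col i)) (U :\: [set x in vs]) r ->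
  exists k, [/\ pop u + 3 * k = n & mt (av (col i)) (U :\: sv u) (k + r)].
Proof.
move=> sub si; elim: fs u sub => [|[k d] fs IH] u sub su /=.
  move=> /eqP pu M; exists 0.
  by rewrite muln0 addn0 sv_full.
have subf : {subset fs <= facts} by move=> x xf; apply: sub; rewrite inE xf orbT.
case: ifP => [dk /and3P[sd di cl] M|_]; last exact: IH.
have /HF/andP[tk ck] : (k, d) \in facts by apply: sub; rewrite inE eqxx.
have /andP[/eqP pk sk] := tk.
have sku : size (bits (Pos.lor k u)) <= n by rewrite size_lor geq_max sk.
have [l [pl Ml]] := IH _ subf sku cl M.
exists l.+1; split; first by rewrite mulnS -pl pop_lor // pk addnCA addnA.
have dku := sv_disj dk.
apply: (@mt_add _ _ _ (sv k)) => //.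
- by rewrite subsetD sv_sub.
- exact: card_triple.
- rewrite /av; have : c (sv k) = col d.
    move: ck sd; rewrite /single !inE => ck /or3P[]/eqP dd; move: ck;
    by rewrite dd /cols /col /= inE => /eqP.
  by move=> ->; apply: contra di => /eqP /(cidx_inj sd si) ->.
- by rewrite setDDl setUC -sv_lor.
Qed.

(** A valid certificate refutes the situation that it describes. *)
Lemma check_sound ds pf : all (has sat) ds -> check n usep nopm facts ds pf -> False.
Proof.
elim: pf ds => // [[cl rs] pf] IH ds sds /= /and3P[al pr].
have hcl : has sat cl.
  apply/negPn/negP => nh; apply: propagate_sound pr.
    apply: ok_foldl; first apply: ok_foldl.
    - by move=> p; rewrite /= sat7.
    - by apply/allP=> [[p d]]; apply: sat_fact.
    - by rewrite all_map; apply/allP=> l ll /=; rewrite sat_neg; apply: (hasPn nh).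
  elim: rs al => //= r rs IHr; case er: clause_of => [d|] //= /IHr ->.
  by rewrite (clause_of_sound sds er).
by case: nilP hcl => [->//|_] hcl /= ; apply: IH; rewrite /= hcl.
Qed.
End Soundness.

(** * Naming points *)

Section Labels.
Variable V : finType.
Implicit Types (S e : {set V}) (s t : seq V).

Lemma uniq_set s : #|[set x in s]| = size s -> uniq s.
Proof. by rewrite cardsE => /card_uniqP. Qed.

Lemma set_cat s t : [set x in s ++ t] = [set x in s] :|: [set x in t].
Proof. by apply/setP=> x; rewrite !inE mem_cat. Qed.

Lemma uniq_catS s t : uniq s -> uniq t -> [disjoint [set x in s] & [set x in t]] ->
  uniq (s ++ t).
Proof.
move=> us ut /disjoint_setI0 d; apply: uniq_set.
by rewrite set_cat cardsU d cards0 subn0 !cardsE !(card_uniqP _) // size_cat.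
Qed.

Lemma seq_of_set S : exists s, [/\ uniq s, size s = #|S| & [set x in s] = S].
Proof. by exists (enum S); rewrite enum_uniq -cardE set_enum. Qed.

Lemma triple_points e : #|e| = 3 -> exists x y z, uniq [:: x; y; z] /\
  [set t in [:: x; y; z]] = e.
Proof.
move=> e3; have [s [us ss <-]] := seq_of_set e; move: ss us; rewrite e3.
by case: s => [|x [|y [|z []]]] // _ us; exists x, y, z.
Qed.

(** When a six-point set has no perfect matching avoiding [a] and none avoiding
    [b], each of its complementary pairs of triples has one triple of each of
    these two colours. Some two triples sharing two points then have different
    colours: between a triple and its complement, replace one point at a time. *)
Lemma neutral_labels (c : {set V} -> 'I_3) S a b : a != b -> #|S| = 6 ->
    ~~ mt (av c a) S 2 -> ~~ mt (av c b) S 2 ->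
  exists s, [/\ size s = 6, uniq s, [set x in s] = S, c (sv s 7) = a & c (sv s 11) = b].
Proof.
move=> ab S6 Na Nb.
have neutral e : e \subset S -> #|e| = 3 ->
    (c e = a /\ c (S :\: e) = b) \/ (c e = b /\ c (S :\: e) = a).
  move=> eS e3; have f3 : #|S :\: e| = 3 by rewrite cardsD (setIidPr eS) S6 e3.
  have one i : ~~ mt (av c i) S 2 -> (c e == i) || (c (S :\: e) == i).
    apply: contraR; rewrite negb_or => /andP[ei fi].
    by apply: (mt_add eS e3 ei); apply: mt_edge.
  move: (one a Na) (one b Nb).
  case: (eqVneq (c e) a) => [->|_] /=; first by rewrite (negbTE ab) => _ /eqP; left.
  by move=> /eqP -> ; rewrite (negbTE ab) orbF => /eqP; right.
have walk x0 x1 x2 x3 x4 x5 : [set x in [:: x0; x1; x2; x3; x4; x5]] = S ->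
   c [set x in [:: x0; x1; x2]] = a -> c [set x in [:: x3; x4; x5]] = b ->
  exists s, [/\ size s = 6, uniq s, [set x in s] = S, c (sv s 7) = a & c (sv s 11) = b].
  move=> sS c012 c345; set s := [:: x0; x1; x2; x3; x4; x5] in sS.
  have us : uniq s by apply: uniq_set; rewrite sS S6.
  have col m : size (mask m s) = 3 ->
      c [set x in mask m s] = a \/ c [set x in mask m s] = b.
    move=> m3; have mS : [set x in mask m s] \subset S.
      by rewrite -sS; apply/subsetP=> x; rewrite !in_set => /mem_mask.
    have [|/eqP na] := eqVneq (c [set x in mask m s]) a; [by left|right].
    have m3' : #|[set x in mask m s]| = 3 by rewrite cardsE (card_uniqP _) ?mask_uniq.
    by have [[]|[]] := neutral _ mS m3'.
  have relabel s' : s =i s' -> size s' = 6 -> uniq s' /\ [set x in s'] = S.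
    move=> ss' s6; have eS : [set x in s'] = S.
      by rewrite -sS; apply/setP=> x; rewrite !in_set ss'.
    by split=> //; apply: uniq_set; rewrite eS S6 s6.
  have perm t t' : t =i t' -> [set x : V in t] = [set x in t'].
    by move=> tt'; apply/setP=> x; rewrite !in_set tt'.
  (* The walk goes through 012, 013, 034 and 345; masks 11 and 25 are 013 and 034. *)
  have [//|c013|c013] := col (bits 11); last by exists s.
  have [//|c034|c034] := col (bits 25).
    have [|//|us' eS] := relabel [:: x3; x4; x0; x5; x1; x2].
      by move=> x; rewrite !inE; btauto.
    exists [:: x3; x4; x0; x5; x1; x2]; split=> //.
    by rewrite -c034; congr c; apply: perm => x; rewrite !inE; btauto.
  have [|//|us' eS] := relabel [:: x0; x3; x1; x4; x2; x5].
    by move=> x; rewrite !inE; btauto.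
  exists [:: x0; x3; x1; x4; x2; x5]; split=> //.
  by rewrite -c013; congr c; apply: perm => x; rewrite !inE; btauto.
have [s [us s6 sS]] := seq_of_set S; rewrite S6 in s6.
case: s us s6 sS => [|x0 [|x1 [|x2 [|x3 [|x4 [|x5 []]]]]]] // us _ sS.
have e3 : #|[set x in [:: x0; x1; x2]]| = 3.
  by rewrite cardsE (card_uniqP _) //; move: (mask_uniq us (bits 7)).
have eS : [set x in [:: x0; x1; x2]] \subset S.
  by rewrite -sS; apply/subsetP=> x; rewrite !in_set;
    exact: (@mem_mask _ x (bits 7) [:: x0; x1; x2; x3; x4; x5]).
have f : S :\: [set x in [:: x0; x1; x2]] = [set x in [:: x3; x4; x5]].
  rewrite -sS (set_cat [:: x0; x1; x2]) setDUl setDv set0U.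
  apply/setDidPl; rewrite disjoint_sym.
  apply/pred0P => x /=; apply/negP; rewrite !in_set => /andP[h1 h2].
  by move: us; rewrite -[_ :: _]/([:: x0; x1; x2] ++ [:: x3; x4; x5]) cat_uniq =>
    /and3P[_ /hasPn/(_ x h2)]; rewrite h1.
have := neutral _ eS e3; rewrite f => -[[c1 c2]|[c1 c2]].
  exact: walk sS c1 c2.
apply: walk c2 c1; rewrite -sS; apply/setP=> x; rewrite !inE; btauto.
Qed.
End Labels.

Lemma other_colours (t : 'I_3) : exists a b, uniq [:: a; b; t].
Proof.
have u := rem_uniq t (enum_uniq 'I_3); have s := size_rem (mem_enum 'I_3 t).
have n : t \notin rem t (enum 'I_3) by rewrite mem_rem_uniqF ?enum_uniq.
rewrite size_enum_ord in s; case: (rem _ _) s u n => [|a [|b []]] // _ u n.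
by exists a, b; rewrite -[[:: a; b; t]]/(rcons [:: a; b] t) rcons_uniq n.
Qed.

Lemma third_colour (i k : 'I_3) : i != k -> exists j, uniq [:: i; j; k].
Proof.
have [a [b u]] := other_colours k; have := @cs_all [:: a; b; k] erefl u i.
rewrite !inE => /or3P[]/eqP -> nk.
- by exists b.
- exists a; move: u; rewrite /= !inE !negb_or => /andP[/andP[? ?] /andP[? _]].
  by rewrite eq_sym; apply/and3P; split=> //; apply/andP.
- by rewrite eqxx in nk.
Qed.

(** One step in the enumeration of the triples of a matching: [W] is the set of
    the points already used. *)
Lemma peel (V : finType) (P : pred {set V}) (U W X : {set V}) j :
    X \subset U :\: W -> mt P X j.+1 -> exists g : {set V},
  [/\ #|g| = 3, P g, g \subset X & [/\ #|W :|: g| = #|W| + 3,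
     X :\: g \subset U :\: (W :|: g) & mt P (X :\: g) j]].
Proof.
move=> XW /mtP[g [gX g3 Pg M]]; exists g; split=> //; split=> //.
  have := subset_trans gX XW; rewrite subsetD => /andP[_ d].
  by rewrite cardsU setIC (disjoint_setI0 d) cards0 subn0 g3.
by rewrite -setDDl; apply: setSD.
Qed.

Lemma sv_take (V : finType) (vs : seq V) p k : uniq vs -> size (bits p) <= k ->
  sv vs p \subset [set x in take k vs].
Proof.
move=> us le; apply/subsetP=> x; rewrite in_sv // => /andP[xvs nx].
rewrite inE in_take //; apply: leq_trans le; rewrite ltnNge; apply/negP=> ge.
by rewrite nth_default in nx.
Qed.

Lemma choose_point (V : finType) (e : {set V}) z : #|e| = 3 -> z \in e ->
  exists x y, e :\ z = [set t in [:: x; y]] /\ e = [set t in [:: x; y; z]].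
Proof.
move=> e3 ze; have /eqP/cards2P[x [y [_ exy]]] : #|e :\ z| = 2.
  by have := cardsD1 z e; rewrite ze e3 => -[].
exists x, y; have eD : e :\ z = [set t in [:: x; y]].
  by rewrite exy; apply/setP=> t; rewrite !inE.
split=> //; rewrite -(setD1K ze) eD; apply/setP=> t; rewrite !inE.
by case: (t == x); case: (t == y); case: (t == z).
Qed.

Lemma subsetDU (V : finType) (U W X Y g : {set V}) :
  [disjoint X & Y] -> g \subset X -> Y \subset U :\: W -> Y \subset U :\: (W :|: g).
Proof.
move=> d gX YW; rewrite -setDDl subsetD YW /=.
by rewrite disjoint_sym; apply: disjointWl d.
Qed.

(** * The certificates *)

(** The colours are 1, 2 and 4. The points form consecutive blocks of three, with
    masks 7, 56, 448, 3584 and 28672. When the first six points have no perfect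
    matching avoiding 1 or 2, the first block is coloured 1 and replacing its last
    point by the next one gives a triple coloured 2. The lists [nopm_...] also
    contain unions of the first points with some of the other blocks. *)
Section Certificates.

(** No triple of the first nine points is coloured 4. *)
Definition low9 : seq lit :=
  [seq L (Pos.of_nat m) 3 | m <- iota 1 511 & pop (Pos.of_nat m) == 3].

Local Open Scope positive_scope.

(** Nine points forming the whole vertex set: a six-point set without a perfect
    matching avoiding 1 or 2, and a block coloured 4. *)
Definition facts_nine : seq lit := [:: L 7 1; L 11 2; L 448 4].

Definition nopm_nine : seq lit := [:: L 63 1; L 511 1; L 63 2; L 511 2; L 511 4].

Definition cert_nine : seq (clause * seq ref) :=
[:: ([:: L 352 5],[:: E 4 [:: 11;148;352];E 1 [:: 11;148;352]]); ([:: L 35 3],[:: E 2 [:: 35;28];E 1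
[:: 35;28;448]]); ([::],[:: C 0;C 1;E 2 [:: 7;152;352];E 4 [:: 35;324;152];E 1 [:: 11;324;176];E 4
[:: 7;328;176];E 2 [:: 7;328;176]])].

Lemma valid_nine :
  valid 9%N false nopm_nine facts_nine [:: 1; 2; 4]%num nopm_nine
    cert_nine.
Proof. by vm_compute. Qed.

(** Twelve points forming the whole vertex set: a six-point set without a perfect
    matching avoiding 1 or 2, and two blocks coloured 4. *)
Definition facts_twelve : seq lit := [:: L 7 1; L 11 2; L 448 4; L 3584 4].

Definition nopm_twelve : seq lit := [:: L 63 1; L 511 1; L 3647 1; L 4095 1; L 63 2;
  L 511 2; L 3647 2; L 4095 2; L 4095 4].

Definition cert_twelve : seq (clause * seq ref) :=
[:: ([:: L 42 3],[:: E 2 [:: 21;42;3584];E 1 [:: 21;42]]); ([::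
L 2208 1;L 1544 3;L 321 1;L 2081 2],[:: E 2 [:: 2081;22;1544];E 1 [:: 321;22;1544;2208]]); ([::
L 35 3],[:: E 1 [:: 35;28;448;3584];E 2 [:: 35;28;448]]); ([:: L 1552 4;L 1568 1;L 19 1;L 200 5],[::
C 0;E 1 [:: 19;2308;200;1568];E 4 [:: 35;2308;200;1552]]); ([:: L 1552 5;L 352 1],[:: E 1 [::
11;52;448];E 1 [:: 11;148;352;3584];C 1;C 3;E 1 [:: 11;2180;1552;352];E 4 [:: 35;2180;328;1552];E 2
[:: 131;52;328;3584];E 2 [:: 7;56;448];E 1 [:: 131;324;56];E 4 [:: 131;324;2088;1552];E 4 [::
321;42;2180;1552];E 1 [:: 321;134;56];E 4 [:: 11;324;1552;2208];E 4 [:: 35;324;2184;1552];E 1 [::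
321;14;1552;2208];E 2 [:: 321;138;52];E 4 [:: 2081;138;324;1552];C 2;E 4 [:: 35;2180;1544;336];E 4
[:: 35;148;1544;2368];E 2 [:: 7;2184;336;1568];E 1 [:: 37;138;1552;2368];E 2 [:: 41;134;336];E 1 [::
11;164;1552;2368];E 1 [:: 41;22;448];E 2 [:: 19;164;328];E 2 [:: 7;2088;336;1664];E 2 [::
161;14;336;3584];E 2 [:: 2081;22;1544];C 0;E 2 [:: 37;274;200];E 4 [:: 41;274;2116;1664];E 1 [::
161;274;2116;1544]]); ([:: L 1552 5;L 2084 4],[:: C 0;E 1 [:: 11;52;448];E 4 [:: 7;2184;1552;352];D
52 2184 2;E 4 [:: 11;2180;1552;352];E 2 [:: 7;56;448];E 2 [:: 7;152;352;3584];D 2180 56 1;D 2084 152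
4]); ([:: L 19 3],[:: E 2 [:: 19;44;3584];E 1 [:: 19;44;448]]); ([::
L 1540 2;L 2184 4;L 42 2;L 1552 2;L 2192 2],[:: E 1 [:: 11;52;448];E 2 [:: 321;42;1540;2192];E 2 [::
7;56;448];E 2 [:: 2053;42;1552];E 1 [:: 2053;1538;56];E 4 [:: 321;1538;52;2184]]); ([::
L 1552 2;L 321 2;L 14 2;L 1544 4],[:: E 2 [:: 321;14;176];E 2 [:: 321;14;1552;2208];E 1 [::
11;324;176];C 1;E 4 [:: 19;324;1544;2208]]); ([:: L 1552 3;L 2054 3],[:: E 1 [:: 41;2054;1552;448];E
2 [:: 41;2054;1552;448]]); ([:: L 352 4;L 3073 6;L 38 2;L 336 2;L 22 4],[:: E 2 [::
3073;38;648;336];E 4 [:: 3073;22;648;352]]); ([:: L 352 4;L 1552 3;L 2184 4],[:: C 1;C 4;E 1 [::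
11;52;448];E 4 [:: 19;1540;2184;352];E 1 [:: 11;1540;2096;448];E 2 [:: 7;1544;2096;448];E 4 [::
7;1544;2192;352];C 3;E 1 [:: 321;42;1540;2192];E 4 [:: 321;2178;52;1544];C 2;E 4 [::
321;1538;52;2184];E 4 [:: 321;2054;1544;176];E 1 [:: 2081;14;1552];E 2 [:: 2057;1538;52;448];E 1 [::
11;324;176];E 1 [:: 2057;38;1552;448];E 2 [:: 41;2178;324;1552];E 1 [:: 41;22;448];E 1 [::
2057;322;1540;176];E 1 [:: 41;2178;1540;336];C 0;E 1 [:: 3073;42;532];E 4 [:: 2081;322;532;1160];E 2
[:: 2081;322;532;1160]]); ([:: L 352 3;L 1552 3;L 2178 3],[:: E 1 [:: 13;2178;1552;352];E 2 [::
13;2178;1552;352]]); ([:: L 321 4;L 2178 4],[:: E 1 [:: 11;52;448];E 2 [:: 7;56;448];E 4 [::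
321;2178;52;1544];E 4 [:: 321;2178;1540;56];E 1 [:: 11;1540;2096;448];E 2 [:: 7;1544;2096;448]]);
([:: L 2084 2;L 1540 4;L 1544 2;L 2088 4;L 145 6],[:: E 4 [:: 145;322;1540;2088];E 2 [::
145;322;2084;1544]]); ([:: L 784 5;L 2177 1;L 42 1;L 2184 4],[:: C 12;E 1 [:: 2177;42;1092;784];E 4
[:: 35;1092;2184;784]]); ([:: L 176 5;L 1027 5;L 2120 5],[:: E 1 [:: 1027;772;2120;176];E 4 [::
1027;772;2120;176]]); ([:: L 2120 5;L 131 5;L 2060 2;L 176 5],[:: C 0;E 2 [:: 1027;2060;560];E 1 [::
131;1284;2120;560];E 4 [:: 131;1284;2120;560]]); ([::
L 352 3;L 321 2;L 2084 2;L 2088 4;L 2184 4;L 42 1;L 1544 2;L 2057 4;L 1552 3],[:: C 11;E 1 [::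
11;52;448];E 2 [:: 7;1544;2096;448];E 2 [:: 2051;52;1544;448];E 1 [:: 11;1540;2096;448];E 2 [::
7;56;448];C 3;E 1 [:: 145;14;352;3584];E 2 [:: 2177;14;1552;352];E 2 [:: 145;14;352];E 2 [::
321;14;176];C 2;E 2 [:: 321;14;1552;2208];E 4 [:: 19;1540;328;2208];E 1 [:: 11;324;176];E 4 [::
19;324;2088;1664];E 2 [:: 131;52;328;3584];E 4 [:: 145;1538;324;2088];E 1 [:: 11;2068;352;1664];E 1
[:: 2053;1538;56];E 2 [:: 35;2068;1544];E 1 [:: 35;2060;1552;448];E 2 [:: 2053;50;1544];C 0;E 2 [::
7;2120;784;1184];E 4 [:: 11;324;2576;1184];E 2 [:: 7;1160;2576;352];E 4 [:: 2051;324;1160;560];E 2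
[:: 7;2120;560;1408];E 1 [:: 11;580;2096;1408];E 4 [:: 2057;50;580;1408]]); ([::
L 176 4;L 328 4;L 1030 5],[:: E 4 [:: 2561;1030;328;176];E 2 [:: 7;56;448];E 1 [::
2561;1030;56;448]]); ([:: L 1664 1;L 2177 2;L 262 1;L 1030 2;L 137 1;L 2057 1;L 560 1;L 176 4],[:: E
1 [:: 2057;262;112;1664];E 2 [:: 2177;1030;776;112];E 1 [:: 137;262;560;3136];E 4 [::
7;776;176;3136]]); ([::
L 1664 1;L 2177 2;L 2208 2;L 1538 1;L 1540 1;L 2081 4;L 1030 2;L 1544 4;L 2057 1;L 137 1;L 140 1;L 560 1;L 176 4;L 145 4;L 2096 2;L 152 4],[::
C 0;E 4 [:: 2081;262;152;1600];E 2 [:: 7;392;2096;1600];E 4 [:: 2113;262;1544;176];E 4 [::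
145;262;1544;2144];E 1 [:: 273;1538;140;2144];E 2 [:: 273;1030;584;2208];E 1 [::
2113;1030;392;560];E 1 [:: 11;1540;400;2144];E 4 [:: 2081;1030;584;400]]); ([::
L 560 6;L 2177 6;L 262 6],[:: E 2 [:: 2177;262;1096;560];E 4 [:: 2177;262;1096;560]]); ([::
L 1552 3;L 2088 4;L 2084 6;L 2184 4],[:: E 1 [:: 11;52;448];C 11;E 2 [:: 7;152;352;3584];C 10;E 2
[:: 7;56;448];C 16;C 20;E 1 [:: 11;148;352;3584];E 1 [:: 11;2180;1552;352];C 9;E 2 [::
321;42;148;3584];E 1 [:: 321;134;56];E 2 [:: 2057;134;1552;352];C 4;C 14;E 1 [:: 2177;14;1552;352];E
4 [:: 35;2180;1544;336];E 1 [:: 2081;14;1552];E 1 [:: 145;14;352;3584];E 1 [:: 321;14;1552;2208];E 1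
[:: 49;14];E 2 [:: 41;134;336];E 4 [:: 19;324;1544;2208];E 1 [:: 11;324;176];E 1 [::
41;2054;1552;448];E 2 [:: 137;2054;1552;352];E 1 [:: 131;324;56];E 2 [:: 131;52;328;3584];C 3;E 4
[:: 19;2084;328;1664];E 4 [:: 19;1540;328;2208];E 4 [:: 49;1538;2180;328];E 1 [::
11;1540;2096;448];E 2 [:: 321;1538;140;2096];C 1;C 0;E 1 [:: 41;262;1552;2240];E 4 [::
7;1288;560;2240];E 2 [:: 7;1288;560;2240]]); ([:: L 2192 2;L 1544 2;L 322 3;L 152 1],[:: E 1 [::
37;322;152;3584];E 2 [:: 37;322;1544;2192]]); ([:: L 352 4;L 3080 5;L 50 1;L 321 1],[:: E 1 [::
321;50;644;3080];E 4 [:: 19;644;3080;352];C 18]); ([::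
L 352 4;L 321 5;L 322 1;L 2180 4;L 1544 2;L 2058 4],[:: E 2 [:: 7;56;448];E 1 [:: 11;52;448];E 4 [::
321;1538;2180;56];E 2 [:: 2057;1538;52;448];E 1 [:: 2053;1538;56];E 2 [:: 2053;50;1544];C 0;E 2 [::
7;3080;560;448];E 4 [:: 321;2058;1156;560];E 1 [:: 2057;322;1156;560]]); ([:: L 1552 1],[:: E 2 [::
7;56;448];E 1 [:: 11;2084;1552;448];C 20;C 21;E 1 [:: 11;52;448];E 2 [:: 7;2088;1552;448];C 3;E 2
[:: 7;2184;1552;352];E 1 [:: 11;2180;1552;352];E 1 [:: 11;148;352;3584];E 4 [:: 19;2180;1544;352];E
2 [:: 7;1544;2096;448];E 2 [:: 2051;52;1544;448];E 1 [:: 11;1540;2096;448];E 4 [::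
11;1540;2192;352];E 4 [:: 2051;1540;152;352];C 2;E 4 [:: 145;322;1540;2088];E 2 [::
145;322;2084;1544];E 4 [:: 1537;322;148;2088];E 2 [:: 1537;2058;52];C 0;E 2 [:: 321;38;152];E 1 [::
2057;38;1552;448];E 1 [:: 321;38;152];E 4 [:: 321;1538;2180;56];E 2 [:: 2057;1538;52;448]]); ([::
L 352 4;L 2236 4],[:: C 0;E 4 [:: 11;2180;1552;352];E 1 [:: 11;52;448];E 2 [:: 7;56;448];E 4 [::
7;2184;1552;352];D 2180 56 1;D 52 2184 2]); ([:: L 38 3],[:: E 2 [:: 25;38];E 1 [:: 25;38;3584]]);
([:: L 1216 6;L 560 2;L 532 4],[:: E 2 [:: 7;2312;560;1216];C 27;E 4 [:: 35;532;2312;1216]]); ([::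
L 2208 2;L 1537 1;L 352 1;L 324 1;L 1092 2;L 2180 1;L 200 4;L 1044 4;L 152 1],[:: E 1 [::
1537;2082;324;152];E 1 [:: 1537;26;2180;352];E 2 [:: 769;26;1092;2208];E 4 [:: 769;2082;1044;200]]);
([:: L 352 3],[:: E 2 [:: 7;152;352;3584];E 1 [:: 11;52;448];E 1 [:: 11;148;352;3584];E 2 [::
7;56;448];C 4;C 29;E 2 [:: 7;2184;1552;352];C 2;E 4 [:: 35;324;2184;1552];E 4 [::
321;38;2184;1552];E 1 [:: 131;324;56];E 2 [:: 131;52;328;3584];E 4 [:: 7;328;1552;2208];E 4 [::
131;2084;328;1552];E 1 [:: 321;134;56];E 4 [:: 2081;134;328;1552];E 2 [:: 321;42;148;3584];E 1 [::
11;324;176];E 4 [:: 35;2180;328;1552];C 12;E 1 [:: 21;42];E 2 [:: 321;14;176];E 1 [::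
145;14;352;3584];E 2 [:: 321;1030;536;2208];E 2 [:: 145;1030;2568;352];E 4 [:: 7;2568;176;1344];E 2
[:: 21;522;2208;1344];E 1 [:: 321;522;1044;2208];E 1 [:: 11;2180;560;1344];E 1 [::
11;532;2208;1344];C 1;E 4 [:: 131;532;328;3104];E 1 [:: 2081;262;536;1216];E 1 [::
11;2084;784;1216];E 2 [:: 7;200;784;3104];E 4 [:: 35;1092;2184;784];C 0;E 2 [:: 1537;262;2120;176];E
4 [:: 1537;262;2120;176]]); ([::],[:: C 0;C 5;E 2 [:: 7;2088;1552;448];C 4;D 148 2088 4;E 1 [::
11;148;352;3584];E 4 [:: 7;2184;1552;352];E 2 [:: 7;2184;1552;352]])].

Lemma valid_twelve :
  valid 12%N false nopm_twelve facts_twelve [:: 1; 2; 4]%num nopm_twelve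
    cert_twelve.
Proof. by vm_compute. Qed.

(** The same among more points, when every pair of points misses a colour. *)
Definition facts_twelve_pairs : seq lit := [:: L 7 1; L 11 2; L 448 4; L 3584 4].

Definition nopm_twelve_pairs : seq lit := [:: L 63 1; L 511 1; L 3647 1; L 4095 1; L 63 2;
  L 511 2; L 3647 2; L 4095 2].

Definition cert_twelve_pairs : seq (clause * seq ref) :=
[:: ([:: L 392 2;L 2051 2;L 1540 1],[:: D 448 3584 1;D 448 3584 2;E 1 [:: 11;52;3584];E 2 [::
7;56;448;3584];E 2 [:: 2051;52;392;1600];E 2 [:: 67;52;392;3584];E 1 [:: 67;1540;56;2432];D 1600
2432 4]); ([:: L 2368 3;L 2296 5;L 2112 1;L 1540 1],[:: P 2112 2368 4;E 1 [:: 11;1540;176;2368];P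
2112 2120 2;D 2120 176 2]); ([:: L 2240 1;L 1540 1],[:: D 448 3584 1;E 2 [:: 7;56;448;3584];P 3072
3584 4;P 48 56 2;E 1 [:: 11;1540;304;2240];D 56 2240 1;E 1 [:: 11;52;3584];D 448 3584 2;E 1 [::
2051;1540;56];P 320 448 4;P 384 448 4;C 1;E 2 [:: 7;200;304];P 48 52 1;P 384 392 2;P 384 896 1;P 384
388 1;P 384 385 1;E 1 [:: 67;388;56];P 48 560 4;D 56 896 1;D 392 560 4;P 48 2096 4;D 200 2096 4;E 1
[:: 385;2114;1540;56];D 648 304 2;P 640 648 2;P 2112 2114 1;C 0;D 2368 1664 4;E 2 [::
2051;52;328;1664];P 320 328 2;E 2 [:: 7;2120;304;1664];P 320 336 1;P 2112 2120 2;P 2112 3136 4;D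
3136 896 4;P 640 896 4;E 2 [:: 67;52;3080;896];P 640 672 1;P 3072 3080 2;E 1 [:: 11;3076;336;672];P
3072 3076 1]); ([:: L 1544 2;L 2051 1;L 388 1],[:: E 1 [:: 11;388;112];E 2 [:: 7;56;448;3584];D 448
3584 2;D 448 3584 1;E 2 [:: 7;1544;112;2432];D 1600 2432 4;E 1 [:: 2051;388;56;1600]]); ([::
L 2112 3;L 2113 1;L 1538 2;L 2114 1;L 2096 1],[:: E 1 [:: 11;52;3584];D 448 3584 1;E 2 [::
7;56;448;3584];D 448 3584 2;P 192 448 4;P 2112 2240 4;D 2240 1792 4;E 1 [:: 11;196;2096;1792];P 192
196 1;P 2112 2368 4;P 320 448 4;P 2112 3136 4;D 2114 1792 1;D 2368 1664 4;E 1 [::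
2113;262;56;1664];P 192 200 2;P 258 262 1;E 2 [:: 259;52;200];E 1 [:: 11;324;2096;1664];P 258 259
2;P 320 324 1;P 258 770 4;P 320 2368 2;D 770 3136 4;D 1538 2368 2]); ([:: L 2240 5;L 2096 1],[:: D
448 3584 1;P 192 448 4;D 448 3584 2;D 2240 1792 4;P 192 2240 2;P 192 196 1;E 1 [::
11;196;2096;1792]]); ([:: L 1536 5],[:: E 1 [:: 11;52;3584];D 448 3584 1;P 384 448 4;D 448 3584 2;P
1536 1544 2;P 1536 1537 2;P 1536 1538 2;E 2 [:: 2051;52;1544];E 2 [:: 7;1544;2096];C 2;C 0;E 2 [::
7;1544;304;2240];P 384 388 1;P 384 385 2;E 2 [:: 385;2114;52;1544];D 52 2240 2;E 1 [:: 11;196;304];D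
196 2096 4;P 384 386 2;E 2 [:: 2113;386;52;1544];E 2 [:: 1537;386;52;2120];P 2112 2120 2;C 1;P 2112
2116 1;D 2116 176 1;E 1 [:: 11;2116;304;1664];E 2 [:: 7;1544;176;2368];D 2368 1664 4]); ([::],[:: D
448 3584 1;P 192 448 4;C 0;D 448 3584 2;P 1536 3584 4;P 1536 1540 1;E 1 [:: 11;52;3584];E 2 [::
7;56;448;3584];C 4;E 1 [:: 2051;1540;56];P 192 2240 1;D 2240 1792 4;P 192 200 2;E 2 [::
2051;52;200;1792]])].

Lemma valid_twelve_pairs :
  valid 12%N true nopm_twelve_pairs facts_twelve_pairs [:: 1; 2]%num nopm_twelve_pairs
    cert_twelve_pairs.
Proof. by vm_compute. Qed.

(** A six-point set without a perfect matching avoiding 1 or 2, one block coloured 2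
    and two blocks coloured 4. *)
Definition facts_neutral : seq lit := [:: L 7 1; L 11 2; L 448 2; L 3584 4; L 28672 4].

Definition nopm_neutral : seq lit := [:: L 63 1; L 511 1; L 3647 1; L 4095 1; L 28735 1;
  L 29183 1; L 32319 1].

Definition cert_neutral : seq (clause * seq ref) :=
[:: ([:: L 2568 2;L 2620 1;L 2575 4],[:: E 2 [:: 7;56];E 1 [:: 11;52;448;28672];D 7 2568 2;D 11 2564
1;D 52 2568 2;D 2564 56 4]); ([:: L 4144 1;L 2568 5;L 28168 1],[:: P 2560 2568 2;P 24576 28672 4;P
2560 3584 4;P 2560 2564 1;E 1 [:: 11;2564;4144;25600];P 24576 25600 1;D 2568 25600 4;D 24584 3584
2;P 24576 24584 2]); ([:: L 35 1;L 1579 4;L 19 1;L 3640 3;L 1048 4],[:: E 2 [:: 7;56];E 1 [::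
11;52;448;28672];P 48 52 1;P 48 56 2;D 1048 2592 4;P 48 2096 4;E 1 [:: 19;1036;2592;28672];P 544
2592 4;P 48 560 4;P 1032 1036 1;D 1544 2096 4;D 3080 560 4;E 1 [:: 19;548;3080;448];P 1032 3080 4;D
35 1544 1;P 544 548 1;P 544 546 2;P 1032 1033 2;D 1033 546 2]); ([:: L 2568 2;L 3640 5;L 2620 1],[::
D 2568 1072 2;E 2 [:: 7;56];E 1 [:: 11;52;448;28672];E 1 [:: 11;2564;1072];D 52 2568 2;D 2564 56
4]); ([:: L 200 3],[:: E 2 [:: 7;56];D 56 448 1;P 192 448 2;D 56 448 4;P 192 200 4;D 200 304 2;P 192
196 1;E 1 [:: 11;196;304;28672]]); ([::
L 2184 2;L 2312 2;L 2058 1;L 2057 1;L 2060 1;L 2505 1;L 462 5;L 2127 6;L 14 1;L 2253 4],[:: D 2057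
70 1;D 70 392 2;D 2113 14 1;D 69 2058 1;D 2113 392 4;D 193 2312 2;D 193 2060 1;D 69 2184 2]); ([::
L 2592 1;L 2052 4;L 12 6;L 2060 2;L 2575 3;L 2620 3],[:: P 12 268 1;C 1;P 12 14 1;D 268 2592 1;P 3 7
1;P 10 11 2;E 1 [:: 11;52;448;28672];D 14 448 1;P 3 11 2;P 20 52 1;P 12 76 1;P 12 13 1;P 12 2060 1;E
2 [:: 7;56];P 6 7 1;P 12 28 1;P 5 7 1;P 12 140 1;E 1 [:: 49;14;3584;28672];P 12 44 1;P 24 56 2;E 1
[:: 19;44];P 48 52 1;D 76 2592 1;P 40 56 2;P 36 52 1;P 48 56 2;E 1 [:: 13;50;448;28672];D 19 2060
2;P 3 67 4;P 3 2051 4;E 1 [:: 35;28];P 48 2096 4;E 2 [:: 35;28];E 2 [:: 19;44];E 2 [:: 49;14];P 20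
28 2;P 6 14 2;P 20 532 4;D 2051 28 4;D 140 2592 1;D 50 2060 2;D 67 28 4;D 14 448 4;P 20 2068 4;P 36
44 2;D 13 2066 1;D 2066 200 4;E 2 [:: 13;50];P 6 518 4;D 14 2096 4;D 532 2088 4;P 40 2088 4;D 2068
552 4;P 36 548 4;P 40 42 1;P 5 13 2;P 5 2053 4;D 548 2072 4;D 2057 518 4;P 24 2072 4;P 5 517 4;P 24
26 1;D 2053 200 4;D 2053 522 4;D 2072 448 1;D 42 2068 1;P 2052 2068 1;D 517 2058 4;D 2057 448 1;P
2052 2180 2;P 10 522 4;P 2052 2308 2;D 26 448 1;E 1 [:: 37;26];E 2 [:: 37;26];D 2180 552 2;P 2052
2116 2;D 2308 552 2;D 26 448 4;D 548 2312 4;P 10 138 1;D 2116 552 2;D 548 2184 4;D 548 2120 4;C 0;D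
7 2120 2;D 2051 76 4;D 19 76 2;D 13 82 1;D 82 2184 2;D 82 392 2;D 2058 208 1;D 138 2128 1;D 392 2128
4;D 2312 208 2]); ([:: L 3640 3;L 2564 1;L 12 5],[:: P 12 28 2;P 3 7 1;E 2 [:: 35;28];P 3 11 2;E 1
[:: 35;2564;1048;448];P 3 515 4;P 12 44 2;E 2 [:: 19;44];E 1 [:: 19;2564;1064];D 515 1064 4;C 4]);
([:: L 2568 2;L 2564 1;L 2620 2],[:: E 1 [:: 11;52;448;28672];E 2 [:: 7;56];D 2564 56 1;P 48 52 1;P
48 56 2;C 7;D 56 3584 1;C 4;C 0;D 2564 56 4;P 48 560 4;P 2052 2564 4;D 2060 560 4;P 12 2060 4;C 1;D
28 2592 4;E 2 [:: 35;28];E 1 [:: 35;28]]); ([:: L 168 1;L 44 4;L 1168 2;L 1044 4;L 1148 3],[:: D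
1044 104 4;E 1 [:: 11;52;448;28672];C 4;P 48 52 1;E 2 [:: 7;56];D 44 1104 4;D 104 1168 2;D 168 1104
1;D 200 1072 4;P 48 56 2;P 48 1072 4]); ([::
L 1058 2;L 1027 2;L 12 2;L 1036 6;L 3132 2;L 3640 3;L 25 4;L 26 4;L 28 1;L 3612 3;L 1596 2],[:: E 1
[:: 11;52;448;28672];E 2 [:: 7;56];P 12 1036 1;P 48 52 1;P 48 56 2;P 48 1072 4;P 12 524 4;P 48 2096
4;D 524 3088 4;D 11 3088 1;D 524 1072 4;D 1036 2096 4;D 28 3104 1;D 28 1568 1;D 2072 1568 4;D 1058
2072 2;D 26 3104 4;D 1027 2072 2;D 3074 56 1;D 25 3074 4]); ([::
L 1056 1;L 1496 1;L 3672 3;L 1036 1;L 3736 3;L 1168 2;L 3864 3;L 19 2;L 1044 4;L 3640 3;L 2620 6],[::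
P 3 7 1;E 2 [:: 19;44];P 3 11 2;D 44 2576 1;C 6;E 2 [:: 7;56];P 40 56 2;D 1160 2576 4;P 3 1027 4;D
1288 2576 4;E 1 [:: 11;52;448;28672];D 1096 2576 4;D 56 448 1;D 52 1096 2;P 48 56 2;D 56 448 4;D 19
1288 2;D 1044 200 4;D 1064 2576 4;P 48 52 1;P 48 1072 4;P 40 1064 4;D 1072 448 4;P 40 168 1;P 1056
1064 4;P 1056 1184 2;C 1;D 84 1064 1;D 84 1160 2;D 1036 208 1;D 1288 208 2;D 200 1296 4;D 11 1296
1;P 272 1296 4;D 1027 280 4;D 280 224 2;E 1 [:: 11;276;224];D 1296 224 1;P 272 276 1;P 272 336 2;D
336 1184 2]); ([:: L 2592 4;L 35 2;L 2568 2;L 12 2;L 1044 4;L 3640 3;L 28 1;L 2620 6;L 1055 4],[:: E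
2 [:: 7;56];D 28 3584 1;P 48 56 2;D 1048 2592 4;E 1 [:: 11;52;448;28672];P 24 56 2;D 35 1048 2;P
1040 1048 4;P 24 1048 4;P 48 52 1;P 24 26 1;D 1048 448 1;D 7 1048 2;P 24 280 1;P 48 560 4;P 48 2096
4;E 1 [:: 37;26];D 1544 2096 4;P 24 152 1;P 48 1072 4;D 3080 560 4;P 24 25 1;D 52 3080 2;D 11 1044
1;P 24 88 1;D 1027 28 1;D 52 1544 2;D 88 3584 1;E 2 [:: 37;26];D 1027 56 4;D 280 3584 1;D 152 3584
1;D 1044 2568 2;D 25 1058 1;P 1040 1044 1;P 1040 1168 2;E 1 [:: 25;38;448;28672];P 1056 1058 1;D
2568 1168 2;P 1040 1104 2;D 2568 1104 2;P 1040 1296 2;D 2568 1296 2;E 2 [:: 25;38];C 1;C 0;E 1 [::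
19;44];P 12 44 1;P 12 524 4;D 524 1072 4;P 12 1036 4;D 1036 2096 4;D 524 3088 4;D 11 3088 1;D 28
1568 1;D 2072 1568 4;D 1027 2072 2;D 28 3104 1;D 25 3074 4;D 1058 2072 2;D 3074 56 1;D 26 3104 4]);
([:: L 21504 4;L 13312 2;L 29744 1;L 5124 1],[:: D 3584 28672 1;D 3584 28672 2;E 1 [::
11;52;448;28672];E 2 [:: 7;56];D 10752 21504 4;P 48 52 1;E 1 [:: 11;5124;16432;10752];P 48 56 2;D
16432 13312 2;P 48 8240 4;D 8240 21504 4]); ([:: L 1072 1;L 12292 1;L 13364 4],[:: E 1 [::
11;52;448;28672];D 3584 28672 2;E 1 [:: 11;12292;1072;18944];D 12292 1072 1;D 52 13312 2;D 3584
28672 1;D 18944 13312 4]); ([:: L 5128 4;L 21515 5;L 29708 3;L 12292 4],[:: D 12292 17416 4;D 24580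
5128 4;D 4099 17416 2;E 1 [:: 4099;24580;56;448];E 2 [:: 7;56]]); ([:: L 13312 5;L 1072 1],[:: D
3584 28672 1;P 12288 28672 4;P 12288 13312 2;D 3584 28672 2;P 12288 12292 1;D 18944 13312 4;E 1 [::
11;12292;1072;18944]]); ([::
L 35 2;L 12292 1;L 2564 4;L 2568 2;L 15880 2;L 9259 4;L 1036 1;L 1072 1;L 4116 4;L 5180 4],[:: C 2;D
4116 9248 4;E 1 [:: 11;52;448;28672];E 2 [:: 7;56];P 48 52 1;P 48 56 2;D 12292 56 1;P 48 8240 4;D 11
9248 1;D 5124 8240 4;D 35 9224 2;D 5124 2568 2;D 5124 56 1;D 52 5128 2;D 2564 5128 4;D 4108 3584 1;D
1036 6656 1;D 4108 8240 4;D 9224 6656 4;D 52 12296 2;D 12296 3584 1]); ([::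
L 1036 1;L 7692 6;L 29708 5],[:: D 3584 28672 1;D 3584 28672 2;D 1036 6656 1;D 4108 3584 1;D 6656
25600 4;D 4108 25600 2]); ([:: L 1072 1;L 2564 4;L 16396 3;L 17468 4],[:: D 16396 3584 1;D 16396
1072 1;E 1 [:: 11;52;448;28672];D 16396 3584 2;D 2564 17416 4;D 52 17416 2]); ([::
L 13312 2;L 12292 4;L 5124 1;L 2564 4;L 2568 2;L 12296 2;L 1036 1;L 16396 4;L 29744 1;L 1044 1;L 5180 4],[::
C 6;D 1044 28672 1;P 3 11 2;E 1 [:: 11;52;448;28672];E 2 [:: 7;56];P 48 56 2;D 52 13312 2;D 1036
28672 1;P 3 7 1;D 52 21504 2;P 48 52 1;D 11 21504 1;D 52 12296 2;P 48 16432 4;P 48 8240 4;D 5124 56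
1;D 52 5128 2;P 3 16387 4;D 56 28672 1;P 4104 5128 2;D 16387 5128 4;D 2564 5128 4;C 4;C 1;D 4108
3584 2;D 5124 2568 2;D 5124 16432 4;D 4108 8240 4;D 5124 16432 1;D 5124 8240 4;D 12296 16432 2;D
1044 12320 1;D 12296 16432 4;D 16396 12320 4;D 20488 8240 4;P 4104 12296 4;P 4104 4120 1;P 4104 4136
1;D 8212 4136 1;D 8228 4120 1;D 8212 21504 2;D 8228 20488 2;D 24580 4136 1;D 44 28672 1;D 44 5136
2;D 24580 5136 4]); ([:: L 12292 4;L 2564 4;L 5128 4;L 7692 2;L 1036 1;L 29708 1;L 29744 1],[:: E 2
[:: 7;56];P 48 56 2;P 3 7 1;D 3584 28672 2;D 3584 28672 1;E 1 [:: 11;52;448;28672];D 2564 5128 4;P 3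
11 2;C 2;P 48 52 1;D 1036 6656 1;D 24580 5128 4;P 3 16387 4;D 6656 25600 4;C 5;P 48 8240 4;D 16387
5128 4;E 1 [:: 11;24580;4144];D 11 21504 1;D 4144 25600 2;D 8240 21504 4]); ([::
L 17412 4;L 24068 2;L 12292 4;L 5124 4;L 5128 1;L 7704 2;L 1036 1;L 7692 6;L 29708 1;L 4144 2;L 29744 1;L 7700 2;L 1048 4;L 28 1],[::
D 3584 28672 2;D 3584 28672 1;D 1036 6656 1;D 1048 6656 4;C 3;D 6656 25600 4;E 2 [:: 7;56];E 1 [::
11;52;448;28672];D 17412 6656 4;D 5128 2576 1;P 48 56 2;D 5124 2576 4;D 12292 17416 4;D 4144 25600
2;D 20484 3584 1;P 48 52 1;D 4116 3584 1;D 4116 17416 2;P 48 8240 4;D 20484 1048 4;D 8240 21504 4;D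
28 21504 1]); ([:: L 2592 2;L 18944 2;L 35 2;L 2564 4;L 2568 2;L 2576 2;L 2620 6],[:: P 3 11 2;E 1
[:: 11;52;448;28672];E 2 [:: 35;28];E 2 [:: 7;56];P 12 28 2;P 3 7 1;P 48 52 1;P 12288 28672 4;P 20
28 2;P 48 56 2;D 56 3584 1;D 28 2592 1;P 20 52 1;P 3 1027 4;D 28 3584 1;P 3 8195 4;P 48 560 4;P 20
1044 4;D 1027 28 4;P 48 16432 4;C 10;P 20 4116 4;P 48 2096 4;D 1064 2576 2;D 1048 2592 2;D 4116 1064
4;D 2568 1072 2;C 6;D 2564 1048 4;D 1072 28672 1;D 8195 1064 4;D 2568 13312 2;D 1036 2576 2;D 1044
2568 2;D 1036 2096 4;P 1028 1044 2;D 1036 16432 4;C 5;D 1036 28672 1;C 3;P 12288 12292 1;P 12288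
12296 2;C 2;D 5124 18944 2;P 1028 5124 1;D 5124 2096 4;D 5124 560 4;D 5124 2576 2;P 5120 5124 1;D
5124 2568 2;P 1028 17412 4;C 1;D 52 5128 2;P 5120 5128 4;D 5128 2576 2;D 4108 1072 1;D 1036 4144 1;P
5120 7168 2;D 52 7168 2;P 12 4108 1;C 0;P 12 2060 4;D 6148 1072 1;D 6148 1544 4;D 2060 5632 4;D 1544
2096 2;D 1036 2096 1;D 52 5632 2;D 4612 1072 1;D 52 3080 2;D 4612 3080 4]); ([::
L 5124 4;L 1036 1;L 29708 1;L 2576 2;L 1072 1;L 1044 1;L 4116 4;L 13364 6;L 7700 6;L 1048 4;L 16408 4;L 5180 2],[::
D 3584 28672 2;D 1044 12320 1;E 1 [:: 11;1044;2592;448];D 1048 2592 4;D 1044 6656 1;E 2 [:: 7;56];D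
3584 28672 1;D 56 3584 1;D 1064 2576 2;D 6656 25600 4;D 16408 12320 4;D 4116 1064 4;D 56 28672 1;D
4108 1072 1;D 1036 4144 1;D 4108 25600 2;D 24584 4144 2;D 5124 24584 4]); ([::
L 5152 2;L 6656 4;L 2592 2;L 5124 4;L 1028 1;L 2564 4;L 1064 4;L 7720 2;L 1036 1;L 12 1;L 13356 1;L 8216 4;L 28728 3;L 25628 2],[::
D 2564 1064 4;E 2 [:: 7;56];D 1064 6656 4;P 40 56 2;D 4136 3584 1;D 4136 24592 4;D 1036 24592 1;D
17412 8216 4;P 1028 17412 4;P 1028 1036 2;P 12 1036 4;D 1036 2592 2;P 12 8204 2;D 44 3584 1;P 40 44
1;D 8204 5152 2;D 5124 8232 4;P 40 8232 4]); ([:: L 1064 3;L 12 1;L 1071 1],[:: E 2 [:: 7;56];P 40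
1064 4;P 3 11 2;P 3 7 1;P 40 56 2;D 7 1064 2;P 40 44 1;P 3 35 4;E 1 [:: 19;44];E 2 [:: 19;44];D 35
1036 4;P 12 1036 4;P 12 44 2]); ([::
L 6656 4;L 2592 2;L 5152 2;L 5124 4;L 2564 4;L 1028 1;L 7720 2;L 1064 4;L 4108 2;L 29708 1;L 1036 1;L 12 1;L 4144 2;L 16408 4;L 8216 4;L 28 2],[::
D 3584 28672 2;D 3584 28672 1;E 2 [:: 7;56];D 6656 25600 4;D 4108 25600 2;D 28 25600 2;D 56 28672
1;D 5124 24584 4;D 24584 4144 2;D 16408 12320 4;C 1;D 1036 12320 1]); ([::
L 2592 2;L 7692 3;L 44 1;L 12 1;L 3628 4;L 1072 1;L 5684 4;L 3132 1],[:: E 1 [:: 11;52;448;28672];P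
48 52 1;E 1 [:: 19;44];E 2 [:: 7;56];D 44 3584 1;P 48 56 2;D 1036 2592 2;P 48 2096 4;E 2 [::
19;44];P 12 44 2;D 1036 2096 4;D 52 3080 2;P 12 2060 4;D 4612 3080 4;D 4612 1072 1;D 2060 5632 4;D
52 5632 2]); ([:: L 12 3;L 7692 3;L 1072 1;L 5684 4;L 3132 1],[:: E 2 [:: 7;56];P 48 56 2;P 12 1036
4;E 1 [:: 11;52;448;28672];P 12 2060 4;D 2060 5632 4;P 48 52 1;D 52 5632 2;P 48 2096 4;D 4612 1072
1;D 4612 3080 4;D 1036 2096 4;D 52 3080 2]); ([::
L 5124 6;L 2564 4;L 12292 4;L 2568 2;L 29708 1;L 1036 1;L 12 1;L 2576 2;L 7700 4;L 8216 4;L 16408 4;L 1048 4;L 28 2;L 2592 2;L 1064 5;L 1072 1;L 29744 1;L 5684 4;L 13364 6;L 3640 5],[::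
P 5120 5124 1;D 5124 2568 2;E 2 [:: 7;56];D 56 28672 1;E 1 [:: 11;52;448;28672];C 8;D 52 5128 2;P 48
52 1;P 48 56 2;D 2564 1064 4;P 40 56 2;P 1028 5124 1;D 5124 2576 2;P 48 2096 4;P 5120 5128 4;D 5128
2592 2;P 5120 7168 2;D 4116 3584 1;C 5;D 4116 1064 4;P 5120 5152 2;D 4108 1072 1;D 1036 4144 1;D
5124 2096 4;D 52 7168 2;D 6148 1072 1;C 2;D 1036 6656 1;D 1064 6656 1;D 6148 1544 4;D 1544 2096 2;D
1036 2096 1;C 1;C 0;P 12 8204 2;P 40 44 1;P 40 8232 4;D 8204 5152 2;D 5124 8232 4;D 1036 12320 1;D
16408 12320 4;D 24584 4144 2;D 5124 24584 4;D 1036 28672 2;D 1036 2096 4;D 52 3080 2;D 4612 3080 4;D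
3080 4640 4;D 1044 4640 2;D 4612 1072 1]); ([::
L 2592 2;L 35 1;L 5124 4;L 5128 2;L 12 1;L 3628 4;L 13356 1;L 5135 1;L 29744 3;L 5180 1],[:: P 3 11
2;P 3 7 1;E 2 [:: 7;56];D 7 5128 2;E 1 [:: 11;52;448;28672];P 40 56 2;P 3 4099 4;P 48 52 1;D 52 5128
2;P 48 56 2;D 4099 1036 4;D 1036 2592 2;D 44 3584 1;P 12 1036 4;P 12 8204 2;P 48 1072 4;P 40 44 1;D
4108 1072 4;E 1 [:: 35;4108;24592];P 40 8232 4;D 5124 8232 4;D 24592 5152 4;D 8204 5152 2]); ([::
L 2592 2;L 35 1;L 5124 4;L 2564 4;L 8216 4;L 1064 5;L 2568 2;L 12 1;L 1036 1;L 16408 4;L 29708 1;L 1072 1;L 29744 1;L 2576 6;L 3640 5;L 1048 4;L 28 2],[::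
C 15;E 2 [:: 7;56];D 2564 1064 4;E 1 [:: 11;52;448;28672];D 5124 2576 4;P 12288 28672 4;D 56 28672
1;P 48 56 2;D 52 13312 2;P 48 52 1;P 48 560 4;P 48 16432 4;D 5124 560 4;P 48 8240 4;D 5124 16432 4;D
5124 8240 4;C 17;C 1;P 48 1072 4;C 18;P 12288 12292 1;D 11 5124 1;D 52 21504 2;D 5124 56 1;P 12288
12296 2;D 5124 16432 1;D 12296 16432 2;D 16432 13312 2;D 16408 12320 4;D 1036 12320 1;C 0;C 10;D
4108 3584 2;D 4108 1072 4;E 1 [:: 35;4108;24592];D 28 5152 2;D 24592 5152 4]); ([::
L 35 1;L 2564 4;L 5128 4;L 1036 1;L 7692 2;L 29708 1;L 1072 1;L 29744 1],[:: D 2564 5128 4;D 3584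
28672 2;E 1 [:: 11;52;448;28672];D 3584 28672 1;P 3 11 2;C 11;P 3 7 1;C 18;C 14;P 48 52 1;E 2 [::
7;56];P 3 4099 4;P 48 56 2;E 1 [:: 11;12292;1072;18944];P 48 8240 4;D 4099 52 4;D 24580 5128 4;E 1
[:: 11;24580;4144];D 5128 8240 4;D 18944 13312 4;D 56 13312 1;E 1 [:: 35;24580;4120;3584];D 7 4144
2;D 4120 9248 2;D 35 4116 1;D 4116 9248 4]); ([::
L 2592 2;L 35 1;L 2564 4;L 8216 4;L 2568 2;L 1036 1;L 12 1;L 16408 4;L 2576 2;L 4120 4;L 1048 4;L 28 2],[::
P 3 7 1;E 1 [:: 11;52;448;28672];D 1036 28672 1;E 1 [:: 35;1036;2576;448];D 35 1036 1;P 3 11 2;E 2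
[:: 7;56];D 56 3584 1;C 7;P 3 4099 4;D 1064 2576 4;D 2568 1072 2;D 1072 28672 1;D 1048 2592 2;D 1064
2576 2;P 1032 1048 2;C 1;D 5124 56 1;D 5124 2568 2;D 11 5124 1;C 0;D 52 5128 2;D 7 5128 2;D 4116
1064 4;D 4099 1036 4;P 1032 5128 4;D 4108 1072 4;P 12 1036 4;P 1032 1544 1;D 4108 3584 1;P 1032 3080
1;P 12 44 2;D 4116 1544 1;E 2 [:: 19;44];E 1 [:: 35;532;3080];D 532 5128 2;E 1 [:: 19;2084;1544];D
2084 4120 4;D 1540 4120 4;E 1 [:: 11;1540;2096];D 1544 2096 2;D 6148 1544 4;D 6148 56 1;D 4108 2096
2]); ([::
L 2592 2;L 2564 4;L 5124 3;L 1028 1;L 2568 2;L 1036 2;L 5135 4;L 1072 1;L 2576 2;L 1048 4;L 28 2],[::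
D 1072 28672 1;P 1028 5124 4;D 11 5124 1;D 5124 2568 2;C 18;D 5124 2592 2;P 1028 1044 2;D 7 5128 2;D
2564 5128 4;E 1 [:: 11;52;448;28672];D 1036 2592 2;E 2 [:: 7;56];P 12288 28672 4;P 4104 5128 2;C
21;D 56 3584 1;P 48 56 2;D 5124 56 1;D 4108 3584 1;D 1044 28672 2;P 48 52 1;P 4104 4108 1;P 48 16432
4;P 4104 12296 4;D 56 28672 1;D 52 21504 2;P 48 1072 4;D 12296 16432 4;D 4108 1072 4;D 28 5152 2;P
4128 5152 2;D 1036 4144 2;E 1 [:: 11;24580;4144];D 2564 5152 4;D 4132 3584 1;D 5124 2592 1;P 4128
4132 1;P 4128 12320 4;P 4128 20512 4;D 1048 2592 4;D 1064 2576 2;D 2564 1064 4;D 44 3584 1;D 44 5136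
2;D 24580 5136 4;D 1044 28672 1;D 1044 20512 4;D 5124 16432 1;D 1044 12320 4;D 12296 16432 2;C 20;P
12288 12292 1;P 12288 12296 2]); ([:: L 13312 2;L 5124 1;L 29744 1;L 16432 1;L 21556 4],[:: D 5124
16432 1;E 1 [:: 11;52;448;28672];C 22;D 52 21504 2]); ([::
L 5632 4;L 10752 1;L 35 1;L 2564 4;L 24072 1;L 19980 2;L 12304 2;L 1048 5;L 29720 4],[:: P 20480
28672 4;E 1 [:: 35;20484;1048;10752];D 1048 28672 1;D 17416 12304 2;P 20480 20484 1;D 2564 17416 4;P
16392 17416 2;P 20480 20488 2;D 20488 3584 2;D 16396 3584 1;D 18440 5632 4;P 16392 16396 1;P 16392
18440 4]); ([:: L 35 1;L 2564 4;L 1064 4;L 3640 3;L 3628 2;L 1048 4],[:: P 3 11 2;D 2564 1064 4;P 3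
7 1;P 3 515 4;D 44 3584 1;D 515 1064 4;E 2 [:: 19;44];C 35]); ([::
L 35 1;L 2564 4;L 1032 1;L 3640 3;L 3628 2;L 12 1;L 3087 4;L 1551 4;L 1048 4;L 1086 4;L 2589 6;L 2590 6],[::
E 1 [:: 11;52;448;28672];E 2 [:: 7;56];P 48 52 1;C 0;P 40 56 2;P 48 56 2;P 48 2096 4;C 12;P 40 1064
4;D 1544 2096 4;D 7 1544 2;P 48 560 4;D 11 1540 1;P 40 44 1;P 48 1072 4;D 44 3584 1;D 35 1544 1;D
1027 44 1;D 3080 560 4;D 2568 1072 4;D 7 3080 2;D 21 2568 1;P 1032 3080 4;P 1032 1034 2;D 22 2568
1;D 11 3076 1;E 2 [:: 21;42];E 2 [:: 41;22];D 42 1540 4;D 1034 52 2;D 3076 552 4;D 1027 552 2;D 1030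
56 1;D 41 1538 4;D 1030 552 2;D 1538 44 1]); ([::
L 5120 1;L 35 1;L 2564 4;L 5128 5;L 19980 2;L 12304 2;L 8216 4;L 1048 5],[:: D 3584 28672 2;D 3584
28672 1;P 5120 5128 2;P 5120 5632 4;P 5120 21504 4;P 5120 13312 4;D 10752 21504 4;D 18944 13312 4;D
8216 21504 4;C 2;D 5128 18944 1]); ([:: L 6656 4;L 1048 4;L 29720 5;L 7704 2],[:: D 1048 6656 4;D
3584 28672 1;D 4120 3584 1;D 3584 28672 2;D 4120 25600 2;D 6656 25600 4]); ([::
L 6656 1;L 33 2;L 2564 4;L 6693 2;L 5128 6;L 3080 4;L 1064 1;L 7720 2;L 536 4;L 7179 4;L 1033 1;L 7689 2;L 2613 6;L 7704 2;L 1048 1],[::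
D 1048 6656 1;D 5128 2576 4;D 1033 6656 1;D 2561 5128 4;D 1064 6656 1;D 37 2576 1;P 2049 2561 4;D
3080 4640 4;D 536 7168 4;P 33 37 1;D 11 7168 1;D 2051 5128 2;P 33 4129 4;P 2049 2051 2;P 2049 2053
1;D 2053 4640 1;D 4129 2564 4]); ([::
L 2592 2;L 2561 2;L 33 2;L 2564 4;L 5128 6;L 1033 1;L 536 4;L 7179 4;L 1064 5;L 3080 4;L 1034 1;L 5135 4;L 2576 2;L 9224 4;L 15880 2;L 2613 6;L 1048 5;L 29720 1],[::
D 5128 2576 2;E 2 [:: 7;56];E 1 [:: 11;52;448;28672];D 5128 2592 2;P 48 56 2;P 48 52 1;D 2561 5128
2;D 7 5128 2;D 56 28672 1;P 48 16432 4;D 4101 1034 1;D 4101 2592 2;C 0;C 1;D 9224 6656 4;D 1064 6656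
4;D 5128 24592 4;D 12296 3584 1;D 4136 3584 1;D 12296 16432 4;D 4136 24592 2]); ([:: L 2568 2],[:: P
3 11 2;E 2 [:: 7;56];D 56 28672 1;P 12288 28672 4;P 3 7 1;P 2560 3584 4;E 1 [:: 11;52;448;28672];D
11 3584 1;P 3 2051 4;P 3 4099 4;P 48 56 2;P 3 515 4;D 56 3584 1;P 24 56 2;D 52 2568 2;P 48 52 1;C
35;P 48 49 4;D 2564 56 4;P 48 8240 4;D 49 2564 4;P 48 16432 4;P 48 50 4;P 2560 2564 1;P 2560 18944
2;P 2560 2592 2;P 2560 2576 2;P 2560 2562 2;P 2560 2561 2;C 20;D 2561 52 2;E 1 [:: 35;28];P 33 35
2;P 24 28 1;P 12 28 1;P 24 536 4;D 2562 28 2;D 2561 28 2;P 24 8216 4;P 24 4120 4;P 24 1048 4;P 24 26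
4;P 24 16408 4;P 24 25 4;D 25 2564 4;C 9;D 1036 2592 2;D 1036 18944 2;D 26 2564 4;D 2051 1036 4;D
515 1036 4;D 50 1036 4;P 1032 1036 1;P 1028 1036 1;D 4099 1036 4;C 4;D 2568 1072 2;D 1064 2576 2;C
8;D 1048 2592 2;P 1032 1048 2;D 5124 16432 4;C 27;P 1032 5128 4;D 1048 28672 1;D 2568 13312 2;P 1032
3080 4;D 5124 8240 4;D 1072 28672 1;D 2051 5128 4;D 515 3080 4;D 2561 1034 2;D 1033 2562 2;P 1032
9224 4;D 2564 5128 4;C 0;P 4104 5128 2;C 29;P 12288 12292 1;P 12288 12296 2;P 12288 12304 2;C 3;P
5120 5124 1;C 7;D 12296 16432 2;D 12296 16432 4;P 4104 12296 4;D 12296 3584 1;P 4104 4108 1;D 4108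
3584 1;D 9224 6656 4;D 1036 6656 2]); ([:: L 5120 2;L 5124 6;L 2564 4],[:: P 2560 3584 4;D 3584
28672 2;P 5120 5124 1;P 5120 13312 4;D 3584 28672 1;P 3 11 2;D 18944 13312 4;D 7 18944 2;P 12288
28672 4;C 0;P 2560 2568 2;P 3 7 1;D 2568 13312 4;D 2564 13312 4;D 11 28672 1;P 5120 21504 4;P 2560
2564 1;D 10752 21504 4;D 5124 10752 2;P 3 16387 4;D 12292 3584 1;D 16387 2564 4;D 16387 2564 1;P
12288 12292 1;P 12288 12296 2;D 12296 3584 2;D 12296 3584 1;D 16387 12296 4;D 16387 12296 2]); ([::
L 12296 3;L 13323 4],[:: D 12296 3584 2;P 2560 3584 4;C 1;P 2560 2568 2;D 12296 3584 1;P 2560 2564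
1;E 2 [:: 7;56];D 2568 13312 4;E 1 [:: 1027;2564;56];D 11 13312 1;D 1027 12296 2]); ([::
L 4144 1;L 6708 4],[:: D 3584 28672 2;P 2560 3584 4;C 2;D 3584 28672 1;E 1 [:: 11;52;448;28672];P
2560 2568 2;P 2560 2564 1;E 1 [:: 11;2564;4144;25600];D 6656 25600 4;D 2564 4144 1;D 52 6656 2]);
([:: L 4144 2;L 5124 1],[:: P 24576 28672 4;D 11 5124 1;E 2 [:: 7;56];C 3;P 3 7 1;P 2560 3584 4;P 3
11 2;E 1 [:: 11;52;448;28672];D 56 28672 1;P 24 56 2;P 2560 2568 2;P 48 56 2;P 2560 2592 1;P 2560
18944 1;P 3 4099 4;P 3 8195 4;D 5124 56 1;P 48 52 1;P 2560 2561 1;P 48 4144 4;E 1 [::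
11;5124;24592;2592];P 2560 2562 1;P 2560 2576 1;E 1 [:: 2561;24578;5124;56];P 48 1072 4;P 48 16432
4;E 1 [:: 11;1060;2576;448];E 1 [:: 1029;2562;56;448];P 24576 24578 1;D 24578 2568 4;P 24576 24584
2;P 24576 25088 2;D 24584 4144 2;P 24576 26624 2;D 24584 3584 2;D 12296 16432 4;D 24584 4144 4;C 1;D
2562 24584 1;D 4099 9224 4;D 522 26624 2;D 8195 5128 4;D 9224 18944 1;D 52 5128 2;D 2568 25600 4;D 7
5128 2;D 4108 1072 4;D 1060 4120 4;E 1 [:: 4101;2562;56;25600];D 2561 4108 1;D 4101 522 4;P 24 4120
4;D 1029 4106 4;D 4120 26624 2;D 4120 25088 2;P 24 2072 1;D 4101 2568 4;D 2072 28672 1;D 6152 24592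
4;P 24 536 1;D 517 6152 2;D 536 28672 1;D 4616 24592 4;D 7 4616 2;D 517 4106 1]); ([::
L 12292 4;L 12296 3;L 4104 2;L 24072 1;L 5128 2;L 4108 1;L 5180 6;L 12303 4;L 16911 4;L 12348 4],[::
P 3 11 2;P 12288 28672 4;P 2560 3584 4;D 7 12296 2;D 12296 3584 1;D 12296 3584 2;P 4104 12296 4;E 1
[:: 11;52;448;28672];D 11 12292 1;C 2;P 12288 12292 1;E 2 [:: 7;56];C 4;P 48 56 2;P 48 52 1;P 12288
14336 2;P 4104 4120 1;D 56 28672 1;P 3 7 1;P 12288 12800 2;P 24 56 2;D 2568 13312 4;P 3 16387 4;D 52
12296 2;P 2560 2568 2;P 48 4144 4;P 2560 2592 1;P 2560 18944 1;P 48 8240 4;P 3 4099 4;D 16387 2568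
4;D 4099 9224 4;P 2560 2564 1;E 1 [:: 11;16404;2592;13312];D 9224 18944 1;D 11 18944 1;E 1 [::
11;2564;16432;13312];D 12296 16432 2;D 24584 4144 4;D 16404 12296 2;D 16404 5128 2;D 24584 3584 2;D
20488 8240 4;D 2568 25600 4;D 20488 3584 2;E 1 [:: 35;2564;4120;25600];E 1 [:: 19;4108;2592;25600];D
2568 21504 4;E 2 [:: 19;44];D 44 12304 1;E 2 [:: 35;28];D 28 21504 1;D 28 28672 1;D 44 5136 1;D
16396 5136 4;D 12292 16408 4;P 24 16408 4;D 16408 14336 2;D 16408 12800 2;P 24 536 1;P 24 2072 1;D
2072 28672 1;D 18440 12304 4;D 515 18440 2;D 536 28672 1;D 515 16396 1;D 16904 12304 4;D 7 16904
2]); ([:: L 12296 2;L 28683 5;L 13323 4;L 18951 4],[:: D 3584 28672 1;D 16387 12296 2;E 2 [::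
7;56];P 2560 3584 4;D 3584 28672 2;C 5;P 2560 2568 2;P 2560 2564 1;D 16387 2564 1;E 1 [::
1027;2564;56];D 7 18944 2;D 18944 13312 4;D 1027 12296 2;D 11 13312 1]); ([::
L 8195 1;L 10759 4],[:: E 2 [:: 7;56];D 3584 28672 1;C 6;D 3584 28672 2;P 2560 3584 4;P 2560 2568
2;P 2560 2564 1;E 1 [:: 8195;2564;56;21504];D 8195 2564 1;D 7 10752 2;D 10752 21504 4]); ([::
L 12296 5;L 13323 2],[:: P 3 7 1;P 12288 12296 2;P 3 11 2;P 12288 28672 4;P 3 1027 4;P 12288 13312
1;D 1027 12296 4;D 11 13312 1]); ([:: L 12296 6;L 18951 4],[:: P 3 11 2;P 3 7 1;D 11 28672 1;P 3
1027 4;P 3 16387 4;D 16387 12296 4;C 2;D 1027 12296 4]); ([:: L 2564 4],[:: P 2560 3584 4;E 2 [::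
7;56];P 48 56 2;C 9;E 1 [:: 11;52;448;28672];P 3 11 2;P 2560 2568 2;P 3 7 1;P 48 52 1;P 48 8240 4;P
48 1072 4;P 2560 18944 1;P 48 4144 4;P 2560 2564 1;P 3 16387 4;D 16387 2564 4;P 3 8195 4;C 0;D 2564
4144 4;D 8195 2564 4;C 6;C 2;C 5;P 4100 5124 1;D 5124 2568 4;C 8;P 5120 5128 2;D 52 5128 2;P 5120
7168 2;D 8195 5128 2;C 1;C 7;D 8195 5128 4;D 2564 5128 1;D 524 7168 2;D 4108 3584 2;D 16387 524 4;D
4108 8240 4;P 4104 4108 2;P 4100 4108 2;D 5128 18944 1;D 8195 4108 4;D 4108 1072 4;C 4;P 4100 12292
4]); ([:: L 13323 3],[:: C 0;P 2560 3584 4;P 3 11 2;P 3 7 1;C 10;P 3 8195 4;D 8195 5128 4;D 2564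
5128 1;P 3 4099 4;P 2560 2568 2;D 2564 5128 2;P 2560 18944 1;D 4099 9224 4;D 5124 2568 4;C 6;D 9224
18944 1;C 53]); ([::
L 25088 1;L 26624 1;L 12296 2;L 24584 4;L 4112 1;L 20016 3;L 18996 3;L 28 5],[:: C 0;P 20 28 2;C 9;C
1;E 1 [:: 11;52;448;28672];C 11;P 2560 3584 4;D 28 28672 1;P 2560 2568 2;P 20 52 1;P 20 4116 4;P 20
2068 4;P 2560 2592 1;P 2560 6656 1;D 4116 2568 4;D 28 6656 1;E 1 [:: 11;1044;2592;448];P 2560 2576
1;E 1 [:: 11;1060;2576;448];P 20 16404 4;D 16404 12296 4;D 2068 16928 4;D 16404 12296 2;D 2564 4120
2;D 1044 16928 2;D 4120 26624 1;D 4120 25088 1;P 4112 4120 2;P 4112 4624 4;D 24584 4624 4;P 4112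
6160 4;D 12296 16912 2;D 24584 6160 4;D 1060 16912 4;D 12296 18448 2;D 16404 1568 1;D 18448 1568
4]); ([:: L 31264 3;L 17408 4;L 41 1;L 18483 5;L 19 2;L 18996 3;L 16947 5;L 17459 5],[:: D 19 17440
2;D 19 18464 2;D 18464 12800 4;D 19 16928 2;D 2068 16928 4;P 17408 17440 2;E 1 [::
41;17410;2068;12800];P 17408 17410 1]); ([::
L 18944 2;L 31264 3;L 16393 4;L 18985 1;L 20016 3;L 16400 2;L 18996 3;L 19988 2;L 28 2],[:: E 1 [::
11;52;448;28672];C 13;E 2 [:: 35;28];P 3 11 2;P 2560 2568 2;P 48 52 1;P 2560 3584 4;D 52 2568 4;P 3
7 1;E 2 [:: 7;56];P 2560 2564 1;P 48 56 2;D 2564 56 1;P 48 16432 4;P 48 1072 4;D 56 3584 1;P 3 515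
4;D 515 16432 4;P 3 16387 4;P 48 2096 4;D 28 2592 2;D 16387 1072 4;D 16387 2096 4;D 2568 1072 4;E 1
[:: 11;1044;2592;448];D 16393 2592 4;D 41 18944 2;D 16387 1044 4;D 17424 2592 4;D 7 17424 2;D 35
17424 1;D 2564 17424 1;P 17408 17424 4;P 16400 17424 4;P 16400 18448 1;P 16400 16912 1;D 35 16912
1;D 35 18448 1;C 0;D 19 17412 1;E 1 [:: 19;2564;1064];D 1064 2576 2;D 17412 2576 4]); ([::
L 12296 2],[:: C 4;D 7 12296 2;C 3;P 12288 28672 4;D 3584 28672 1;D 2564 12296 2;C 12;E 1 [::
11;52;448;28672];P 2560 3584 4;P 48 52 1;C 14;P 3 11 2;D 11 28672 1;E 2 [:: 7;56];P 3 7 1;E 1 [::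
11;2564;1072];D 3584 28672 2;D 7 12296 4;P 24576 28672 4;P 3 16387 4;D 11 12292 1;P 12288 12292 1;E
1 [:: 1027;2564;56];P 3 35 4;D 56 28672 1;P 48 56 2;D 16387 12296 4;P 2560 2568 2;P 48 16432 4;P
12288 12290 2;P 12288 12304 2;D 1027 12296 2;D 12296 16432 4;P 12288 12320 2;D 12292 2568 4;P 2560
10752 1;D 12296 16432 2;P 2560 2592 1;P 2560 2561 1;E 1 [:: 11;1044;2592;448];D 2592 28672 1;D 11
13312 1;D 16432 3584 1;P 16400 16432 2;P 2560 6656 1;D 18944 13312 4;D 1072 18944 2;E 1 [::
11;5124;16432;10752];D 16393 12290 2;D 1044 18944 2;D 52 18944 2;D 16424 12304 2;D 1044 2568 4;D
4108 10752 1;D 2564 16432 1;D 35 4108 4;D 12320 18944 2;D 5124 2568 4;D 4108 3584 2;D 2561 16424 1;D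
1036 6656 1;C 0;D 28 3584 1;D 1036 2576 2;E 1 [:: 35;28];D 35 4108 2;D 11 4132 1;D 4132 2576 4;C
11;P 4112 4144 1;D 24584 4144 2;P 24576 24584 2;P 24576 25088 1;P 24576 26624 1;C 2]); ([::
L 10752 2;L 35 2;L 1032 1;L 1036 2;L 4108 2;L 4143 4;L 27184 3],[:: D 35 4108 2;P 3 7 1;C 15;P 12288
28672 4;E 1 [:: 11;52;448;28672];P 20 52 1;D 11 4132 1;C 0;E 2 [:: 35;28];P 12288 12296 2;E 2 [::
7;56];P 24576 28672 4;P 12288 12304 1;P 3 11 2;P 2560 2568 2;C 5;D 28 28672 1;P 12288 13312 1;P 2560
3584 4;P 3 515 4;D 1036 10752 2;P 48 52 1;D 28 3584 1;P 2560 2561 1;P 20 28 2;D 56 28672 1;P 2560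
2576 1;P 12288 12292 1;E 1 [:: 11;2564;16432;13312];P 20 21 4;P 48 56 2;D 12296 16432 4;D 2561 28
1;P 20 16404 4;E 1 [:: 16387;12292;56;448];P 2560 2592 1;D 21 2568 4;D 25 2564 2;E 1 [::
11;1060;2576;448];D 12304 2592 1;P 48 2096 4;E 1 [:: 11;1044;2592;448];D 16404 12296 4;D 1060 2568
4;D 1044 2568 4;D 1036 2576 2;D 2564 1048 2;D 4108 24592 2;D 515 24592 4;D 24592 2592 4;D 4132 2576
4;C 12;D 1036 2592 2;D 24584 4144 2;P 1032 1048 2;D 44 3584 1;D 4144 10752 2;P 1032 9224 4;P 24576
24584 2;D 24584 2096 4;P 24576 25600 1;E 2 [:: 19;44];D 9224 16432 4;P 24576 26624 1;P 24576 25088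
1;D 56 25600 1;P 24576 24578 1;D 19 25088 1;D 9224 16432 2;D 2564 9224 1;D 56 26624 1;D 16387 8720
2;D 8720 6176 4;D 10248 16432 2;E 1 [:: 25;24578;1540;6176];D 1540 10248 4]); ([::
L 10752 2;L 9216 4;L 35 1;L 7720 5;L 14888 5;L 10794 4;L 27160 3;L 14860 3;L 4144 2;L 13368 5;L 8731 5],[::
P 2560 3584 4;D 4144 10752 2;E 1 [:: 11;52;448;28672];P 48 52 1;E 2 [:: 7;56];P 24576 28672 4;D 56
28672 1;C 16;P 48 56 2;C 1;P 12288 28672 4;P 48 2096 4;P 48 8240 4;P 2560 2568 2;P 2560 2592 1;P
12288 12296 2;P 12288 13312 1;P 48 16432 4;P 12288 12304 1;P 2560 2562 1;D 12296 16432 4;P 2560 2564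
1;D 12304 2592 1;D 24584 4144 2;P 24576 24584 2;E 1 [:: 11;2564;16432;13312];D 24584 2096 4;D 8240
6656 4;P 24576 25600 1;D 8232 6656 2;P 24576 26624 1;D 1064 6656 2;D 2562 8232 1;D 42 10752 2;E 1
[:: 35;2564;4120;25600];D 4120 9248 2;D 56 26624 1;E 1 [:: 19;2564;1064];P 9216 9248 2;D 19 8712 2;D
10248 16432 2;P 9216 9217 1;D 6148 8712 4;E 1 [:: 9217;42;6148;16912];D 10248 16912 4]); ([::
L 5128 2;L 7692 4;L 4100 1],[:: C 2;P 3 11 2;D 11 28672 1;P 3 7 1;E 1 [:: 11;52;448;28672];P 3 16387
4;C 9;P 48 52 1;P 12288 12296 2;C 7;D 3584 28672 2;P 2560 3584 4;E 2 [:: 7;56];P 12288 28672 4;D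
3584 28672 1;P 24 56 2;C 17;D 16387 12296 4;P 3 515 4;P 20480 28672 4;P 3 35 4;P 48 56 2;D 8195 5128
2;D 2564 12296 1;E 1 [:: 1027;2564;56];D 2564 5128 2;D 56 28672 1;D 2564 56 1;D 52 2568 4;P 12288
13312 1;P 12288 12292 1;P 2560 2568 2;D 8195 3584 1;P 48 8240 4;E 1 [:: 8195;2564;56;21504];P 2560
2576 1;P 2560 2562 1;D 2564 5128 1;D 4108 3584 1;D 12292 56 1;D 35 4108 4;P 2560 2592 1;D 56 13312
1;P 2560 6656 1;P 20480 21504 1;P 20480 20481 2;P 2560 18944 1;E 1 [:: 11;12292;2576;17440];E 1 [::
11;2564;16432;13312];D 10752 21504 4;D 12296 2592 1;D 5128 8240 4;D 4108 10752 2;D 12292 2568 4;D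
12296 17440 4;D 1036 6656 1;D 4108 8240 4;D 4108 8240 2;D 12296 16432 4;D 16432 10752 2;P 20480
20488 2;P 8208 8240 2;D 1027 10752 2;D 20481 8202 2;D 8240 18944 1;P 4100 12292 4;D 515 11264 4;P
1032 1036 1;P 4100 4132 2;D 4132 8216 2;P 9216 11264 4;C 1;E 1 [:: 35;12292;16408;3584];E 1 [::
35;28];D 8216 18944 1;D 16408 10752 2;D 28 2592 2;D 12296 2592 4;P 24 28 1;D 24592 2592 4;D 8202
2592 4;D 5128 2592 4;D 4136 24592 2;P 24 536 4;D 8195 536 4;P 24 2072 4;P 8208 24592 4;P 8208 8720
1;D 4136 3584 1;D 8195 2072 4;D 11 8720 1;P 8208 10256 1;D 11 10256 1;C 0;E 1 [::
11;2564;4144;25600];D 6656 25600 4;D 8232 6656 2;D 2562 8232 1;D 1064 6656 2;D 42 10752 2;D 1064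
28672 1;E 1 [:: 19;2564;1064];D 19 8712 2;D 20488 9248 2;D 19 10248 2;D 6148 8712 4;P 9216 9248 2;D
10248 16912 4;P 9216 9217 1;E 1 [:: 9217;42;6148;16912]]); ([:: L 5124 6],[:: P 4100 5124 1;P 5120
5124 1;P 12288 28672 4;D 3584 28672 1;P 2560 3584 4;D 3584 28672 2;C 3;P 20480 28672 4;C 18;D 5124
2568 4;P 2560 2568 2;P 2560 2564 1;P 12288 12296 2;P 2560 2592 1;P 12288 12304 1;C 0;D 2564 5128 1;P
5120 5128 2;P 5120 13312 4;P 5120 5632 4;E 1 [:: 11;16420;12304;3584];D 18944 13312 4;D 5124 18944
2;E 1 [:: 11;17412;12304;2592];P 5120 21504 4;D 5128 18944 1;D 2568 21504 4;P 16388 16420 1;D 17412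
2568 4;D 20488 3584 2;P 20480 20488 2;P 20480 20484 1;D 20484 3584 1;D 18436 5632 4;D 17412 6656 4;P
16388 18436 4;P 16388 16396 2;D 1036 6656 2;D 16396 3584 2;D 1036 18944 1]); ([:: L 1036 5],[:: C
0;D 3584 28672 2;E 1 [:: 11;52;448;28672];D 3584 28672 1;P 1028 1036 2;P 24576 28672 4;E 2 [::
7;56];C 19;C 15;P 2560 3584 4;C 9;E 1 [:: 11;2564;4144;25600];D 6656 25600 4;P 36 52 1;P 2560 2568
2;P 2560 2576 1;P 2560 18944 1;E 1 [:: 11;5124;2576;24608];P 2560 2561 1;P 2560 2592 1;P 2560 10752
1;E 1 [:: 2561;1030;56;448];E 1 [:: 2561;24578;5124;56];P 1028 1030 1;E 1 [:: 11;1060;2576;448];D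
1060 6656 2;E 1 [:: 19;1036;2592;28672];D 2568 24608 4;P 24576 24578 1;D 5124 2592 1;P 24576 24584
2;P 1028 5124 4;E 2 [:: 19;44];D 5124 2592 4;P 36 44 2;P 36 8228 4;D 44 10752 1;D 8228 2568 4;D
24584 2592 2;D 8232 18944 1;D 2564 8232 2]); ([:: L 28 5],[:: C 5;D 3584 28672 2;C 1;E 1 [::
11;52;448;28672];P 3 7 1;C 16;C 20;P 2560 3584 4;D 3584 28672 1;C 0;C 17;E 2 [:: 7;56];P 20 28 2;P
2560 2568 2;P 20 52 1;P 24576 28672 4;C 12;P 3 11 2;P 3 2051 4;P 2560 2561 1;D 2568 28672 1;E 1 [::
2561;24578;5124;56];P 2560 2564 1;P 2560 18944 1;P 20 532 4;E 1 [:: 8195;5124;56;18944];E 1 [::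
1027;2564;56];D 8195 5128 2;P 24576 24578 1;D 532 5128 4;D 2051 5128 4;E 1 [:: 11;2564;4144;25600];D
2564 5128 1;P 5120 5128 2;P 24576 24584 2;D 6656 25600 4;D 24584 6656 2;D 1036 6656 2;D 5124 2568
4;P 5120 5124 4;P 5120 7168 1;P 5120 5632 1;P 5120 5136 1;D 28 5632 1;D 11 7168 1;D 1036 4624 2;D
2084 4624 4;E 1 [:: 11;2084;5136;25088];D 1027 6152 2;D 6152 25088 4]); ([::],[:: C 2;P 24576 28672
4;P 3 11 2;E 2 [:: 7;56];D 3584 28672 1;P 2560 3584 4;P 12288 28672 4;E 1 [:: 11;52;448;28672];D
3584 28672 2;C 6;D 7 12296 4;C 21;C 0;C 17;P 2560 2568 2;C 13;P 48 52 1;P 3 7 1;C 1;P 2560 2564 1;P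
48 56 2;E 2 [:: 35;28];P 48 49 4;D 49 2568 4;P 2560 2576 1;P 3 2051 4;P 2560 18944 1;P 12288 12296
2;D 2568 28672 1;E 1 [:: 35;2564;1048;448];P 3 515 4;P 12288 12292 1;E 1 [:: 1027;2564;56];P 2560
2561 1;E 1 [:: 11;2564;4144;25600];E 1 [:: 8195;5124;56;18944];D 11 12292 1;D 8195 4108 2;E 1 [::
2561;24578;5124;56];D 6656 25600 4;D 2561 56 1;P 24576 24578 1;P 24576 24584 2;D 1036 6656 2;D 8195
5128 2;D 515 5128 4;D 1048 6656 2;P 4100 4108 2;D 2051 5128 4;D 5128 2576 1;P 5120 5128 2;D 24584
6656 2;D 2564 5128 1;D 5128 2576 4;D 5124 2568 4;P 5120 5124 4;P 4100 5124 4;P 5120 7168 1;D 41 2576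
2;P 5120 5632 1;P 4100 4102 1;D 11 5632 1;D 11 7168 1;D 1027 6152 2;D 6152 25088 4;D 1027 4616 2;E 1
[:: 41;4102;3088;25088];D 4616 3088 4])].

Lemma valid_neutral :
  valid 15%N true (L 63 2 :: nopm_neutral) facts_neutral [:: 1]%num nopm_neutral
    cert_neutral.
Proof. by vm_compute. Qed.

(** Nine points without the colour 4, forming blocks coloured 1, 2 and 2, and two
    blocks coloured 4. A pair of triples coloured 1 exchanges a point of the first
    block with one of the second block, another pair exchanges the same point with
    one of the third block. No union of the first block with one or two others has
    a perfect matching avoiding 1. *)
Definition facts_same_point : seq lit :=
  ([:: L 7 1; L 56 2; L 448 2; L 3584 4; L 28672 4; L 11 1; L 67 1; L 52 1; L 388 1] ++
  low9).

Definition nopm_same_point : seq lit := [:: L 63 1; L 455 1; L 511 1; L 3591 1; L 3647 1;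
  L 4039 1; L 28679 1; L 28735 1; L 29127 1; L 32263 1].

Definition cert_same_point : seq (clause * seq ref) :=
[:: ([:: L 11140 1;L 2564 6],[:: P 2560 2564 1;P 384 448 2;P 384 388 1;P 2560 3584 4;P 384 8576 4;D
2564 8576 4;P 2560 10752 2;D 388 10752 2]); ([::
L 2816 4;L 2561 2;L 2176 1;L 2499 6;L 4032 3;L 2883 6;L 2568 2;L 49 2],[:: P 48 52 1;D 1216 2816 4;D
49 1216 2;P 65 67 1;P 384 448 2;P 48 56 2;P 48 1072 4;P 384 388 1;P 192 448 2;D 56 3584 1;D 2561
1216 2;P 192 1216 4;P 384 1408 4;P 192 193 1;D 67 1408 4;D 11 1216 2;P 65 193 2;D 2624 1408 4;D 259
2624 1;D 193 1072 4;D 193 3584 1;P 192 194 1;P 65 1089 4;P 48 560 4;P 384 2432 4;D 2305 194 1;D 193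
1072 1;D 259 1216 2;D 2568 1072 2;D 2305 1216 2;D 1089 2688 4;D 1027 448 1;D 1089 2432 4;P 2176 2688
4;D 3080 560 4;D 1027 200 4;D 193 3080 1;D 3073 448 1;D 1033 194 1;P 2176 2240 2;D 1033 2240 2;D
3073 200 4]); ([:: L 1664 4;L 2305 1;L 4032 3;L 2308 1;L 1544 2;L 2379 4],[:: P 48 52 1;P 320 448
2;P 48 56 2;P 384 448 2;D 2368 1664 4;P 48 1072 4;P 384 388 1;D 52 2368 2;P 320 2368 4;D 11 2368 2;P
48 2096 4;P 384 2432 4;D 1600 2432 4;D 2305 74 1;D 56 1600 1;P 320 328 1;P 72 328 2;D 324 2096 4;P
72 74 1;P 72 584 4;D 584 1072 4;D 2308 112 1;D 1544 112 2]); ([::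
L 2176 1;L 2304 1;L 3012 2;L 2564 1],[:: P 48 52 1;P 48 56 2;P 48 2096 4;P 384 388 1;D 196 2096 4;D
56 448 1;D 2564 448 1;P 384 448 2;D 392 112 4;D 268 2096 4;P 48 560 4;P 384 896 4;P 384 2432 4;D 196
2816 4;D 76 560 4;D 324 2688 4;P 2304 2816 4;P 2176 2688 4;D 580 2432 4;P 2176 2240 2;P 2304 2312
2;D 580 56 1;D 52 2240 2;D 2116 896 4;D 580 2312 2;D 52 2312 2;D 52 584 2;D 2116 176 1;D 2308 56 1;D
328 176 2;D 2308 584 4;D 2564 328 1]); ([::
L 26624 1;L 4608 6;L 17152 4;L 31488 2;L 1540 1;L 18436 4;L 31236 2;L 3076 2;L 15876 4],[:: P 4608
4612 1;D 4612 26624 1;P 4608 4864 1;D 4864 26624 1;D 18436 12800 4;D 3076 12800 2;D 1540 14336 1;D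
17152 14336 4]); ([::
L 4608 3;L 29568 1;L 5632 4;L 26624 1;L 28164 1;L 3076 4;L 2564 2;L 10244 4;L 31236 2;L 30212 1;L 11264 2],[::
P 4608 6656 4;P 4608 20992 4;D 3584 28672 2;D 388 28672 2;P 384 388 1;P 384 448 2;D 10244 5632 4;D
10244 20992 4;P 384 16768 4;D 3584 28672 1;D 4612 26624 1;D 6656 25600 4;D 4612 25600 2;D 2564 25600
2;P 384 8576 4;D 24580 5632 4;D 8576 20992 4;D 4612 11264 2;D 3076 25088 4;D 12292 3584 1;D 4480
25088 2;D 12292 16768 4;D 24580 4480 1]); ([::
L 26624 1;L 11264 2;L 2304 1;L 2176 1;L 19844 6;L 30212 1;L 11652 6;L 3076 6;L 1540 1;L 3200 2;L 4608 2;L 768 2;L 29568 1;L 5632 4;L 2624 2;L 4032 5;L 10240 4;L 2432 2;L 27520 1;L 8064 4],[::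
D 388 2624 2;D 2624 1408 2;C 2;D 10244 1408 1;P 384 448 2;P 10240 10244 1;P 2560 3584 4;D 10244 5632
4;C 5;D 2564 28672 2;P 2560 2564 1;D 1540 26624 1;D 18436 1408 1;P 384 388 1;P 2560 2816 2;P 10240
10368 2;C 0;P 4608 6656 1;D 2816 28672 2;P 384 16768 4;D 1408 6656 1;C 1;D 10368 17152 2;P 4608 4612
1;D 16768 10752 4;P 768 17152 4;D 3200 4864 2;D 4480 3584 2;D 4612 26624 1;D 4480 10752 1;P 768 772
1;D 772 10368 1;D 18436 12800 4;D 10368 4864 4;D 2432 12800 2]); ([::
L 5632 5;L 896 1;L 2432 2;L 29568 1;L 768 2;L 3200 2;L 1540 1;L 3076 6;L 11652 6;L 30212 1;L 19844 6;L 2053 4;L 1538 1;L 4032 5;L 2112 1;L 30272 1;L 3651 6;L 2176 1;L 2304 1;L 11264 2],[::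
P 384 448 2;P 2560 3584 4;P 384 388 1;P 5120 5632 2;D 3584 28672 1;P 4608 5632 2;P 24576 28672 4;D
3584 28672 2;D 2053 5632 4;P 384 2432 4;P 384 8576 4;D 2432 5632 4;D 5632 26624 4;D 448 26624 1;D
896 26624 1;P 10240 26624 4;E 1 [:: 4101;1538;26624];C 0;P 2112 2624 2;P 2560 2624 2;D 4101 3584 2;P
2112 18496 4;P 2560 2562 1;D 18496 8576 4;P 2560 2564 1;D 1089 2562 1;D 5121 2564 1;P 5120 5121 1;D
24640 2432 2;P 5120 7168 4;D 1089 28672 2;D 24640 5632 4;D 5121 24640 4;P 24576 24640 2;D 25088 7168
4;P 24576 24577 1;D 24577 5184 1;D 5184 25088 2]); ([::
L 2624 5;L 1985 5;L 6080 5;L 10176 5;L 3972 6;L 1986 5;L 3651 6;L 7745 2;L 1538 1;L 5699 2;L 1537 1;L 1600 1;L 18368 5],[::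
D 3584 28672 1;D 3584 28672 2;D 1027 2624 1;P 2560 3584 4;P 2560 2624 2;P 2560 2564 1;D 2564 1408
1;D 577 1408 2;D 16960 1408 2;D 577 28672 1;D 578 1408 2;D 4672 1408 2;D 8768 1408 2;D 1027 4672 4;P
4160 4672 2;D 3073 578 1;D 4161 1538 1;D 3073 4672 4;P 4160 4161 1;D 6145 1600 1;D 6145 16960 4;D
577 7168 1;P 4160 12352 4;D 1537 6208 1;D 25088 7168 4;D 4161 25088 2;D 20481 8768 4;D 16897 12352
4;D 16897 6208 2;D 20481 2624 1]); ([::
L 26624 1;L 2688 2;L 896 1;L 27520 2;L 28164 2;L 10244 4;L 1540 1;L 18436 4;L 2116 2;L 11844 4;L 3780 4;L 11076 4;L 1988 5;L 20036 4;L 1216 1;L 2816 2],[::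
D 1540 26624 1;D 896 26624 1;P 384 448 2;D 10244 17920 4;P 384 388 1;P 384 16768 4;D 18436 9728 4;D
2116 17920 2;D 16768 10752 4;P 384 8576 4;D 2116 9728 2;D 8260 3584 1;D 8260 2816 2;D 1540 18496 1;D
8576 18944 4;D 1092 10752 1;D 324 10752 1;D 1216 18944 1;D 324 1664 2;D 1092 2688 2;D 18496 1664 4;D
1540 2240 1;D 2240 17920 2]); ([::
L 5632 2;L 25088 3;L 2816 2;L 2432 2;L 18436 4;L 10244 4;L 1540 1;L 3076 2;L 2688 2;L 896 1;L 4032 5;L 6208 4;L 1216 1;L 1600 4;L 832 4;L 1988 5;L 3780 4;L 2116 2;L 3136 2;L 2624 2;L 704 4],[::
D 18436 1600 4;P 384 448 2;D 10244 1600 4;D 10244 832 4;D 448 28672 1;D 3136 25088 2;D 2432 25088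
2;D 3076 25088 2;P 384 388 1;P 24576 28672 4;P 384 4480 4;C 0;D 832 26624 4;D 1600 26624 4;D 704
26624 4;P 24576 26624 1;D 24640 3584 1;D 24640 4480 4;P 24576 24704 2;D 24640 2816 2;D 2368 25088
1;D 4416 24704 2;D 2624 24704 2;D 4416 3584 1;D 2368 5632 2;D 6208 1792 4;D 2240 25088 1;D 2240 1792
2]); ([:: L 4032 5;L 2051 4;L 3076 6;L 1540 1],[:: D 3584 28672 1;P 384 388 1;P 1536 3584 4;P 2560
3584 4;D 3584 28672 2;D 67 3584 2;D 1540 28672 1;D 1540 448 1;D 388 3584 2;P 3072 3584 4;P 384 448
2;P 384 8576 4;P 3072 3076 1;P 384 16768 4;P 3072 19456 2;P 3072 3136 2;P 384 4480 4;P 3072 3200 2;P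
3072 3328 2;D 3076 16768 4;P 384 1408 4;D 3076 4480 4;P 3072 11264 2;D 3136 896 2;D 704 3328 2;P
3072 7168 2;D 388 19456 2;D 3076 8576 4;D 388 7168 2;D 832 3200 2;D 3076 704 4;D 388 11264 2;D 896
28672 1;P 768 896 2;D 3076 896 4;D 1540 2432 1;P 2304 2432 1;D 1600 2432 2;D 1600 8576 4;D 386 1600
4;D 388 1600 4;D 385 1600 4;D 1600 16768 4;P 2176 2432 1;D 1600 4480 4;D 1600 28672 1;D 2051 1600
4;P 1536 1600 2;P 1536 1792 1;P 1536 5632 1;P 1536 17920 1;D 2180 1792 1;D 448 5632 1;P 1536 1537
1;D 2180 832 4;P 1536 1538 1;P 1536 9728 1;D 1537 448 1;D 1538 448 1;D 448 17920 1;D 2113 1538 1;D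
448 9728 1;E 1 [:: 2053;1538];P 2112 2113 1;C 3;D 67 5632 2;D 2113 5632 2;C 2;D 2624 1408 2;D 388
2624 2;D 6148 1408 1;D 18436 1408 1;C 7;D 6148 1600 4;D 2116 896 1;D 10244 1408 1;P 2560 2564 1;D
2116 5632 2;D 4164 3584 1;D 4164 3328 2;D 4164 3200 2;P 2560 2816 2;P 2560 2688 2;D 1540 6208 1;D
6208 1408 4;D 1216 2816 2;D 1344 2688 2;D 6148 1216 4;C 0;D 6148 1344 4;D 25088 7168 4;D 324 7168
1;D 196 7168 1;D 448 7168 1;D 4416 3200 2;D 196 1792 2;D 1540 4416 1;D 324 5632 2;D 4164 1792 4]);
([::
L 3136 1;L 1089 1;L 9280 4;L 5632 2;L 2113 2;L 7745 4;L 1538 1;L 5699 4;L 29761 1;L 1537 1;L 4160 2;L 17472 4;L 1600 1],[::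
D 3584 28672 1;D 67 5632 2;D 2113 5632 2;D 3584 28672 2;D 4161 1538 1;D 1537 6208 1;P 4160 4161 1;D
1089 6656 1;D 6145 1600 1;P 4160 12352 4;D 6656 25600 4;D 6145 17472 4;D 4161 25600 2;D 17409 12352
4;D 20481 9280 4;D 17409 6208 2;D 20481 3136 1]); ([::
L 2432 2;L 4032 5;L 2051 4;L 3012 2;L 1540 1;L 515 4],[:: P 384 448 2;D 67 3584 2;C 1;D 3584 28672
1;D 388 3584 2;D 3584 28672 2;P 24576 28672 4;P 3072 3584 4;P 384 388 1;P 384 1408 4;D 1600 2432 2;P
384 16768 4;P 1536 3584 4;P 384 896 4;P 384 4480 4;D 1600 4480 4;D 2051 1600 4;D 1600 16768 4;D 1600
28672 1;P 384 2432 4;P 1536 1600 2;D 385 1600 4;P 384 8576 4;P 2304 2432 1;P 1536 17920 1;P 1536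
5632 1;P 2176 2432 1;D 1600 8576 4;D 448 5632 1;P 1536 1537 1;P 1536 9728 1;P 1536 1538 1;C 9;D 448
17920 1;D 2564 1408 4;D 2113 1538 1;D 448 9728 1;D 3076 896 1;D 2113 896 2;D 3136 896 2;D 1537 448
1;D 1089 896 2;D 17472 896 2;D 5184 896 2;P 2112 2113 1;P 2112 3136 2;D 9280 896 2;D 2113 896 4;P
2112 18496 4;P 3072 3136 2;P 4160 5184 2;D 1089 28672 1;D 18496 8576 4;D 515 5184 4;D 2561 448 1;P
3072 3074 1;D 2561 5184 4;C 0;D 577 3074 1;D 2051 5632 4;D 577 28672 2;P 4608 5632 2;D 5632 26624
4;E 1 [:: 4099;1540;26624];D 448 26624 1;D 24640 2432 2;D 4099 3584 2;P 24576 24640 2;D 24640 5632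
4;P 24576 24577 1;D 4609 3074 1;D 4609 24640 4;P 4608 4609 1;D 24577 4672 1;D 4672 25600 2;P 4608
6656 4;D 6656 25600 4]); ([:: L 4032 5;L 2051 4;L 3012 2;L 515 4;L 1540 1],[:: P 192 448 2;C 0;D 388
3584 2;P 384 388 1;D 1540 2432 1;P 384 448 2;P 2176 2432 2;P 2304 2432 2;P 384 1408 4;D 2564 1408
4;D 2564 448 1;D 196 2816 4;D 324 2688 4;P 2304 2816 4;D 1216 2816 2;P 2176 2688 4;D 580 2432 4;P
2176 2178 1;D 2178 580 1;P 2304 2305 1;E 1 [:: 2305;518;1216];E 1 [:: 2305;194;1540];D 194 2564 2;P
192 194 1;D 518 2240 4;P 192 2240 4]); ([::
L 2112 2;L 1089 6;L 1090 2;L 3010 5;L 1540 1;L 1028 1;L 3972 3;L 3076 1;L 3654 4;L 2562 1;L 3524 1;L 1988 1;L 3653 4],[::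
P 384 448 2;P 1536 3584 4;P 384 388 1;P 384 1408 4;P 384 2432 4;D 2564 1408 4;D 1090 2564 2;P 384
896 4;D 2562 1092 1;D 1092 896 4;D 1092 2432 4;D 2114 1540 1;D 388 1600 2;D 1089 2564 2;P 2112 2114
1;P 1536 1600 2;D 3076 896 4;D 2113 1540 1;P 2112 3136 4;D 133 3136 4;P 1536 1537 1;P 1028 3076 4;D
262 3136 4;P 1028 1284 2;P 1028 1156 2;D 2114 1284 2;D 2113 1156 2;D 1284 2240 2;D 322 3076 1;D 193
3076 1;D 193 3584 2;D 322 2688 2;D 1537 2240 1;D 1089 2688 4]); ([:: L 4032 5;L 1540 1],[:: P 2560
3584 4;D 388 3584 2;P 1536 3584 4;E 1 [:: 2051;1540;448];D 1540 448 1;D 67 3584 2;C 4;E 1 [::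
515;3076;56];D 3076 448 1;C 1;D 388 2624 2;P 2560 2624 2;D 386 2624 4;D 385 2624 4;P 2112 2624 2;P
2560 2564 1;P 2560 2561 1;P 2560 2562 1;E 1 [:: 2561;1030];E 1 [:: 1027;2564;28672];E 1 [::
1029;2562];D 1027 2624 4;P 1028 1030 1;D 1089 2562 1;D 2561 448 1;D 1030 2624 4;D 2562 448 1;D 2561
1090 1;D 1029 2624 4;C 0;D 1540 2432 1;D 3076 896 1;D 1600 2432 2;D 2113 896 2;P 1536 1600 2;D 2113
1538 1;P 1536 1538 1]); ([::
L 10304 4;L 2113 1;L 18496 4;L 896 2;L 25088 1;L 25536 4;L 3076 1;L 7745 4;L 29249 2;L 31296 1],[::
E 1 [:: 4099;3076;25088];D 448 25088 1;D 24640 896 2;D 3584 28672 2;D 67 28672 2;D 3584 28672 1;P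
24576 28672 4;D 4099 24640 4;P 24576 24640 2;P 24576 24578 1;D 2113 24578 1;D 4161 24578 1;P 24576
24577 1;D 4161 3584 2;E 1 [:: 4609;24578;3076];D 4609 24640 4;D 2113 5632 1;D 24577 4672 1;D 5632
26624 4;D 4672 26624 2;D 18496 12800 4;E 1 [:: 16387;3076;12800];D 67 26624 2;D 16387 10304 4]);
([::
L 31296 1;L 7104 5;L 3010 5;L 3651 6;L 3972 6;L 3524 4;L 3076 1;L 576 2;L 19392 5;L 3009 5;L 11200 5],[::
P 384 388 1;P 24576 28672 4;D 3076 448 1;D 3584 28672 2;P 384 448 2;P 3072 3584 4;P 384 8576 4;D
3076 896 1;D 10304 896 2;D 3584 28672 1;D 2113 896 2;D 388 3136 2;P 3072 3136 2;D 6208 896 2;D 2114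
896 2;D 18496 896 2;P 3072 3073 1;D 1537 2114 1;P 3072 3074 1;D 1537 6208 4;D 577 3074 1;D 577 28672
2;P 576 577 1;P 576 16960 4;D 16960 8576 4;C 0;D 6208 25088 4;P 24576 25088 1;P 24576 26624 2;D
25088 7168 4;D 577 7168 2;D 4672 26624 2;D 3073 4672 1]); ([::
L 1408 2;L 5632 4;L 8064 1;L 1540 2;L 2564 1;L 28164 4],[:: P 384 448 2;D 3584 28672 1;D 3584 28672
2;P 384 388 1;P 384 2432 4;D 2432 5632 4;D 5632 26624 4;D 1408 6656 2;D 1540 26624 2;D 6656 25600
4;D 2564 25600 1]); ([::
L 2816 4;L 25088 4;L 896 1;L 1408 2;L 1540 2;L 3076 4;L 2564 1;L 5124 4;L 30212 2;L 29568 1;L 1156 2],[::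
P 384 388 1;D 3584 28672 2;D 3076 25088 4;P 24576 28672 4;D 3584 28672 1;D 5124 25088 4;P 384 448
2;D 25088 7168 4;P 384 4480 4;D 896 7168 1;D 4480 25088 4;C 0;D 24580 5632 1;D 24580 3584 2;D 2564
25600 1;D 6656 25600 4;P 24576 24580 1;P 24576 25088 2;D 1156 6656 2;D 4480 25088 2;P 24576 24832
2;D 388 6656 2;D 2564 4480 1;D 4736 24832 2;D 3076 4736 4;D 4228 2816 4;D 4228 3584 1]); ([::
L 6656 5;L 25088 2;L 4608 1;L 29568 1;L 28164 2;L 2564 1;L 17412 4;L 5124 2;L 9220 4;L 30080 2],[::
P 384 388 1;D 3584 28672 1;D 9220 6656 4;P 4608 6656 2;P 384 448 2;P 384 16768 4;D 3584 28672 2;P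
4608 20992 4;P 384 8576 4;D 6656 25600 4;D 8576 20992 4;D 2564 25600 1;D 17412 10752 4;D 5124 10752
2;D 4480 25088 2;D 2564 13312 1;D 4480 25600 1;D 16768 13312 4]); ([::
L 2816 3;L 768 2;L 1988 6;L 4032 5],[:: D 1216 2816 2;P 768 2816 4;P 768 772 1;D 772 1216 1]); ([::
L 896 1;L 9728 2;L 5632 6;L 8064 2;L 31104 1;L 17920 2;L 2816 4;L 4608 4;L 3328 2;L 8000 4;L 7104 5],[::
D 3584 28672 1;P 4608 5632 1;P 384 448 2;P 384 388 1;P 4608 4672 2;P 384 2432 4;D 3584 28672 2;P
4608 20992 2;P 384 8576 4;D 3328 20992 2;D 8576 5632 4;D 4672 3328 2;D 4416 3584 1;D 2432 5632 4;P
384 16768 4;D 4480 3584 1;D 4416 2688 2;D 5632 26624 4;D 4480 26624 2;D 4480 17920 2;D 16768 5632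
4;D 896 21504 1;D 8576 22528 4;D 2816 21504 4;D 4480 9728 2;D 896 13312 1;D 20736 3584 1;D 2688
20736 4;D 896 22528 1;D 4480 18944 2;D 18944 13312 4]); ([::
L 6656 3;L 2816 4;L 3328 2;L 17920 2;L 7940 4;L 2564 1;L 1284 2;L 31104 1;L 1408 2;L 2432 1;L 896 1;L 9728 2;L 5632 2;L 1792 2;L 7104 5;L 1092 2;L 7748 4;L 5956 4;L 3012 5],[::
P 4608 6656 4;D 1284 6656 2;D 1408 6656 2;D 1092 6656 2;D 2564 5376 1;D 4164 3584 1;D 4164 1792 2;D
2564 5184 1;D 5184 2816 4;C 0;D 324 5632 1;D 324 2688 2;D 2432 5632 1;D 2688 5376 4]); ([::
L 4032 5;L 2240 4;L 2432 1;L 1792 2;L 3972 6;L 1540 6;L 2564 1;L 6020 6;L 5632 2;L 9728 2;L 1988 6;L 10116 6;L 17920 2],[::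
D 3584 28672 1;D 2564 1408 1;D 2564 448 1;P 2560 3584 4;D 1540 28672 2;D 67 3584 2;E 1 [::
1027;2564;28672];D 2624 1408 2;P 576 2624 2;P 384 388 1;D 1408 28672 2;P 384 448 2;P 3072 3584 4;P
384 4480 4;D 386 2624 4;P 384 8576 4;D 2624 4480 4;D 3584 28672 2;D 2432 28672 1;D 1027 2624 4;D
2624 28672 1;P 384 16768 4;D 388 2624 4;P 2560 2624 2;D 385 2624 4;D 2624 8576 4;P 2560 2561 1;P
2560 2816 1;P 2560 10752 1;P 2560 6656 1;D 448 6656 1;P 2560 18944 1;D 448 10752 1;P 2560 2688 1;D
1284 2688 1;D 1284 2240 4;D 448 18944 1;P 2560 2562 1;D 2624 16768 4;D 2561 448 1;D 2562 448 1;D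
1156 2816 1;C 6;P 3072 3076 1;P 3072 3328 2;D 3076 16768 4;P 3072 3200 2;P 3072 19456 2;P 3072 3136
2;D 388 19456 2;D 17412 2432 1;D 388 3136 2;D 832 3200 2;D 3136 896 2;D 5124 896 1;D 896 28672 1;D
9220 896 1;D 1092 2432 1;D 5124 2624 4;P 768 896 2;D 5124 832 4;C 2;D 5124 2816 4;C 4;C 0;D 3076
25088 2;D 17412 6656 4;C 3;D 6656 25600 4;D 2432 25600 1;P 4608 4612 1;D 2564 25600 1;D 9220 18944
4;D 1540 26624 4;D 5124 18944 2;D 4612 19456 1;D 8576 19456 4;D 1408 26624 2]); ([::
L 896 1;L 2112 2;L 640 1;L 9216 4;L 10116 6;L 3012 6;L 1988 6;L 1088 2;L 26048 1;L 2688 2;L 18308 6;L 17408 4],[::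
P 384 448 2;D 9220 896 1;P 9216 9220 1;P 384 388 1;D 2116 896 1;P 9216 9472 2;P 384 896 4;D 17412
896 1;P 2112 2116 1;D 1092 896 1;P 1088 1092 1;P 2112 3136 4;P 1088 9280 4;P 17408 17412 1;P 384
16768 4;P 17408 17472 2;P 640 896 2;D 9280 16768 4;D 17472 2688 2;D 16576 9472 2;D 16576 3584 1;P
640 17024 4;D 3136 17024 4]); ([::
L 896 2;L 5632 3;L 2432 1;L 8064 4;L 2564 2;L 29568 2;L 3076 1;L 16900 4;L 8708 4;L 30212 2],[:: D
3584 28672 1;D 3584 28672 2;P 384 388 1;P 5120 5632 4;D 2432 5632 1;P 384 448 2;D 4480 3584 2;D 896
7168 2;P 384 8576 4;D 16900 7168 4;D 25088 7168 4;D 4480 25088 1;P 5120 7168 2;D 8576 20992 4;P 5120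
5124 1;D 3076 20992 1;D 5124 25088 1;D 2564 21504 2;D 8708 21504 4]); ([::
L 25088 3;L 18688 4;L 2432 1;L 27520 2;L 3076 1;L 28164 2;L 8708 4;L 16900 4;L 644 2;L 8704 1;L 9156 4;L 3524 5],[::
D 2432 25088 1;D 8832 18688 4;D 3076 25088 1;P 8704 25088 4;D 16900 11264 4;D 3076 8832 1;P 8704
8768 2;D 644 11264 2;D 8708 3200 4;D 388 8768 2;D 324 8832 1;D 324 3200 2]); ([::
L 8704 1;L 27520 2;L 2432 1;L 2304 3;L 644 2;L 9156 4;L 3524 5;L 16900 4;L 8708 4;L 28164 2;L 3076 1;L 3136 4;L 31040 1;L 6144 1;L 28224 2],[::
D 3584 28672 1;D 3584 28672 2;P 2304 18688 4;P 2304 6400 4;C 0;D 3136 25088 4;D 24640 3584 1;D 24640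
6400 4;D 25088 7168 4;P 6144 7168 4;D 24640 6400 2;P 6144 6400 2]); ([::
L 6656 6;L 2688 2;L 640 1;L 2432 1;L 18308 6;L 10116 6;L 2564 2;L 8708 4;L 16900 4;L 644 2;L 30212 2;L 8704 1;L 2624 2;L 31040 1;L 1088 2;L 2112 2;L 1988 6;L 3012 6;L 9156 4;L 4032 5;L 580 2;L 2304 2;L 19268 4;L 2816 2],[::
D 3584 28672 1;P 3072 3584 4;P 6144 6656 1;P 384 448 2;P 384 388 1;D 3584 28672 2;D 2816 28672 2;P
384 1408 4;D 1408 6656 4;P 384 8576 4;D 6656 25600 4;P 17408 25600 4;D 2816 25600 2;D 2624 25600 2;D
448 25600 1;D 2564 25600 2;P 9216 25600 4;C 3;D 3136 896 2;D 896 28672 2;D 388 3136 4;P 3072 3136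
2;P 3072 3076 1;D 3076 448 1;C 2;D 5632 26624 4;D 896 26624 2;C 0;P 2304 2816 1;D 2816 25600 1;P
2304 2308 1;D 2308 704 1;D 2816 28672 1;D 704 3328 2;D 24832 6656 4;D 704 24832 2;D 3328 25088 4;C
1;D 448 25088 1;D 580 18688 2;D 16960 8576 4;D 2308 16960 1]); ([::
L 8704 1;L 5632 4;L 896 2;L 2432 1;L 644 2;L 9156 4;L 3524 5;L 16900 4;L 8708 4;L 1540 2;L 3076 1;L 2304 2;L 4612 2;L 29568 2;L 25088 3;L 1664 2;L 8064 1],[::
D 3584 28672 1;P 384 448 2;D 3584 28672 2;P 384 388 1;D 5632 26624 4;P 384 8576 4;P 384 2432 4;D 896
26624 2;D 1540 26624 2;D 2432 5632 4;C 2;P 2304 18688 4;D 4480 3584 2;D 1664 6400 2;D 4612 18688 2;D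
16900 6400 4;P 2304 2308 1;D 4480 25088 1;D 2308 20992 1;D 8576 20992 4]); ([::
L 896 2;L 29568 2;L 2432 1;L 5632 3;L 8708 4;L 16900 4;L 3076 1;L 30212 2;L 2564 2;L 580 2;L 7748 4;L 3908 4;L 5828 4;L 3524 5;L 6656 1;L 1664 2;L 2816 2;L 8000 1],[::
C 4;P 384 448 2;P 384 388 1;P 384 896 4;D 896 7168 4;D 580 7168 2;D 4164 3584 1;D 1092 6656 1;D 3076
4672 1;D 1092 2816 2;D 4164 1664 2;D 3076 832 1;D 196 5632 1;D 832 7168 2;D 4672 3328 4;D 196 3328
2]); ([::
L 8064 1;L 1664 2;L 2304 2;L 2432 1;L 3972 6;L 3076 1;L 4612 6;L 1540 2;L 8708 4;L 16900 4;L 644 2;L 2564 2;L 8704 1;L 4032 5;L 8000 1;L 9156 4;L 5828 4;L 580 2;L 3908 4;L 6656 1;L 2816 2],[::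
D 3076 896 1;D 1540 28672 2;D 3136 896 2;D 4612 3136 4;P 384 448 2;D 896 28672 2;D 3076 448 1;P 384
388 1;D 3584 28672 2;D 3584 28672 1;D 388 3136 4;P 384 2432 4;C 0;C 1;D 25088 7168 4;D 2432 5632 4;D
896 7168 2]); ([:: L 4032 5],[:: P 3072 3584 4;D 388 3584 2;P 1536 3584 4;P 384 448 2;C 17;D 1540
448 4;D 1540 28672 2;P 2560 3584 4;P 384 388 1;P 384 16768 4;P 384 8576 4;P 1536 1540 1;D 1540 16768
4;P 1536 5632 2;P 384 4480 4;D 1540 8576 4;P 1536 9728 2;P 1536 1664 2;D 2368 1664 2;P 1536 1792 2;D
1540 4480 4;P 2112 2368 2;P 1536 1600 2;D 2368 28672 1;D 1540 2368 4;D 388 5632 2;D 2240 1792 2;D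
388 1600 2;P 1536 17920 2;D 388 9728 2;P 2304 2368 2;D 388 17920 2;D 1600 2432 2;D 1540 2432 4;C 8;D
2564 448 4;P 2560 2564 1;P 2560 2624 2;P 2560 2688 2;C 33;D 2564 16768 4;P 2560 6656 2;P 2560 18944
2;P 2560 2816 2;D 388 18944 2;D 2624 1408 2;D 8708 2432 1;D 4612 1408 1;D 1344 2688 2;D 388 2624 2;D
16900 2432 1;P 4608 4612 1;D 16900 2368 4;P 8704 8708 1;D 1216 2816 2;P 1088 1344 2;D 4612 1216 4;D
644 1344 1;D 8708 448 4;P 1152 1216 2;P 640 644 1;D 580 2432 1;C 3;D 1344 6656 1;P 4608 6656 4;D
1408 6656 1;P 4608 4864 2;C 0;D 3076 448 4;P 3072 3076 1;P 3072 3136 2;P 3072 3200 2;D 3200 4864 2;D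
3136 896 2;D 388 3136 2;D 1156 2368 1;P 768 896 2;P 1152 1156 1;C 11;P 1152 5248 4;D 5248 2816 4]);
([:: L 2304 6;L 1544 2;L 3972 6],[:: P 2304 2305 1;P 2304 2308 1;D 448 3584 1;P 48 52 1;C 0;D 2308
1664 1;P 48 56 2;D 2308 56 1;P 48 2096 4;D 268 2096 4;D 52 2312 2;C 32;D 67 2312 4]); ([::
L 2432 1;L 3972 6;L 3524 6;L 3476 6],[:: C 1;P 192 448 2;P 384 448 2;D 1044 2432 1;D 448 3584 1;P 48
56 2;P 48 52 1;P 384 388 1;P 48 1072 4;D 1092 2432 1;P 48 560 4;P 1536 3584 4;D 1540 2432 1;P 1536
1540 1;D 196 560 4;P 1088 1092 1;D 200 1072 4;P 384 2432 4;P 1536 1544 2;D 1540 208 4;D 1600 2432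
4;P 2304 2432 2;P 1088 1600 4;C 0;P 1088 1096 2;P 2304 3328 4;P 2304 2816 4;D 1216 2816 4;P 192 1216
4;D 704 3328 4;P 192 196 1;D 52 704 2;D 56 1216 1;D 196 560 1;D 1044 704 2;D 1096 176 2;D 196 1552
1;D 560 1216 2;D 1552 224 4;D 176 1600 1]); ([::
L 2816 4;L 2561 2;L 2176 1;L 2883 2;L 3524 6;L 2499 6;L 2568 2],[:: D 67 2816 4;C 2;P 48 52 1;D 448
3584 1;D 1216 2816 4;P 48 56 2;P 48 560 4;P 48 1072 4;P 192 448 2;P 192 1216 4;D 52 1216 2;C 35;P
192 194 1;D 196 1072 4;D 2305 194 1;D 2305 1216 2;D 49 3584 1;P 192 196 1;D 196 1072 1;D 2561 1072
2;D 3073 560 4;D 196 3328 1;D 3073 448 1;D 193 3328 4]); ([::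
L 3328 1;L 2432 2;L 72 1;L 2120 2;L 1072 2],[:: D 392 112 4;P 384 388 1;P 384 448 2;D 2120 1072 2;D
56 448 1;P 48 56 2;C 3;D 1072 2432 2;D 448 3584 1;P 384 896 4;P 48 52 1;P 384 2432 4;P 48 1072 4;D
3136 896 4;D 1072 2432 4;D 56 3136 1;D 176 3328 1;D 2120 1072 4;D 328 176 2;P 72 2120 4;P 72 328
2]); ([:: L 2432 2;L 3328 1;L 2568 2;L 72 1;L 2056 1;L 1072 2],[:: D 2568 1072 2;P 48 56 2;P 48 52
1;C 0;D 56 3584 1;P 2056 2120 2;P 48 1072 4;D 2568 1072 4;P 2056 2568 4]); ([::
L 1216 2;L 1056 2;L 292 2;L 272 1;L 1520 5;L 3888 3],[:: D 292 1216 2;P 384 448 2;D 304 1216 2;P 272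
304 2;P 384 388 1;P 384 1408 4;D 100 1408 4;P 272 784 4;D 1060 448 1;D 784 3104 4;P 1056 1060 1;P
1056 3104 4]); ([::
L 2816 1;L 768 5;L 3328 1;L 2432 2;L 2084 2;L 2916 4;L 2056 1;L 2568 2;L 2060 2;L 2892 4;L 2860 4;L 3088 2;L 2068 2;L 2900 4;L 3412 4;L 3188 6;L 2872 1],[::
P 384 388 1;P 768 800 2;D 3088 800 2;D 2060 800 2;P 384 448 2;P 384 896 4;P 768 776 2;P 40 56 2;P
384 1408 4;D 448 3584 1;P 384 2432 4;P 768 832 2;C 6;D 112 1408 4;D 44 2816 1;D 2060 832 2;D 1600
2432 4;D 3136 896 4;P 40 44 1;D 2624 1408 4;P 40 552 4;D 76 2816 1;D 2068 832 2;D 2084 832 2;P 72 76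
1;P 1088 1600 4;D 276 2624 1;P 272 276 1;C 1;D 1072 448 1;D 292 2624 1;D 276 3136 2;P 1056 1072 2;D
1072 2816 1;C 0;P 1088 1216 2;P 1088 1092 1;D 1092 2096 1;D 776 2096 2;D 1092 2320 1;D 552 2320 4]);
([:: L 3076 6],[:: D 3076 336 4;P 384 448 2;D 3076 400 4;C 7;P 384 388 1;P 192 448 2;P 384 1408 4;D
448 3584 1;P 48 52 1;D 3076 112 4;D 3076 448 4;D 388 3584 2;P 3072 3076 1;P 2560 3584 4;P 384 2432
4;P 3072 3584 4;P 320 448 2;P 48 56 2;D 76 2432 4;D 2624 1408 4;D 84 2432 4;P 384 896 4;D 67 2432
4;D 100 2432 4;P 3072 3088 2;D 388 2624 2;D 388 3088 2;D 3076 896 4;P 48 560 4;D 3136 896 4;P 48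
2096 4;D 268 560 4;D 324 560 4;D 52 3136 2;D 388 3136 2;C 5;P 2304 2432 1;P 2176 2432 1;D 67 2432
2;C 38;D 2564 448 4;D 2564 336 4;P 2560 2564 1;P 2560 2561 2;D 2564 296 4;D 2564 328 4;D 2564 352
4;P 2560 2816 2;D 67 2816 2;P 2560 2568 2;C 4;D 196 2816 1;P 2304 2816 4;P 192 196 1;P 2304 2312 2;D
56 2816 1;P 768 2816 4;P 2304 2320 2;P 2304 2336 2;P 192 704 4;D 196 2312 2;D 704 3328 4;D 196 2336
2;D 2060 448 1;D 196 2320 2;D 2084 448 1;P 2056 2060 1;D 2068 448 1;C 0;P 768 772 1;D 772 56 1;D 52
776 2;D 776 2096 4;D 772 3200 1;D 2312 560 2;D 832 3200 4;P 320 832 4;D 52 832 2;P 320 324 1;D 324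
560 1]); ([:: L 2304 5],[:: P 320 448 2;C 8;P 48 56 2;P 2304 2368 2;P 48 52 1;C 0;D 448 3584 1;P 384
388 1;P 384 448 2;P 2304 2312 2;D 3076 448 1;P 48 1072 4;D 52 2312 2;P 384 896 4;P 48 2096 4;P 384
1408 4;D 76 1072 4;P 384 2432 4;D 3136 896 4;D 76 2096 4;D 268 2096 4;D 2308 56 1;D 2624 1408 4;D
388 3136 2;P 2112 2624 4;D 1092 2432 4;D 1092 2312 2;D 2116 1408 4;D 1092 56 1;D 2116 56 1;D 52 1096
2;D 52 2120 2;D 2308 1096 4;D 3076 328 1;P 2112 2120 2;P 320 328 1;P 320 2368 4;P 2112 2368 1]);
([:: L 776 2],[:: P 48 56 2;P 384 448 2;P 384 388 1;C 0;P 384 2432 4;D 448 3584 1;P 384 1408 4;P 48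
52 1;C 1;C 9;P 384 896 4;D 3136 896 4;P 48 2096 4;D 3076 448 1;P 48 1072 4;D 388 3136 2;D 196 3328
4;D 1600 2432 4;D 2116 1408 4;D 76 2096 4;D 2116 776 2;P 2304 3328 4;D 1092 2432 4;D 76 1072 4;D 324
3200 4;P 1088 1600 4;P 2304 2305 1;P 2304 2432 1;D 2116 56 1;P 2176 3200 4;P 2176 2432 2;D 1092 56
1;D 52 1096 2;D 1096 2432 1;D 52 2120 2;D 2120 1408 4;D 392 3136 2;D 1096 896 4;P 2176 2688 1;D 328
3200 2;D 1092 2688 1;P 2176 2178 1;P 1088 1096 2;D 392 1600 1;P 1088 1090 1;P 1088 1089 1;E 1 [::
1089;2178;772];D 776 1216 2;E 1 [:: 2305;1090;644];D 644 3136 2;D 772 2120 4;D 2564 1216 4;D 2564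
328 1]); ([::],[:: P 384 388 1;P 384 448 2;C 0;C 1;P 384 896 4;P 384 2432 4;P 384 1408 4;C 10;P 768
776 2;P 48 56 2;C 2;D 448 3584 1;P 48 52 1;D 3076 776 1;E 1 [:: 515;3076;56];P 48 2096 4;D 268 2096
4;D 2624 1408 4;P 48 560 4;D 1600 2432 4;P 48 1072 4;D 3136 896 4;D 3076 448 1;D 76 2096 4;D 13 560
4;D 11 2624 2;D 388 1600 2;P 2112 2624 4;D 76 1072 4;D 388 3136 2;P 1088 1600 4;D 196 3328 4;D 1092
2432 4;D 1092 56 1;D 324 3200 4;D 52 1096 2;P 2176 3200 4;D 2116 1408 4;P 2304 3328 4;P 2304 2432
1;P 2176 2432 2;P 1088 1096 2;P 2304 2308 1;D 2116 56 1;D 2308 56 1;D 52 2312 2;P 2176 2180 1;P 1088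
1089 1;D 52 2120 2;D 11 2116 2;E 1 [:: 1089;770;2180];D 7 2120 4;D 515 2120 4;P 2112 2120 2;P 768
770 1;P 2112 2114 1;P 2112 2113 1;D 521 2114 1;P 768 1792 4;D 13 2114 1;D 196 1792 4;D 521 52 2;D
1540 448 1;D 13 2624 2;D 1540 2312 4;D 517 56 1;D 524 3328 2;D 517 2120 4;D 2113 524 1])].

Lemma valid_same_point :
  valid 15%N true nopm_same_point facts_same_point [:: 1]%num nopm_same_point
    cert_same_point.
Proof. by vm_compute. Qed.

(** The same, the two points of the first block being different. *)
Definition facts_two_points : seq lit :=
  ([:: L 7 1; L 56 2; L 448 2; L 3584 4; L 28672 4; L 11 1; L 385 1; L 70 1; L 52 1] ++
  low9).

Definition nopm_two_points : seq lit := [:: L 63 1; L 455 1; L 511 1; L 3591 1; L 3647 1;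
  L 4039 1; L 28679 1; L 28735 1; L 29127 1; L 32263 1].

Definition cert_two_points : seq (clause * seq ref) :=
[:: ([:: L 544 1;L 548 4;L 1596 3],[:: D 28 1568 4;P 9 11 1;P 48 56 2;P 24 56 2;D 548 1048 4;P 544
1568 4;P 48 52 1;P 24 1048 4;P 24 25 1;P 544 545 2;P 9 25 2;P 48 1072 4;D 25 1568 1;D 545 1048 2;D
521 1072 4;P 9 521 4]); ([::
L 17408 6;L 30240 3;L 1568 2;L 4612 4;L 1544 2;L 536 2;L 29208 2;L 22028 2;L 560 2;L 16400 1;L 17976 4],[::
P 17408 17920 1;P 17408 17412 1;D 56 17920 1;D 17416 560 2;D 16408 1568 2;D 1544 16432 2;D 536 17440
2;D 4612 17416 4;P 16400 16432 2;D 17412 4616 1;D 17440 12800 4;D 16408 12800 1;P 16400 24592 4;D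
4616 24592 4]); ([::
L 2560 5;L 1056 4;L 544 4;L 21504 2;L 1568 2;L 30240 3;L 17408 4;L 1544 2;L 28 2;L 2096 1;L 16400 1;L 17972 6;L 5684 6;L 16404 4;L 3640 5;L 2072 1;L 2620 4;L 1596 6],[::
P 2560 2576 2;P 48 56 2;P 40 56 2;P 48 52 1;D 56 28672 1;P 3072 3584 4;P 2560 2568 2;P 48 8240 4;D
2568 1072 2;D 1064 2576 2;D 4612 1072 1;D 16900 1072 1;D 52 2568 2;D 524 2096 1;P 1056 1072 2;D 548
2072 1;D 524 21504 2;P 544 548 1;P 1056 1060 1;P 544 560 2;D 1060 16912 1;D 1060 536 1;P 544 552 2;D
536 3104 2;D 3080 560 2;D 16404 3104 4;D 536 28672 2;D 16912 3104 4;D 1064 16912 4;D 16900 3080 4;C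
0;D 16404 3080 4;P 3072 3080 2;P 17408 19456 2;P 3072 3076 1;D 28 19456 2;P 17408 25600 2;D 52 25600
2;D 52 19456 2;D 552 19456 2;D 3076 16408 1;D 524 19456 2;D 560 19456 2;D 17412 2096 1;D 2096 17920
1;D 17412 8240 4;D 3076 16904 1;D 16904 3104 4;D 1060 24592 1;D 16424 3584 1;D 12320 17920 4;P 40
16424 1;P 40 4136 4;D 16408 12320 2;D 4136 24592 4]); ([::
L 25600 1;L 30240 6;L 560 2;L 7728 1;L 3088 4;L 2576 2],[:: D 3584 28672 2;D 4640 25600 1;D 3584
28672 1;D 3088 4640 4;D 2576 5152 2;D 560 7168 2;D 5152 25088 1;D 25088 7168 4]); ([::
L 2560 6;L 21504 1;L 10752 2;L 1032 2;L 1544 2;L 3595 6;L 11320 5;L 560 2;L 3636 6;L 2618 4;L 7224 5;L 3129 5;L 19512 5],[::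
D 3584 28672 1;P 2560 2564 1;D 3584 28672 2;D 56 21504 1;D 2564 1072 1;P 2560 2568 1;D 6152 1072 2;P
48 56 2;P 48 52 1;P 2560 2562 1;D 2057 1072 2;P 2560 10752 1;P 20480 28672 4;D 18440 1072 2;D 2568
21504 1;P 10240 10752 4;D 10248 1072 2;P 48 4144 4;D 1033 2562 1;D 2562 56 1;D 1033 10752 2;P 10240
10248 2;P 10240 10244 1;D 2058 560 2;P 1032 1033 1;D 1537 2058 1;D 1537 10248 4;P 1032 17416 4;D
2057 9728 1;D 17416 4144 4;D 9728 22528 4;D 11 22528 2;D 1544 22528 2;D 20488 1072 2;D 18440 5632
4;P 20480 20488 2;P 20480 20482 1;E 1 [:: 16387;10244;5632];D 16387 6152 4;D 2057 20482 1]); ([::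
L 17440 4;L 3104 1;L 30240 6;L 25600 3;L 9248 4;L 1072 1;L 2576 2;L 3088 4;L 560 2;L 22064 2;L 29744 1;L 24080 2],[::
C 1;D 4144 3584 1;D 4624 3104 1;D 4144 25600 2;D 20496 9248 4;D 4624 17440 4;D 1072 20992 1;D 20496
3584 1;D 3088 20992 4]); ([::
L 21504 3;L 9248 4;L 30240 6;L 3104 1;L 17440 4;L 560 2;L 29744 1;L 2576 2;L 3088 4;L 1072 1],[:: P
48 56 2;D 2576 21504 2;D 8736 21504 1;P 48 52 1;D 3584 28672 2;D 3088 8736 4;D 3584 28672 1;D 560
21504 2;C 0;P 48 4144 4;D 4144 25600 4;D 8240 21504 2;D 8240 3584 1;D 560 11264 2;D 2576 9248 2;D
20992 11264 4;D 9248 20992 1]); ([::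
L 5152 4;L 9248 4;L 17440 4;L 3104 1;L 21504 3;L 30240 2;L 3076 1;L 4612 4;L 24068 2;L 16900 4;L 3088 4;L 1072 1;L 2576 2;L 29744 1;L 560 2;L 532 2],[::
D 16900 3088 4;D 560 21504 2;C 0;D 9248 20992 4;D 1072 20992 1;D 3076 20992 1;D 16912 5152 4;D 4612
19456 4;D 532 19456 2;D 3076 16912 1]); ([::
L 2560 5;L 21504 3;L 30240 2;L 3104 1;L 3076 1;L 1056 1;L 560 2;L 532 2;L 17972 6;L 5684 6;L 3640 5;L 1596 6],[::
P 2560 2576 2;P 2560 2568 2;P 2560 2564 2;D 2568 1072 2;D 2564 21504 2;D 16900 1072 1;P 1040 1072
2;P 1056 1072 2;P 1056 5152 4;D 1072 28672 1;P 1056 9248 4;D 4612 1072 1;P 1056 17440 4;C 0;D 552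
3088 2;P 1040 3088 4;D 1044 552 1;P 1040 1044 1]); ([::
L 21504 3;L 1056 1;L 30240 2;L 1544 2;L 30216 2;L 560 2;L 3636 6;L 5684 6;L 17972 6;L 3640 5;L 1596 6],[::
P 48 52 1;P 48 56 2;P 2560 3584 4;P 48 8240 4;D 11 560 2;D 3584 28672 2;D 3080 560 2;P 3072 3080 2;P
48 2096 4;D 3584 28672 1;P 3072 3584 4;P 3072 3104 1;P 3072 11264 1;D 11 3584 2;P 48 560 4;D 11 560
4;P 48 4144 4;P 48 16432 4;D 3080 16432 4;P 3072 3076 1;D 49 3080 4;D 56 11264 1;D 515 56 1;P 1032
3080 2;P 3072 7168 1;D 3080 4144 4;D 3080 8240 4;P 3072 3073 1;D 532 3104 1;P 3072 19456 1;D 56 7168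
1;D 3073 56 1;D 515 3080 4;D 56 19456 1;C 0;D 3073 522 1;P 2560 2564 1;E 1 [:: 1027;2564;448];D 2564
1072 1;P 2560 2568 1;P 2560 2562 1;D 2568 28672 1;D 522 2096 4;D 18440 1072 2;E 1 [::
8195;2564;21504];D 1033 2562 1;C 4;D 8195 3584 2;D 1027 10752 4;P 8704 10752 2;D 3073 8706 1;P 1032
1033 1;P 1032 17416 4;P 8704 8706 1;P 8704 9728 4;D 9728 22528 4;P 8704 12800 4;D 18440 12800 4;D
8712 22528 2;D 17416 12800 4;D 8712 21504 1]); ([::
L 6656 4;L 17920 2;L 1540 2;L 17412 4;L 24068 1;L 9220 4;L 31748 2],[:: D 3584 28672 1;D 3584 28672
2;D 17412 6656 4;D 6656 25600 4;D 1540 22528 2;D 6148 17920 2;D 9220 22528 4;D 6148 25600 1]); ([::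
L 21504 1;L 17920 2;L 3104 2;L 9220 4;L 1540 6;L 31748 2;L 17412 6;L 5124 4;L 1036 2;L 7212 4;L 1072 2;L 23600 1;L 3088 2;L 17424 2;L 3640 5;L 7196 4],[::
P 48 52 1;D 56 21504 1;P 2560 3584 4;P 48 56 2;P 48 16432 4;D 2568 1072 2;D 5124 2568 4;P 2560 2568
2;D 52 2568 4;P 2560 2564 1;D 2564 21504 1;D 2564 56 1;C 0;D 17412 6656 2;D 1036 6656 2;D 4108 3584
1;D 1540 22528 4;D 4108 3104 2;D 1072 22528 2;D 2564 5128 1;D 4108 3088 2;D 16432 7168 4;D 5128
16432 4;D 28 7168 1;D 4136 17424 2;D 44 7168 1;D 44 6656 2;D 2564 4136 1;D 28 2592 2;D 4108 2592
4]); ([::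
L 21504 3;L 17408 1;L 17920 2;L 5124 4;L 17412 6;L 31748 2;L 1540 6;L 9220 4;L 1544 2;L 520 2;L 1036 2;L 3088 2;L 7196 4;L 3104 2;L 1056 1;L 552 1;L 7212 4;L 2096 1;L 21556 4;L 3640 5;L 1596 6],[::
D 52 21504 2;D 552 21504 1;P 20480 28672 4;P 17408 21504 4;D 2096 21504 1;P 17408 17424 2;C 0;D
20484 1072 1;D 524 1072 1;P 1056 1072 2;P 520 524 1;P 20480 20484 1;P 1056 17440 4;P 520 4616 4;D
4616 17440 4;P 20480 20512 2;D 1544 20512 2]); ([::
L 10752 1;L 8704 4;L 520 2;L 3080 2;L 1040 1;L 1072 5;L 3636 6;L 9780 6;L 3640 5;L 1596 6],[:: P
1040 1072 2;D 8708 1072 1;P 8704 8708 1;P 1040 3088 4;P 2560 3584 4;D 2564 1072 1;D 524 1072 1;P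
8704 8720 2;P 2560 2564 1;P 2560 2592 2;P 520 524 1;D 3080 8720 2;D 1048 2592 2;P 520 8712 4;D 8712
3088 4;D 1048 10752 1]); ([::
L 21504 1;L 17920 2;L 1540 6;L 31748 2;L 9220 4;L 2564 1;L 17412 6;L 1072 2;L 2096 1;L 23600 4],[::
D 2564 21504 1;D 2096 21504 1;C 3;D 17412 6656 2;D 1072 22528 2;D 1540 22528 4]); ([::
L 17920 2;L 1540 6;L 2088 4;L 1544 2;L 560 1;L 2096 1;L 3636 6;L 9780 6;L 5684 6;L 17972 6;L 3640 5;L 2072 5;L 1596 6],[::
D 3584 28672 1;P 48 52 1;D 1036 560 1;D 5124 560 1;P 2560 3584 4;P 48 56 2;P 20480 28672 4;D 56
28672 1;D 9220 560 1;D 17412 560 1;D 3076 560 1;P 17408 17412 1;P 48 16432 4;D 3584 28672 2;P 48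
2096 4;D 1036 2096 4;D 5124 2072 4;P 3072 3584 4;D 3076 28672 2;P 3072 3076 1;D 5124 16432 4;P 48
8240 4;D 5124 2088 4;P 3072 3088 2;P 3072 3080 2;P 3072 3104 2;D 552 3088 2;D 52 3080 2;D 1060 2072
1;P 520 552 2;D 1044 552 1;P 1040 1044 1;P 1056 1060 1;C 2;D 10752 21504 4;D 1036 10752 2;P 8704
10752 4;C 1;D 2568 1072 2;D 2568 21504 4;D 2096 21504 4;D 9220 2568 4;P 2560 2568 2;D 52 2568 4;D
8204 3584 1;P 2560 2564 1;C 0;D 2564 56 1;P 20480 21504 1;P 20480 22528 2;P 20480 20496 2;D 8204
20496 2;P 20480 20512 2;D 1544 22528 2;D 20488 3584 1;D 52 20488 2;D 8204 20512 2;D 20488 8240 4;D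
8216 20512 2;D 52 20488 4;D 8232 20496 2;D 2564 8232 1;D 20484 56 1;D 20484 8232 4;D 20484 8216 4;D
44 28672 1;D 28 28672 1;D 44 10752 2;D 8204 2592 4;D 28 2592 2]); ([::
L 2560 6;L 21504 4;L 10248 4;L 11785 4;L 1033 2;L 31752 1;L 3595 6;L 1544 2;L 11320 5;L 1032 2;L 560 2;L 2618 4;L 3636 6;L 19512 5;L 3129 5;L 7224 5],[::
D 10248 21504 4;P 20480 28672 4;P 2560 2561 1;D 3584 28672 2;D 3584 28672 1;D 10752 21504 4;D 1033
10752 2;C 11;D 2561 9224 1;P 20480 21504 1;D 9224 22528 2;P 20480 22528 2]); ([::
L 1032 2;L 1544 2;L 31752 1;L 3595 6;L 30216 2;L 30240 2;L 560 2;L 1072 2;L 3636 6;L 17972 6;L 5684 6;L 3640 5;L 11320 5;L 3130 5;L 2618 4;L 7224 5;L 3129 5;L 19512 5;L 1596 6],[::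
D 2568 1072 2;D 10248 1072 2;P 48 52 1;P 48 56 2;P 2560 3584 4;D 2058 1072 2;P 48 1072 4;P 2560 2568
2;P 2560 2562 1;D 1033 2562 1;D 1537 2058 1;D 1537 10248 4;P 1056 1072 1;C 7;C 0]); ([::
L 30240 2;L 21504 3;L 1568 2;L 2560 5;L 30216 2;L 1544 2;L 560 2;L 2096 1;L 3636 6;L 5684 6;L 17972 6;L 3640 5;L 2072 1;L 1596 6;L 2620 4],[::
C 8;P 1056 1060 1;P 17408 21504 4;P 1056 1568 1;P 544 1568 4;D 28 1568 1;D 16404 1568 1;D 1060 16912
1;D 1568 28672 1;C 15;P 16400 16912 1]); ([::
L 20480 6;L 10752 1;L 24068 4;L 8708 4;L 1540 2;L 3076 1;L 31236 2],[:: P 20480 20484 1;P 20480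
20992 1;D 3076 20992 1;D 1540 22528 2;D 20484 10752 1;D 8708 22528 4]); ([:: L 3640 5;L 1540 6],[::
P 48 52 1;P 2560 3584 4;P 20480 28672 4;D 3584 28672 1;P 3072 3584 4;D 1540 56 4;P 1536 1540 1;P
1536 3584 4;P 1536 5632 2;P 48 56 2;D 52 3584 2;D 3584 28672 2;P 1536 1552 2;P 1536 1568 2;P 48
16432 4;P 1536 1544 2;P 1536 17920 2;D 11 3584 2;P 1536 9728 2;D 2088 1552 2;D 2072 1568 2;P 48 560
4;D 1544 2096 2;D 52 5632 2;D 52 9728 2;P 48 4144 4;P 48 8240 4;D 1540 2096 4;D 1568 28672 2;D 1540
16432 4;D 1544 28672 2;D 52 1544 2;D 52 17920 2;D 11 560 4;D 1540 4144 4;D 1540 8240 4;C 4;D 3080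
560 2;P 3072 3080 2;D 3080 28672 1;D 3080 16432 4;D 49 3080 4;D 11 560 2;P 3072 19456 1;P 3072 11264
1;D 50 3080 4;P 3072 7168 1;P 3072 3088 1;P 3072 3076 1;D 56 11264 1;D 3080 4144 4;D 515 56 1;P 3072
3073 1;D 515 3080 4;P 3072 3074 1;D 3074 56 1;D 56 19456 1;P 1032 3080 2;D 3073 56 1;D 3080 8240 4;D
548 3088 1;D 56 7168 1;P 3072 3104 1;D 3073 522 1;D 532 3104 1;D 522 2096 4;D 548 2072 4;C 2;D 8708
1072 1;D 1072 28672 1;D 2564 1072 1;D 2564 28672 2;P 2560 2564 1;C 1;D 10752 21504 4;D 2564 21504
4;D 8240 21504 4;C 0;P 20480 22528 2;P 20480 21504 2;D 1540 22528 2;P 20480 20512 2;D 8240 21504 2;D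
9232 20512 2;P 9216 9232 2;D 2564 9232 4;P 20480 20496 2;D 3076 20992 1;D 20992 11264 4;D 52 11264
2;D 20496 9248 2;D 3076 8240 1;P 9216 11264 4;D 532 11264 2;D 2068 9248 4;P 9216 9728 1;D 2068 9728
1]); ([:: L 3074 1;L 1544 2;L 522 2;L 3598 4;L 3640 5;L 1596 1],[:: C 0;D 1544 2096 2;P 48 52 1;D 52
1544 2;D 52 3584 2;P 48 56 2;D 1540 2096 1;P 48 560 4;P 48 1072 4;D 3076 560 4;D 524 1072 4;D 3074
524 1;D 522 3076 2]); ([::
L 10752 3;L 2562 4;L 1540 1;L 2568 2;L 11786 4;L 522 2;L 1034 1;L 1036 1;L 11788 4;L 560 2;L 10808 4],[::
D 1036 10752 1;D 3584 28672 2;D 9220 2568 2;D 2562 9220 4;D 56 10752 1;D 3584 28672 1;P 10240 10752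
4;D 10248 560 2;D 1034 10752 1;P 10240 10248 2;P 10240 10241 1;D 522 11264 2;P 10240 10242 1;D 10242
1540 1;D 20992 11264 4;E 1 [:: 10241;1030;20992];D 1030 10752 2]); ([::
L 2432 2;L 20480 5;L 896 2;L 22976 4;L 21440 4;L 9224 4;L 31752 1],[:: D 3584 28672 2;P 20480 20488
2;P 20480 20544 2;D 20544 896 2;D 3584 28672 1;D 448 20992 1;D 20544 2432 2;D 20992 11264 4;D 448
22528 1;D 20488 11264 2;D 9224 22528 4]); ([::
L 5128 4;L 521 2;L 19977 4;L 24072 3;L 1033 1;L 4616 4],[:: D 5128 18944 4;D 1033 18944 1;D 521
19456 2;D 4616 19456 4]); ([:: L 3640 5;L 560 2],[:: D 3080 560 2;P 384 385 1;P 3072 3080 2;P 384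
448 2;D 11 3584 2;P 3072 3584 4;D 3584 28672 1;P 2560 3584 4;P 20480 28672 4;P 48 56 2;P 3072 3073
1;D 385 3584 2;P 48 52 1;D 3080 28672 1;C 4;D 11 560 2;P 48 560 4;P 1536 3584 4;P 48 4144 4;D 3584
28672 2;P 384 1408 4;P 48 2096 4;P 3072 3074 1;P 48 8240 4;E 1 [:: 3073;518];D 11 560 4;P 48 1072
4;P 48 16432 4;D 1540 56 1;D 515 56 1;D 518 3080 4;D 515 3080 4;D 521 3074 1;D 3073 522 1;D 521 1072
4;P 520 521 1;C 3;D 522 1072 4;D 1544 4144 4;D 1544 16432 4;D 52 1544 4;D 1036 560 2;P 1536 1544 2;P
520 1544 2;P 1536 5632 1;P 1536 1537 1;P 520 2568 4;P 520 4616 4;D 1544 8240 4;P 1536 1538 1;D 56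
5632 1;P 1536 9728 1;P 520 8712 4;P 1536 17920 1;D 52 2568 4;D 1537 56 1;D 8712 2096 4;D 56 9728 1;D
56 17920 1;D 1538 56 1;D 5128 560 2;D 17416 560 2;D 1033 560 2;D 1033 2562 1;D 1034 560 2;D 9224 560
2;D 2561 1034 1;D 2561 17416 4;D 2562 9224 4;D 2561 1408 4;C 0;P 2560 2561 1;P 2560 10752 2;D 3073
896 1;P 2560 2568 2;D 1537 2432 1;D 52 2568 2;D 2564 56 1;D 2564 9224 4;C 2;D 10752 21504 4;D 2568
21504 2;D 3080 20992 1;D 448 20992 4;D 20488 3584 1;P 20480 20488 1;D 1544 22528 1;C 1;D 448 22528
4]); ([:: L 20992 6;L 2084 2;L 3076 4;L 1540 1;L 22064 1;L 560 1;L 2096 2;L 29232 1],[:: D 3584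
28672 2;P 48 52 1;D 3584 28672 1;P 48 56 2;P 20480 28672 4;P 20480 20992 1;D 2096 20992 2;P 20480
20512 2;P 48 8240 4;P 48 2096 4;D 8240 20992 4;P 20480 20496 2;P 48 1072 4;D 8240 20992 2;D 2096
20992 4;D 1072 20992 4;D 20496 8736 2;D 1540 8240 1;D 560 22528 1;D 1552 20512 2;D 9728 22528 4;D
3076 8736 4;D 2084 9728 2;D 52 9728 2;D 8228 3584 1;D 8228 1552 4]); ([::
L 20992 1;L 22528 4;L 552 4;L 23064 2;L 536 4;L 23080 2;L 1544 4;L 24072 2;L 2060 2;L 11788 4;L 20496 2;L 3640 5],[::
D 536 22528 4;D 3584 28672 1;P 48 52 1;P 48 56 2;P 48 8240 4;D 56 28672 1;D 552 22528 4;D 1544 22528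
4;D 20488 3584 1;C 6;D 3584 28672 2;D 20488 8240 4;D 2072 20992 1;D 2088 20992 1;D 9728 22528 4;D
8232 20496 2;D 8232 3584 1;D 2072 1568 2;D 2060 9728 2;D 2088 9728 2;D 10248 1568 4;D 1540 10248
1]); ([::
L 20480 5;L 20992 1;L 6148 4;L 24068 2;L 24072 2;L 1544 4;L 2568 2;L 536 4;L 11788 4;L 2060 2;L 552 4;L 19980 4;L 2576 2;L 2096 2;L 3640 5],[::
P 20480 20496 2;P 48 52 1;C 7;P 48 56 2;P 20480 20512 2;P 20480 20488 2;D 20488 2576 2;P 48 4144 4;D
20488 2096 2;D 2568 20512 2;C 0;D 1540 22528 1;D 56 22528 1;D 6148 17920 4;D 2060 17920 2;D 18440
4144 4;D 1540 18440 1]); ([::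
L 21504 2;L 1552 1;L 24068 2;L 1544 4;L 2568 2;L 1064 4;L 2576 2;L 560 1;L 1072 1;L 29232 1;L 3636 6;L 18996 2;L 10804 2;L 6708 2;L 3640 5;L 22064 1;L 1048 4],[::
P 48 56 2;C 8;D 52 2568 2;P 3072 3584 4;D 2564 1072 1;P 20480 28672 4;D 2084 1552 1;D 2568 21504 2;P
48 52 1;D 3076 560 1;D 2564 56 4;D 52 21504 2;D 1540 2096 1;D 2096 21504 2;P 48 16432 4;P 48 560 4;P
48 1072 4;P 3072 3076 1;P 48 4144 4;D 2060 560 1;P 48 8240 4;C 2;D 2564 16432 4;P 3072 3088 2;D 2564
4144 4;D 552 3088 2;D 2564 8240 4;D 18436 560 1;D 18436 1544 4;P 3072 3104 2;P 16388 18436 1;D 6148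
560 1;D 18436 1048 4;D 10244 560 1;D 10244 1544 4;D 18436 1064 4;D 6148 1544 4;D 536 3104 2;C 0;P
20480 20484 1;P 20480 22528 1;D 20484 1072 1;D 20484 3584 1;D 560 22528 1;D 5124 16432 4;D 1072
22528 1;D 3076 20992 4;D 2096 20992 2;D 20484 1072 4;D 20484 560 1;D 4144 19456 4;D 52 20992 2;P
16388 20484 4;D 4612 16432 4;D 5124 552 1;D 18436 5632 4;D 2060 5632 2;P 16388 16396 2;D 16432 6656
4;D 16396 3104 2;D 1036 6656 1;D 4108 3584 1;D 44 19456 1;D 4612 56 1;D 4108 560 4;D 16396 3088 2;D
44 5632 2;D 28 19456 1;D 28 4640 2;D 1036 4640 4]); ([::
L 2560 5;L 1537 1;L 21504 2;L 1544 4;L 2057 2;L 3597 4;L 560 1;L 22064 1;L 29232 1;L 1552 1;L 3640 5],[::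
P 2560 6656 2;P 48 52 1;P 2560 2576 2;D 52 6656 2;P 2560 18944 2;P 2560 2568 2;P 2560 2592 2;P 2560
2564 2;D 2564 21504 2;D 2568 1072 2;P 48 56 2;D 52 18944 2;D 52 3584 2;D 1064 2576 2;D 52 2568 2;P
2560 10752 2;P 48 560 4;D 1048 2592 2;D 52 10752 2;P 48 2096 4;C 0;D 2564 1072 4;D 1540 2096 4;D
2057 1540 2;D 2564 56 1;D 1537 2060 1;D 2060 560 4]); ([::
L 1537 1;L 1028 1;L 2057 6;L 3117 4;L 3636 3;L 1593 5;L 3132 4;L 3101 4],[:: P 48 56 2;P 48 52 1;P
48 560 4;P 48 2096 4;D 3076 560 4;D 3076 56 1;D 1540 2096 4;P 1028 1540 4;P 1028 1060 2;P 1028 1044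
2;D 2057 1044 2;D 1044 2088 2;D 2057 1060 2;D 25 3076 1;D 1537 2088 1;D 41 3076 1;D 25 1568 2;D 41
3584 2;D 2057 1568 4]); ([::
L 21504 3;L 1537 1;L 1538 1;L 2053 4;L 1544 4;L 2057 6;L 1032 2;L 3595 6;L 5688 5;L 9784 5;L 17976 5;L 2617 4;L 1552 1;L 560 1;L 30729 2;L 3640 5;L 1593 5;L 2618 4],[::
P 48 52 1;P 2560 3584 4;D 11 28672 2;P 48 56 2;D 560 21504 1;D 3584 28672 2;P 20480 28672 4;D 56
21504 1;D 3584 28672 1;D 560 28672 1;D 2053 1544 4;C 11;P 48 4144 4;D 52 3584 2;P 48 2096 4;C 1;P
2560 2568 1;D 2568 28672 1;P 2560 2562 1;P 2560 2564 1;E 1 [:: 8195;2564;21504];E 1 [:: 1029;2562];D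
1033 2562 1;P 1032 1033 1;D 2562 56 1;P 1032 1036 4;P 2560 2561 1;P 1028 1029 1;D 2561 56 1;P 1032
1048 4;P 1032 17416 4;P 1032 1064 4;D 1036 2096 4;D 2053 1064 4;D 2053 1048 4;D 17416 4144 4;C 0;D
1540 2096 1;D 2564 1072 1;D 521 2096 2;D 522 2096 2;D 16904 1072 2;D 8712 1072 2;D 20488 1072 2;D
4616 1072 2;D 3073 522 1;P 20480 20488 2;D 3073 8712 4;D 8195 20488 4;P 20480 20484 1;P 20480 20481
1;P 20480 20482 1;D 521 20482 1;E 1 [:: 10241;1538;20484];D 10241 20488 4;D 8201 20482 1;D 8201 3584
2;D 521 11264 1;D 20992 11264 4;D 11 20992 2;D 20481 10248 1;D 16387 4616 4;D 10248 20992 2;E 1 [::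
16387;1540;14336];D 16904 14336 4]); ([::
L 10752 2;L 21504 4;L 2564 1;L 30216 1;L 2057 2;L 3595 6;L 3636 6;L 9784 5;L 1593 5;L 2620 4;L 3129 4],[::
P 2560 3584 4;D 3584 28672 1;D 3584 28672 2;D 2564 56 1;D 2564 1072 1;D 8712 1072 2;D 52 2568 2;D
2057 1072 2;D 3073 56 1;D 521 1072 2;D 3073 8712 4;P 2560 2568 2;P 2560 2562 1;D 8712 21504 4;P 2560
2561 1;D 1033 2562 1;D 1033 10752 2;D 2561 9224 1;D 521 11264 1;D 9224 20992 2;D 20992 11264 4]);
([:: L 10752 1;L 24068 4;L 10244 4;L 3076 2;L 20484 1;L 31236 2],[:: D 20484 3584 1;D 20484 10752
1;D 3076 20992 2;D 10244 20992 4]); ([::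
L 1568 1;L 21504 4;L 10752 3;L 30216 1;L 2057 2;L 9784 5;L 3595 6;L 1544 4;L 1593 5;L 560 1;L 30224 1;L 3636 6;L 3640 5;L 3129 4],[::
D 3584 28672 1;P 48 56 2;D 3584 28672 2;C 14;P 20480 28672 4;D 52 10752 2;P 3072 3584 4;P 2560 3584
4;P 48 52 1;D 3076 560 1;P 48 8240 4;D 2068 1568 1;P 48 16432 4;D 3076 16432 4;D 1540 2096 1;P 3072
3076 1;P 3072 3080 2;P 48 4144 4;P 3072 3104 2;P 3072 3088 2;D 8240 21504 4;D 536 3104 2;P 3072 7168
2;D 52 7168 2;D 3076 4144 4;P 3072 19456 2;D 552 3088 2;D 52 19456 2;D 2068 552 4;C 1;D 2564 8240
4;P 2560 2564 1;D 2564 28672 2;D 2564 21504 4;P 2560 2576 2;D 10244 560 1;C 0;D 20484 3584 2;D 1540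
22528 1;P 2560 2568 2;P 20480 20484 1;P 20480 20512 2;P 20480 20992 2;D 10244 1544 4;D 9728 22528
4;P 20480 20496 2;D 2568 1072 2;D 1072 28672 1;D 9232 20512 2;D 18436 1072 1;D 20496 9728 2;D 52
2568 2;D 6148 1072 1;D 3080 20992 2;D 2060 560 1;D 9232 20992 4;D 18436 1544 4;C 6]); ([::
L 1544 5;L 560 1;L 3640 5;L 2051 4],[:: P 48 56 2;D 11 3584 2;D 3584 28672 1;D 2051 1544 4;D 3584
28672 2;P 48 52 1;P 48 16432 4;D 52 3584 2;D 49 1544 4;P 48 8240 4;P 1536 1544 2;P 1032 1544 2;P
1536 3584 4;D 1544 28672 1;P 48 1072 4;P 1536 1552 1;D 1544 8240 4;P 1536 17920 1;P 48 4144 4;P 48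
560 4;P 1536 9728 1;P 1536 5632 1;D 56 17920 1;D 13 1072 4;D 1544 16432 4;D 56 5632 1;P 48 2096 4;P
1536 1537 1;P 1536 1568 1;D 1537 2058 1;D 1537 56 1;D 2058 560 4;P 1536 1538 1;D 1552 28672 1;D 1544
4144 4;D 56 9728 1;E 1 [:: 2053;1538;56];D 2057 1538 1;D 2057 560 4;D 2057 1072 4;D 2057 28672 2;D
2053 1544 4;C 3;D 10752 21504 4;C 0;D 2564 1072 4;D 1540 2096 4;D 2057 1540 2;D 1033 2564 1;D 1033
52 2;D 1537 2060 1;D 1029 56 1;P 1032 1033 1;P 1032 1064 4;P 1028 1029 1;D 2060 1072 4;P 1032 1048
4;D 2053 1064 4;C 4;D 2053 1048 4]); ([:: L 3640 5],[:: D 52 3584 2;C 11;P 528 560 2;C 16;P 544 560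
2;E 1 [:: 2051;1540;448];D 1540 56 1;C 0;D 52 1544 2;D 1544 2096 2;D 28 1568 4;P 544 1568 4;P 2080
2096 2;D 44 1552 4;D 1540 56 4;P 544 545 1;D 1036 560 4;D 1540 2096 1;P 528 1552 4;P 528 529 1;D
2088 1552 2;D 3076 560 4;P 528 530 1;E 1 [:: 529;2082;1036];D 545 3076 1;P 2080 2082 1;E 1 [::
2081;530;1036];P 2080 2592 4;E 1 [:: 1029;530;2088];D 1029 2592 4;D 2081 1540 2]); ([::
L 1056 4;L 12 4;L 2508 5;L 1071 6;L 1072 5;L 1040 4;L 3473 2;L 3123 6],[:: P 1056 1072 2;P 1056 1058
1;P 384 385 1;P 1040 1072 2;P 384 448 2;D 2065 1058 1;P 1040 1041 1;P 384 1408 4;D 13 1058 1;D 2065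
1408 4;P 12 13 1;D 1041 2432 1;P 12 76 2;D 76 2432 2]); ([::
L 1568 1;L 1312 2;L 544 4;L 528 4;L 560 6;L 1596 3],[:: P 384 385 1;P 528 560 1;P 384 448 2;P 36 52
1;P 384 1408 4;D 388 56 4;P 544 560 1;P 528 656 2;D 656 1312 2;D 560 1408 4;C 38;P 384 896 4;D 400
1568 1;P 544 608 2;P 36 548 4;D 100 896 4;D 548 448 1;D 388 608 2;P 36 44 2;D 388 56 1;D 44 400 2]);
([:: L 3636 3],[:: P 48 56 2;P 384 385 1;D 56 3584 1;P 384 448 2;P 48 52 1;C 2;P 384 896 4;P 384
2432 4;P 48 1072 4;D 76 2432 4;P 48 560 4;D 2564 1072 4;P 48 2096 4;P 384 1408 4;D 81 1408 4;D 3080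
560 4;D 1540 2096 4;D 3076 560 4;D 1544 2096 4;D 52 1544 2;D 76 1408 4;D 3076 56 1;E 1 [::
1027;2564;448];E 1 [:: 2051;1540;448];D 52 3080 2;D 28 3104 4;D 1540 56 1;D 524 1072 4;D 1036 560
4;D 44 1552 4;D 1036 448 1;D 2051 1072 4;D 44 3088 4;D 2060 1072 4;D 1027 44 4;D 28 1568 4;P 1040
1552 4;E 1 [:: 35;524;3088];P 1056 1568 4;P 528 1552 4;E 1 [:: 19;524;3104];D 385 3088 2;P 12 1036
4;D 385 1552 2;P 544 1568 4;D 35 1036 2;D 2060 448 1;D 19 3104 2;C 1;P 1056 1072 1;P 1040 1072 1;P
1040 1104 2;P 1056 1312 2;C 0;D 385 1104 2;P 528 560 2;P 528 529 1;D 1041 448 1;E 1 [::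
529;14;3104];D 1041 896 4;P 12 14 1;D 529 1408 1;P 12 76 2;D 76 1408 2]); ([::
L 2052 4;L 2508 5;L 560 1;L 528 4;L 3612 2],[:: D 52 3584 2;P 48 56 2;P 48 52 1;C 3;C 0;D 56 3584
1;D 3076 560 1;P 384 385 1;P 384 448 2;P 2052 3076 1;P 384 896 4;P 48 560 4;P 2052 2116 2;D 3080 560
4;D 25 896 4;P 528 560 2;D 2116 392 2;P 528 532 1;P 528 529 1;D 529 392 1;D 532 3080 1;D 3076 536
4;D 385 536 2]); ([:: L 544 4;L 1056 1;L 560 6;L 528 4;L 1596 3],[:: D 28 1568 4;P 1056 1568 4;C 2;P
1056 1312 2]); ([:: L 1056 1;L 2564 1],[:: C 5;P 1536 3584 4;P 48 52 1;P 384 448 2;D 2564 56 1;P 384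
385 1;P 48 56 2;P 48 2096 4;C 2;P 384 896 4;D 56 448 1;D 328 176 4;D 76 896 4;D 56 3584 1;P 48 560
4;D 52 3584 2;D 1544 2096 4;P 384 2432 4;D 84 896 4;D 44 896 4;P 48 1072 4;D 13 2432 4;D 52 1544 2;D
76 2432 4;D 2568 1072 4;D 52 2568 2;D 44 2576 4;D 2564 56 4;D 28 2592 4;D 524 2096 4;D 2060 560 4;P
544 2592 4;D 385 2060 2;P 528 2576 4;P 516 2564 4;D 1044 2592 1;D 524 448 1;P 2052 2060 4;D 2060 448
1;D 1044 2568 2;C 1;P 528 560 1;C 0;D 1540 56 1;D 1540 2432 4;P 544 560 1;P 1536 1540 1;P 516 1540
1;P 528 592 2;P 544 552 2;D 2060 592 2;P 1536 1792 2;P 516 580 2;D 580 392 2;D 2053 392 1;P 2052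
2053 1;P 2052 2180 2;D 2180 1792 2;D 388 3584 1;D 388 2120 2;D 388 592 2;D 388 552 2;D 524 416 1;D
532 448 1;D 88 416 2;D 532 2120 4;D 2564 88 1]); ([:: L 1568 4;L 1600 2;L 1656 2],[:: P 384 385 1;P
384 448 2;D 448 3584 1;P 24 56 2;C 6;P 384 2432 4;D 56 3584 1;D 88 1568 4;D 25 2432 4;D 2072 1568
4;D 56 1600 1;P 24 2072 4;D 385 2072 2;D 1600 2432 4;P 24 25 1;D 1600 2432 2;D 25 2432 1]); ([::
L 1056 5;L 1600 2;L 552 2;L 1644 4;L 592 2;L 656 2;L 1596 6],[:: P 384 385 1;P 384 448 2;P 48 56 2;D
56 3584 1;P 1056 1064 2;D 328 176 4;C 7;P 48 52 1;P 48 560 4;D 56 448 1;P 1056 1312 2;P 1056 1120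
2;P 48 2096 4;P 48 1072 4;D 656 1312 2;P 384 1408 4;P 384 896 4;D 1544 2096 4;D 1064 592 2;D 56 896
4;D 76 1072 4;C 0;D 560 1408 4;D 400 1568 1;D 28 1568 1;D 104 400 2;D 28 1120 2;D 1568 448 1;P 96
104 2;D 552 400 2;D 1092 56 1;D 56 896 1;D 1120 896 2;D 1092 552 2;D 100 1544 1;D 1120 896 4;P 96
100 1;P 96 1120 4]); ([:: L 1600 2;L 544 5;L 1056 1;L 1644 4;L 592 2;L 656 2;L 1072 2;L 1596 6],[::
P 48 52 1;P 544 608 2;D 56 3584 1;P 48 56 2;P 544 552 2;C 8;P 48 1072 4;D 2568 1072 4;P 48 2096 4;C
0;P 1056 1568 4;C 1;D 1544 2096 4;D 2072 1568 4;D 1544 112 2;D 584 1072 2;D 2072 608 2;D 584 2096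
4;D 2568 112 1]); ([::
L 1600 2;L 1056 1;L 544 1;L 1644 4;L 528 5;L 1072 2;L 3696 2;L 603 4;L 1596 6],[:: P 528 592 2;C 9;D
56 3584 1;D 11 592 2;P 528 656 2;P 48 56 2;P 24 56 2;P 48 52 1;P 48 2096 4;C 0;P 544 1568 4;C 2;D
1544 2096 4;D 584 1072 2;P 544 2592 4;P 576 584 2;D 1064 592 2;D 1048 2592 4;D 1544 112 2;D 112 3584
1;P 24 1048 4;P 1056 1064 2;P 24 25 1;D 25 578 1;P 576 578 1;P 1056 3104 4;D 592 3104 4;P 576 592
4]); ([:: L 2624 2;L 544 1;L 1056 1;L 1027 4;L 1540 6;L 1072 2;L 528 1;L 571 6;L 603 4],[:: P 48 56
2;D 448 3584 1;P 384 385 1;P 40 56 2;P 1536 1540 1;P 384 448 2;D 1072 2624 2;D 1027 104 4;D 1540 104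
4;P 48 52 1;C 10;P 9 11 1;D 1540 56 4;P 1536 3584 4;D 56 3584 1;P 384 1408 4;P 1536 1600 2;P 48 2096
4;P 1536 1537 2;D 1544 2096 4;D 52 1544 2;D 41 1408 4;P 1536 1552 2;D 11 2096 4;D 11 1552 2;C 0;P
528 1552 4;D 2088 1552 4;D 1537 2088 2;P 528 536 4;P 528 2576 4;D 1064 2576 4;D 536 3104 4;P 40 2088
4;P 40 41 1;D 385 1064 2;D 1027 536 4;D 41 3584 1;P 40 42 1;P 9 41 2;D 41 2576 4;D 41 1408 1;P 1056
3104 4;P 9 2057 4;D 2624 1408 2;D 19 1544 1;D 529 42 1;D 2624 1408 4;D 19 2088 2;P 1056 1120 2;D 11
1120 2;D 529 2088 2;D 2057 1568 4;P 544 1568 4;P 544 552 2;D 41 2624 1;D 2561 56 1;D 67 1064 1;D 67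
2088 2;D 2051 56 1;D 2561 104 4;D 2113 552 2;D 2051 104 4;D 2113 42 1]); ([::
L 2624 2;L 1056 1;L 1027 4;L 560 6;L 1072 2],[:: D 56 3584 1;P 48 56 2;C 11;P 528 560 1;P 48 52 1;D
11 560 2;D 11 560 4;P 544 560 1;D 515 56 1;D 515 88 4;C 0;P 48 2096 4;D 1544 2096 4;D 1540 56 1;D 52
1544 2;D 44 1552 4;D 28 1568 4;P 528 1552 4;C 6;P 544 1568 4]); ([::
L 516 1;L 12 1;L 1040 1;L 528 2;L 1596 3],[:: D 44 1552 4;P 384 385 1;P 528 1552 4;D 1540 56 4;P 48
52 1;P 384 448 2;P 528 532 1;P 1040 1552 4;P 48 56 2;P 384 896 4;D 532 448 1;P 384 1408 4;P 516 1540
4;D 84 896 4;P 1040 1296 2;P 48 560 4;D 1036 560 4;P 12 1036 4;P 516 580 2;D 580 400 2;D 28 1408 4;D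
1036 400 1;P 12 140 2;D 140 1296 2]); ([:: L 1344 4;L 545 1;L 2977 6;L 1096 2;L 2729 6],[:: P 48 56
2;D 545 2432 1;P 48 52 1;D 545 2184 1;D 1096 2432 2;D 56 3584 1;C 13;P 48 560 4;D 2184 1344 4;D 3080
448 1;D 3080 560 4]); ([:: L 1072 2],[:: D 56 3584 1;P 384 448 2;C 11;P 24 56 2;P 2560 3584 4;P 48
52 1;P 320 448 2;C 14;D 11 1072 2;P 384 385 1;P 48 56 2;P 1536 3584 4;D 52 3584 2;P 384 2432 4;P 48
1072 4;P 48 2096 4;P 48 560 4;P 1056 1072 1;C 8;D 73 2432 4;D 137 2096 4;D 3080 560 4;P 2560 2564
1;P 1040 1072 1;D 2564 304 4;D 1544 2096 4;D 11 1072 4;P 2560 2816 2;D 2568 1072 4;D 2564 56 4;D 52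
1544 2;P 2560 2624 2;D 1027 56 1;D 1072 2624 2;P 2056 3080 4;D 52 2816 2;P 516 2564 1;P 2560 2592
2;D 52 3080 2;D 52 2568 2;P 1032 1544 4;C 2;D 2060 560 1;P 12 2060 1;D 3076 560 1;D 3076 56 4;P 2056
2060 1;P 2056 2057 2;D 385 2592 2;D 2308 560 1;P 528 560 2;D 3076 328 4;D 2057 1072 2;P 544 560 2;P
2056 2120 2;P 2056 2184 2;C 1;D 1036 560 1;D 385 2120 2;D 2057 448 1;D 2057 560 4;D 2057 1072 4;P
1032 1036 1;P 1032 1064 2;D 1540 56 1;P 1032 1096 2;D 3073 56 1;D 49 3080 1;D 49 2184 2;D 3073 168
4;P 1536 1540 1;P 1536 1600 2;D 2308 1096 2;D 49 2568 2;D 2177 56 1;D 324 3080 1;D 2561 56 1;D 2561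
416 4;D 2561 168 4;P 320 324 1;D 2177 1064 2;D 161 3080 1;P 320 1344 4;D 161 2568 2;C 0;P 544 545
1;P 544 2592 4;D 1048 2592 4;P 544 1568 4;C 7;D 1544 112 2;D 112 3584 1;D 1064 592 2;P 24 1048 4;D
592 3104 4;P 24 28 1;D 28 3104 1]); ([:: L 1056 3],[:: D 56 3584 1;C 15;P 1536 3584 4;C 0;P 1056
1568 4;P 2560 3584 4;P 48 56 2;C 12;P 1056 1064 4;P 24 56 2;P 1056 3104 4;D 52 3584 2;D 28 1568 4;P
48 52 1;P 48 560 4;D 536 3104 4;P 48 2096 4;D 76 560 4;D 1064 2576 4;D 28 3104 4;D 3080 560 4;D 52
3080 2;P 24 536 4;D 2564 1072 1;P 2560 2564 1;D 1544 2096 4;P 2560 2624 2;D 52 2624 2;P 24 28 1;D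
2564 112 4;D 28 3584 1;D 3076 56 1;D 100 2576 1;D 52 1544 2;D 100 536 2;D 28 608 1;D 3076 536 2;D
1540 56 1;D 2564 1048 4;P 1536 1540 1;P 1536 1600 2;D 1048 608 2;C 8]); ([::],[:: P 384 448 2;P 384
385 1;C 0;D 56 3584 1;C 1;P 2560 3584 4;C 13;P 1056 1072 2;D 52 3584 2;D 448 3584 1;P 384 1408 4;D
97 1408 4;C 16;P 40 56 2;P 1056 1057 1;P 384 2432 4;D 1057 448 1;D 2564 1072 1;D 385 1120 2;P 2560
2564 1;P 1056 1060 1;P 2560 2624 2;D 41 1408 4;D 1060 2576 1;P 1088 1120 2;D 14 1120 4;D 1064 2576
4;D 70 1064 2;P 40 1064 4;D 385 1064 2;P 40 41 1;P 40 44 1;D 1090 44 1;D 41 1408 1;D 2624 1408 2;P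
1088 1090 1;D 1600 2432 4;P 1088 1600 4])].

Lemma valid_two_points :
  valid 15%N true nopm_two_points facts_two_points [:: 1]%num nopm_two_points
    cert_two_points.
Proof. by vm_compute. Qed.

End Certificates.

(** * The minimal counterexample *)

(** [U] has no perfect matching avoiding a colour, while each proper subset
    whose cardinal is a multiple of 3 has one. No subset [F] of [U] is small enough
    with respect to some [j] and has, for each of the three colours, a matching of
    size [j] avoiding it. *)
Section Minimal.
Variables (V : finType) (c : {set V} -> 'I_3) (U : {set V}) (m : nat).
Hypothesis cardU : #|U| = 3 * m.
Hypothesis critical : forall i, ~~ mt (av c i) U m.
Hypothesis below : forall (F : {set V}) j,
  F \proper U -> #|F| = 3 * j -> exists i, mt (av c i) F j.
Hypothesis no_gadget : forall (F : {set V}) j, F \subset U -> 0 < j ->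
  4 * #|F| <= 13 * j -> exists i, ~~ mt (av c i) F j.

Lemma dual (F : {set V}) i j k : F \subset U -> mt (av c i) F j -> mt (av c i) (U :\: F) k
  ->
  j + k < m.
Proof.
move=> FU M N; rewrite ltnNge; apply/negP=> le.
by have := critical i; rewrite (mt_le le (mt_compl FU M N)).
Qed.

Lemma drop_edge (e : {set V}) : 0 < m -> e \subset U -> #|e| = 3 ->
  mt (av c (c e)) (U :\: e) m.-1.
Proof.
move=> m0 eU e3.
have [||i Mi] := @below (U :\: e) m.-1.
- rewrite properE subsetDl /=; apply/negP => /subset_leq_card.
  by rewrite cardsD (setIidPr eU) e3 cardU; lia.
- by rewrite cardsD (setIidPr eU) e3 cardU; lia.
have [<- //|ne] := eqVneq i (c e).
have := critical i; rewrite -(prednK m0); case/negP.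
by apply: (mt_add eU e3) => //; rewrite /av eq_sym.
Qed.

Lemma dominated (S : {set V}) : S \subset U -> #|S| = 6 -> exists i, ~~ mt (av c i) S 2.
Proof. by move=> SU S6; apply: no_gadget => //; rewrite S6. Qed.

(** Otherwise, removing the pair [A] would leave matchings of size [m - 1] that
    avoid each colour, on [3 * m - 2] points. *)
Lemma missed (A : {set V}) : 4 < m -> A \subset U -> #|A| = 2 ->
  exists i, [forall z in U :\: A, c (z |: A) != i].
Proof.
move=> m5 AU A2.
have [|||i Ni] := @no_gadget (U :\: A) m.-1; first exact: subsetDl.
- by lia.
- by rewrite cardsD (setIidPr AU) cardU A2; lia.
exists i; apply/forallP=> z; apply/implyP; rewrite inE => /andP[zA zU].
apply: contra Ni => /eqP <-.
apply: mt_subset (drop_edge _ _ _); first exact: setDS (subsetUr _ _).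
- by lia.
- by rewrite subUset sub1set zU.
- by rewrite cardsU1 zA A2.
Qed.

(** The situation described by a valid certificate does not occur in [U]. Here
    [3 * r] is the number of points not in [vs]; [extra] lists the absences of a
    perfect matching that do not come from that of [U]. *)
Lemma refute (vs : seq V) (cs : seq 'I_3) n q r usep ids extra closed facts pf :
  valid n usep (extra ++ closed) facts ids closed pf ->
  size vs = n -> n = 3 * q -> q + r = m -> (usep -> 4 < m) ->
  uniq vs -> [set x in vs] \subset U -> size cs = 3 -> uniq cs ->
  {in ids, forall i, mt (av c (col cs i)) (U :\: [set x in vs]) r} ->
  {in extra, forall l, ~~ mt (av c (col cs l.2)) (sv vs l.1) (pop l.1 %/ 3)} ->
  {in facts, forall f, c (sv vs f.1) \in cols cs f.2} -> False.
Proof.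
move=> /and3P[ch tri clo] sn nq qr um uvs vsU scs ucs Hr Hx Hf; subst n.
have vsU' : {subset vs <= U} by move=> x xv; apply: (subsetP vsU); rewrite inE.
have HF p d : (p, d) \in facts -> triple (size vs) p && (c (sv vs p) \in cols cs d).
  by move=> pf'; rewrite (Hf _ pf') (allP tri _ pf').
apply: (@check_sound V c U vs cs uvs vsU' scs ucs usep (extra ++ closed) facts
  dominated _ _ HF [::] pf isT ch).
  by move=> up A AU A2; apply: missed => //; apply: um.
move=> i u; rewrite mem_cat => /orP[/Hx //|ul].
have /and4P[iis si su cl] := allP clo _ ul.
have [k [pk M]] := closes_sound uvs vsU' scs ucs HF (fun x xf => xf) si su cl (Hr _ iis).
apply/negP => Mu; have := dual (sv_sub uvs vsU' u) Mu M.
rewrite /= nq in pk; by move: pk qr; clear; lia.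
Qed.

(** The triples coloured [t]. *)
Definition on (t : 'I_3) : pred {set V} := fun e => c e == t.

Lemma on_av t i F j : i != t -> mt (on t) F j -> mt (av c i) F j.
Proof. by move=> it; apply: mt_weaken => e /eqP ce; rewrite /av ce eq_sym. Qed.

(** No six-point set [S] has a complement covered by triples of a single colour
    [t]: for [m = 3], [m = 4] and [m > 4], a certificate excludes [S] together with
    one or two of these triples. *)
Lemma neutral_refuted (S : {set V}) t : 2 < m -> S \subset U -> #|S| = 6 ->
  mt (on t) (U :\: S) (m - 2) -> False.
Proof.
move=> m3 SU S6 M; have [a [b u]] := other_colours t.
move: (u); rewrite /= !inE negb_or => /andP[/andP[ab at_] /andP[bt _]].
have N i : i != t -> ~~ mt (av c i) S 2.
  move=> it; apply/negP=> Mi; have := dual SU Mi (on_av it M); lia.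
have [s [s6 us sS c7 c11]] := neutral_labels ab S6 (N a at_) (N b bt).
have [k mk] : exists k, m = k.+3 by exists (m - 3); lia.
have em : m - 2 = k.+1 by rewrite mk.
rewrite em in M; have /mtP[g [gU g3 /eqP cg M']] := M.
have [x6 [x7 [x8 [ug eg]]]] := triple_points g3.
have uv : uniq (s ++ [:: x6; x7; x8]).
  apply: uniq_catS => //; rewrite sS eg disjoint_sym.
  by move: gU; rewrite subsetD => /andP[].
have vU : [set x in s ++ [:: x6; x7; x8]] \subset U.
  by rewrite set_cat sS eg subUset SU (subset_trans gU) ?subsetDl.
have eW : U :\: [set x in s ++ [:: x6; x7; x8]] = (U :\: S) :\: g.
  by rewrite set_cat sS eg setDDl.
case: s s6 us sS c7 c11 uv vU eW => [|x0 [|x1 [|x2 [|x3 [|x4 [|x5 []]]]]]] // _ us sS.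
move=> c7 c11; rewrite /sv /= in c7 c11.
rewrite [_ ++ _]/=; set vg := [:: x0, x1, x2, x3, x4, x5 & _] => uv vU eW; subst t.
case: k => [|k] in mk em M M'.
  apply: (refute (cs := [:: a; b; c g]) (r := 0) (extra := [::])
    valid_nine _ (erefl (3 * 3)) (esym mk) _ uv vU (erefl _) u).
  - by [].
  - by [].
  - by [].
  - by [].
  - by apply/allP; rewrite /facts_nine /cols /sv /= !inE c7 c11 eg !eqxx.
have /mtP[h [hU h3 /eqP ch M'']] := M'.
have [x9 [x10 [x11 [uh eh]]]] := triple_points h3.
set vs := vg ++ [:: x9; x10; x11].
have uv' : uniq vs.
  apply: uniq_catS => //.
  by rewrite eh disjoint_sym; move: hU; rewrite -eW subsetD => /andP[].
have eV : [set x in vs] = [set x in vg] :|: h.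
  by rewrite -eh -set_cat.
have vU' : [set x in vs] \subset U.
  by rewrite eV subUset vU (subset_trans hU) // -eW subsetDl.
rewrite [vs]/= in uv' vU' eV.
case: k => [|k] in mk em M M' M''.
  apply: (refute (cs := [:: a; b; c g]) (r := 0) (extra := [::])
    valid_twelve _ (erefl (3 * 4)) (esym mk) _ uv' vU' (erefl _) u).
  - by [].
  - by [].
  - by [].
  - by [].
  - by apply/allP; rewrite /facts_twelve /cols /sv /= !inE c7 c11 eg eh ch !eqxx.
have M4 : mt (on (c g)) (U :\: [set x in vs]) k.+1 by rewrite eV -setDDl eW.
apply: (refute (cs := [:: a; b; c g]) (r := k.+1) (extra := [::])
  valid_twelve_pairs _ (erefl (3 * 4)) (esym mk) _ uv' vU' (erefl _) u).
- by [].
- by rewrite mk.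
- by move=> i; rewrite !inE => /orP[]/eqP ->; apply: on_av M4.
- by [].
- by apply/allP; rewrite /facts_twelve_pairs /cols /sv /= !inE c7 c11 eg eh ch !eqxx.
Qed.

(** [F] has six points, and its complement has a perfect matching avoiding [one]
    with at least one triple coloured [two] and at least two coloured [three]. *)
Lemma neutral_with_block_refuted (F Q2 Q3 : {set V}) one two three a b :
  uniq [:: one; two; three] -> F \subset U -> #|F| = 6 ->
  ~~ mt (av c one) F 2 -> ~~ mt (av c two) F 2 ->
  Q2 \subset U :\: F -> Q3 \subset U :\: F -> [disjoint Q2 & Q3] ->
  mt (on two) Q2 a.+1 -> mt (on three) Q3 b.+2 -> a + b + 5 = m -> False.
Proof.
move=> u FU F6 N1 N2 Q2F Q3F d M2 M3 mab.
move: (u); rewrite /= !inE negb_or => /andP[/andP[o12 o13] /andP[o23 _]].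
have [s [s6 us sS c7 c11]] := neutral_labels o12 F6 N1 N2.
have [f [f3 /eqP cf fQ [Wf Q2f M2']]] := peel Q2F M2.
have {}Q3F := subsetDU d fQ Q3F.
have [g [g3 /eqP cg gQ [Wg Q3g {}M3]]] := peel Q3F M3.
have [h [h3 /eqP ch hQ [Wh Q3h M3']]] := peel Q3g M3.
have [x6 [x7 [x8 [_ ef]]]] := triple_points f3.
have [x9 [x10 [x11 [_ eg]]]] := triple_points g3.
have [x12 [x13 [x14 [_ eh]]]] := triple_points h3.
set W := F :|: f :|: g :|: h in Wh Q3h.
set vs := ((s ++ [:: x6; x7; x8]) ++ [:: x9; x10; x11]) ++ [:: x12; x13; x14].
have eW : [set x in vs] = W by rewrite !set_cat sS ef eg eh.
have uv : uniq vs by apply: uniq_set; rewrite eW Wh Wg Wf F6 !size_cat s6.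
have vU : [set x in vs] \subset U.
  rewrite eW !subUset FU (subset_trans fQ) ?(subset_trans gQ) ?(subset_trans hQ) //.
  - by apply: subset_trans (subsetDl _ _) _; apply: subset_trans Q3F (subsetDl _ _).
  - exact: subset_trans Q3F (subsetDl _ _).
  - exact: subset_trans Q2F (subsetDl _ _).
have M : mt (av c one) (U :\: [set x in vs]) (a + b).
  have M23 : mt (av c one) ((Q2 :\: f) :|: (Q3 :\: g :\: h)) (a + b).
    apply: mt_union; last exact: on_av M3'.
      apply: disjointWl (subsetDl _ _) _; apply: disjointWr d.
      by rewrite setDDl subsetDl.
    exact: on_av M2'.
  apply: mt_subset M23; rewrite eW subUset Q3h andbT.
  apply: (@subsetDU _ _ _ Q3) => //.
    by rewrite disjoint_sym; apply: disjointWl d; apply: subsetDl.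
    exact: subset_trans hQ (subsetDl _ _).
  apply: (@subsetDU _ _ _ Q3) => //.
  by rewrite disjoint_sym; apply: disjointWl d; apply: subsetDl.
rewrite {}/vs in uv vU M eW.
case: s s6 us sS c7 c11 uv vU M eW => [|x0 [|x1 [|x2 [|x3 [|x4 [|x5 []]]]]]] // _ us sS.
move=> c7 c11; rewrite /sv /= in c7 c11.
rewrite [_ ++ _]/=; set vs := [:: x0, x1, x2, x3, x4, x5 & _] => uv vU M eW;
  subst two three.
apply: (refute (cs := [:: one; c f; c g]) (r := a + b) (extra := [:: L 63 2])
  valid_neutral _ (erefl (3 * 5)) _ _ uv vU (erefl _) u).
- by [].
- by rewrite -mab addnC.
- by rewrite -mab addnC.
- by move=> i; rewrite inE => /eqP ->.
- move=> l; rewrite inE => /eqP ->.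
  by rewrite -[sv _ _]/[set x in [:: x0; x1; x2; x3; x4; x5]] sS.
- by apply/allP; rewrite /facts_neutral /cols /sv /= !inE c7 c11 ef eg eh ch !eqxx.
Qed.

(** Two complementary triples of [e :|: f], other than [e] and [f], exchange a point
    [z] of [e] with a point [u] of [f]. *)
Lemma crossing_pair (e f : {set V}) one : #|e| = 3 -> #|f| = 3 -> [disjoint e & f] ->
    c f != one -> mt (on one) (e :|: f) 2 ->
  exists z u, [/\ z \in e, u \in f, c (u |: (e :\ z)) = one & c (z |: (f :\ u)) = one].
Proof.
move=> e3 f3 def nf /mtP[h [hS h3 /eqP ch /mtP[k [kS k3 /eqP ck _]]]].
have hk : [disjoint h & k] by rewrite disjoint_sym; move: kS; rewrite subsetD => /andP[].
have kS' : k \subset e :|: f by apply: subset_trans kS (subsetDl _ _).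
have S : h :|: k = e :|: f.
  apply/eqP; rewrite eqEcard subUset hS kS' !cardsU (disjoint_setI0 def).
  by rewrite (disjoint_setI0 hk) cards0 e3 f3 h3 k3.
have core (a b : {set V}) : c a = one -> c b = one -> #|a| = 3 -> #|b| = 3 ->
    a :|: b = e :|: f -> [disjoint a & b] -> #|e :\: a| <= 1 ->
  exists z u, [/\ z \in e, u \in f, c (u |: (e :\ z)) = one & c (z |: (f :\ u)) = one].
  move=> ca cb a3 b3 S' dab ea.
  have eb : b = (e :|: f) :\: a.
    by rewrite -S' setDUl setDv set0U; apply/esym/setDidPl; rewrite disjoint_sym.
  have /esym/eqP := cardsID a e; rewrite e3.
  case: (#|e :\: a| =P 0) => [/eqP|e0].
    rewrite cards_eq0 setD_eq0 => sub _.
    have ae : e = a by apply/eqP; rewrite eqEcard sub a3 e3.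
    case/eqP: nf; rewrite -cb eb -ae setDUl setDv set0U; congr c.
    by apply/esym/setDidPl; rewrite disjoint_sym.
  have e1 : #|e :\: a| = 1 by lia.
  rewrite e1 addn1 => /eqP[] eIa; have /cards1P[z ez] : #|e :\: a| == 1 by rewrite e1.
  have ae1 : #|a :\: e| = 1 by have := cardsID e a; rewrite setIC -eIa a3; lia.
  have /cards1P[u au] : #|a :\: e| == 1 by rewrite ae1.
  have aS x : x \in a -> (x \in e) || (x \in f).
    by move=> xa; rewrite -in_setU -S' in_setU xa.
  have ef x : x \in e -> x \notin f by move=> xe; rewrite (disjointFr def xe).
  have eqz x : (x == z) = (x \notin a) && (x \in e) by rewrite -in_setD ez inE.
  have equ x : (x == u) = (x \notin e) && (x \in a) by rewrite -in_setD au inE.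
  have /andP[za ze] : (z \notin a) && (z \in e) by rewrite -eqz.
  have /andP[ue ua] : (u \notin e) && (u \in a) by rewrite -equ.
  exists z, u; split=> //.
  - by move: (aS u ua); rewrite (negbTE ue).
  - rewrite -ca; congr c; apply/setP=> x; rewrite !inE eqz equ.
    by case: (x \in e); case: (x \in a).
  - rewrite -cb eb; congr c; apply/setP=> x; rewrite !inE eqz equ.
    move: (ef x) (aS x).
    by case: (x \in e); case: (x \in a); case: (x \in f) => //= h1 h2;
      try (by have := h1 isT); have := h2 isT.
have eDh : e :\: h = e :&: k.
  apply/setP=> x; rewrite !inE andbC.
  case: (boolP (x \in e)) => //= xe.
  have : x \in h :|: k by rewrite S inE xe.
  by rewrite inE; case: (boolP (x \in h)) => [xh _|_ /= ->] //; rewrite (disjointFr hk xh).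
have := cardsID k e; rewrite e3 -eDh => split.
have [le|gt] := leqP #|e :\: h| 1; first exact: (core h k).
by apply: (core k h); rewrite ?(setUC k) // 1?disjoint_sym //; lia.
Qed.

(** A part [F] without the colour [three] and with at least nine points: [e] and two
    triples [f], [f'] coloured [two] form nine points, in which both [e :|: f] and
    [e :|: f'] have a perfect matching coloured [one]. Each exchanges a point of
    [e], and there is one certificate for equal points and one for different
    points. *)
Lemma two_coloured_part_refuted (F Q2 Q3 e : {set V}) one two three j a b :
  uniq [:: one; two; three] -> F \subset U ->
  (forall h : {set V}, h \subset F -> #|h| = 3 -> c h != three) ->
  e \subset F -> #|e| = 3 -> c e = one -> mt (on two) (F :\: e) j.+2 ->
  (forall f : {set V}, f \subset F :\: e -> #|f| = 3 -> c f = two ->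
    mt (on two) (F :\: e :\: f) j.+1 -> mt (av c two) (e :|: f) 2) ->
  Q2 \subset U :\: F -> Q3 \subset U :\: F -> [disjoint Q2 & Q3] ->
  mt (on two) Q2 a -> mt (on three) Q3 b.+2 -> j + a + b + 5 = m -> False.
Proof.
move=> u FU F3 eF e3 ce MF pair Q2F Q3F d M2 M3 mab.
have [em m5] : 5 + (j + (a + b)) = m /\ 4 < m by clear -mab; lia.
move: (u); rewrite /= !inE negb_or => /andP[/andP[o12 o13] /andP[o23 _]].
have FeU : F :\: e \subset U :\: e by apply: setSD.
have [f [f3 /eqP cf fF [Wf Ff MF']]] := peel FeU MF.
have [f' [f'3 /eqP cf' f'F [Wf' Ff' MF'']]] := peel Ff MF'.
have dF (Q : {set V}) : Q \subset U :\: F -> [disjoint F & Q].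
  by rewrite subsetD disjoint_sym => /andP[].
have QW (Q : {set V}) : Q \subset U :\: F -> Q \subset U :\: (e :|: f :|: f').
  move=> QF; have dQ := dF _ QF; have QU := subset_trans QF (subsetDl _ _).
  have f'F' : f' \subset F by apply: subset_trans f'F _; rewrite setDDl subsetDl.
  apply: (subsetDU dQ f'F'); apply: (subsetDU dQ (subset_trans fF (subsetDl _ _))).
  by rewrite subsetD QU disjoint_sym; apply: (disjointWl _ dQ).
have [g [g3 /eqP cg gQ [Wg Q3g {}M3]]] := peel (QW _ Q3F) M3.
have [h [h3 /eqP ch hQ [Wh Q3h M3']]] := peel Q3g M3.
set W := e :|: f :|: f' in Wf' Ff' Wg Q3g Wh Q3h.
have WF : W \subset F.
  by rewrite !subUset eF (subset_trans fF) ?subsetDl ?(subset_trans f'F) // setDDl subsetDl.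
have gQ3 : g \subset Q3 by [].
have hQ3 : h \subset Q3 by apply: subset_trans hQ (subsetDl _ _).
have W15 : #|W :|: g :|: h| = 15 by rewrite Wh Wg Wf' Wf e3.
have Q3U : Q3 \subset U := subset_trans Q3F (subsetDl _ _).
have WU : W :|: g :|: h \subset U.
  by rewrite 2!subUset (subset_trans WF FU) (subset_trans gQ3 Q3U) (subset_trans hQ3 Q3U).
have M : mt (av c one) (U :\: (W :|: g :|: h)) (j + (a + b)).
  have Q2W : Q2 \subset U :\: (W :|: g :|: h).
    by do 2!(apply: (@subsetDU _ _ _ Q3) => //; first by rewrite disjoint_sym); apply: QW.
  have FW : F :\: e :\: f :\: f' \subset U :\: (W :|: g :|: h).
    have d3 : [disjoint Q3 & F :\: e :\: f :\: f'].
      by rewrite disjoint_sym; apply: disjointWl (dF _ Q3F); rewrite !setDDl subsetDl.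
    by do 2!(apply: (@subsetDU _ _ _ Q3) => //).
  have M23 : mt (av c one) (Q2 :|: (Q3 :\: g :\: h)) (a + b).
    apply: mt_union (on_av _ M2) (on_av _ M3') => //.
    by apply: disjointWr d; rewrite setDDl subsetDl.
  have := mt_union _ (on_av o12 MF'') M23; move=> MM.
  apply: mt_subset (MM _); first by rewrite !subUset FW Q2W.
  have FF : F :\: e :\: f :\: f' \subset F by rewrite !setDDl subsetDl.
  rewrite disjoint_sym -setI_eq0 setIUl setU_eq0 !setI_eq0
    ![[disjoint _ & F :\: _ :\: _ :\: _]]disjoint_sym.
  rewrite (disjointWl FF (dF _ Q2F)) (disjointWl FF) //.
  by apply: disjointWr (dF _ Q3F); rewrite setDDl subsetDl.
have low (h0 : {set V}) : h0 \subset F -> #|h0| = 3 -> c h0 \in [:: one; two].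
  move=> h0F h03; have := @cs_all [:: one; two; three] erefl u (c h0).
  by rewrite !inE (negbTE (F3 _ h0F h03)) orbF.
have cross (k : {set V}) : k \subset F :\: e -> #|k| = 3 -> c k = two ->
  mt (on two) (F :\: e :\: k) j.+1 ->
  exists z y, [/\ z \in e, y \in k, c (y |: (e :\ z)) = one & c (z |: (k :\ y)) = one].
  move=> kF k3 ck Mk; have kF' := subset_trans kF (subsetDl _ _).
  apply: crossing_pair => //.
  - by move: kF; rewrite subsetD disjoint_sym => /andP[].
  - by rewrite ck eq_sym.
  - apply: mt_sub (pair k kF k3 ck Mk) => // x xS x3 /negP nx; apply/eqP.
    have := low x; rewrite (subset_trans xS) ?subUset ?eF // => /(_ isT x3).
    by rewrite !inE => /orP[/eqP//|].
have [z [y [ze yf c1 c2]]] := cross f fF f3 cf MF'.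
have f'Fe : f' \subset F :\: e by apply: subset_trans f'F (subsetDl _ _).
have Mf' : mt (on two) (F :\: e :\: f') j.+1.
  apply: (@mt_add _ _ _ f) => //; last 1 first.
  - by rewrite setDDl setUC -setDDl.
  - rewrite subsetD fF disjoint_sym.
    by move: f'F; rewrite subsetD => /andP[].
  - by rewrite /= /on cf.
have [z' [y' [z'e y'f c1' c2']]] := cross f' f'Fe f'3 cf' Mf'.
have [v [w [fD ef]]] := choose_point f3 yf.
have [v' [w' [f'D ef']]] := choose_point f'3 y'f.
have [x9 [x10 [x11 [_ eg]]]] := triple_points g3.
have [x12 [x13 [x14 [_ eh]]]] := triple_points h3.
have vsP x0 x1 x2 : [set x in [:: x0; x1; x2]] = e ->
  let vs := [:: x0, x1, x2, y, v, w, y', v', w', x9, x10, x11 & [:: x12; x13; x14]] in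
  [/\ uniq vs, [set x in vs] = W :|: g :|: h &
    {in low9, forall f, c (sv vs f.1) \in cols [:: one; two; three] f.2}].
  move=> ee vs; have eW : [set x in vs] = W :|: g :|: h.
    rewrite /W -ee ef ef' -eg -eh; apply/setP=> x; rewrite !inE.
    by rewrite -!orbA; do 3!congr orb; btauto.
  have uv : uniq vs by apply: uniq_set; rewrite eW W15.
  have e9 : [set x in take 9 vs] = W.
    by rewrite /W -ee ef ef'; apply/setP=> x; rewrite !inE; btauto.
  split=> // l ll.
  have /allP/(_ l ll)/and3P[/eqP l2 /eqP p3 s9] :
    all (fun l : lit => [&& l.2 == 3%num, pop l.1 == 3 & size (bits l.1) <= 9]) low9.
    by vm_compute.
  rewrite l2; apply: low; last by rewrite card_sv // (leq_trans s9).
  by apply: subset_trans WF; rewrite -e9; apply: sv_take.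
have perm (s t : seq V) i : s =i t -> c [set x in s] = i -> c [set x in t] = i.
  by move=> st <-; congr c; apply/setP=> x; rewrite !in_set st.
have cy : c [set t in [:: y; v; w]] = two.
  by rewrite -cf ef; apply: perm erefl => x; rewrite !inE; btauto.
have cy' : c [set t in [:: y'; v'; w']] = two.
  by rewrite -cf' ef'; apply: perm erefl => x; rewrite !inE; btauto.
have c2s : c [set t in [:: z; v; w]] = one.
  by rewrite -c2 fD; congr c; apply/setP=> x; rewrite !inE.
have c2s' : c [set t in [:: z'; v'; w']] = one.
  by rewrite -c2' f'D; congr c; apply/setP=> x; rewrite !inE.
have [ez|nz] := eqVneq z z'.
  have [x0 [x1 [eD ee]]] := choose_point e3 ze.
  have [uv eW lowP] := vsP x0 x1 z (esym ee).
  have c1s : c [set t in [:: x0; x1; y]] = one.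
    by rewrite -c1 eD; congr c; apply/setP=> x; rewrite !inE; btauto.
  have c1s' : c [set t in [:: x0; x1; y']] = one.
    by rewrite -c1' -ez eD; congr c; apply/setP=> x; rewrite !inE; btauto.
  apply: (refute (cs := [:: one; two; three]) (r := j + (a + b)) (extra := [::])
    valid_same_point _ (erefl (3 * 5)) em _ uv _ (erefl _) u).
  - by [].
  - by [].
  - by rewrite eW.
  - by move=> i; rewrite inE => /eqP -> ; rewrite eW.
  - by [].
  - move=> l; rewrite mem_cat => /orP[|/lowP//]; move: l; apply/allP.
    by rewrite /cols /sv /= !inE -ee ce cy cy' eg eh cg ch c1s c1s' c2s ez c2s' !eqxx.
have [x1 [eD ee]] : exists x1, e :\ z = [set t in [:: z'; x1]] /\
  e = [set t in [:: z'; x1; z]].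
  have [p [q [eD ee]]] := choose_point e3 ze.
  have : z' \in e :\ z by rewrite !inE eq_sym nz.
  rewrite eD !inE => /orP[]/eqP ->; [exists q|exists p]; rewrite ?eD ee;
  split; apply/setP=> x; rewrite !inE; btauto.
have [uv eW lowP] := vsP z' x1 z (esym ee).
have eD' : e :\ z' = [set t in [:: x1; z]].
  move: (uv); rewrite /= !inE !negb_or => /andP[/and3P[n1 n2 _] _].
  by rewrite ee; apply/setP=> x; rewrite !inE; case: (eqVneq x z') => [->|_] //=;
    rewrite (negbTE n1) (negbTE n2).
have c1s : c [set t in [:: z'; x1; y]] = one.
  by rewrite -c1 eD; congr c; apply/setP=> x; rewrite !inE; btauto.
have c1s' : c [set t in [:: x1; z; y']] = one.
  by rewrite -c1' eD'; congr c; apply/setP=> x; rewrite !inE; btauto.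
apply: (refute (cs := [:: one; two; three]) (r := j + (a + b)) (extra := [::])
  valid_two_points _ (erefl (3 * 5)) em _ uv _ (erefl _) u).
- by [].
- by [].
- by rewrite eW.
- by move=> i; rewrite inE => /eqP -> ; rewrite eW.
- by [].
- move=> l; rewrite mem_cat => /orP[|/lowP//]; move: l; apply/allP.
  by rewrite /cols /sv /= !inE -ee ce cy cy' eg eh cg ch c1s c1s' c2s c2s' !eqxx.
Qed.

(** [k] is the only colour that a perfect matching of [F] can avoid. *)
Definition tight (F : {set V}) (k : 'I_3) : bool :=
  mt (av c k) F (#|F| %/ 3) && [forall i, (i != k) ==> ~~ mt (av c i) F (#|F| %/ 3)].

Lemma exists_tight : exists2 F : {set V}, (F \proper U) && (3 %| #|F|) & exists k,
  tight F k.
Proof.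
have m0 : 0 < m by case: (m) critical => [/(_ ord0)|].
have [e eU e3] : exists2 e : {set V}, e \subset U & #|e| = 3.
  have /card_gt0P[e] : 0 < #|[set A : {set V} | A \subset U & #|A| == 3]|.
    by rewrite cards_draws bin_gt0 cardU; lia.
  by rewrite inE => /andP[eU /eqP e3]; exists e.
have cD : #|U :\: e| = 3 * m.-1 by rewrite cardsD (setIidPr eU) e3 cardU; lia.
exists (U :\: e).
  rewrite cD dvdn_mulr // andbT properE subsetDl /=; apply/negP => /subset_leq_card.
  by rewrite cD cardU; lia.
exists (c e); rewrite /tight cD mulKn // drop_edge //=.
apply/forallP=> i; apply/implyP=> ie; apply: contra (critical i) => M.
by rewrite -(prednK m0); apply: (mt_add eU e3) => //; rewrite /av eq_sym.
Qed.

(** Take a smallest [F] with only one avoidable colour [k]. By minimality, no triple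
    in [F] is coloured [k], and what remains of [F] after removing a triple coloured
    [i] can be covered by triples of the third colour. The complement [Q] of [F]
    has a perfect matching avoiding some colour [i] other than [k]; together with a
    triple [e] of [F] coloured [i] and triples of the third colour [t] covering the
    rest of [F], it forms a perfect matching of [U] in which [e] alone is coloured
    [i]. The cases depend on the numbers [a] and [b] of triples of [Q] coloured [t]
    and [k], and on the size of [F]. *)
Lemma no_minimal_counterexample : False.
Proof.
have [F [[pF dF [k /andP[Mk /forallP Nk]]] minF]] : exists F : {set V},
    [/\ F \proper U, 3 %| #|F| & exists k, tight F k] /\
    forall G : {set V}, #|G| < #|F| -> G \proper U -> 3 %| #|G| -> forall k, ~~ tight G k.
  have [F0 P0 [k0 t0]] := exists_tight.
  pose T (F : {set V}) := [&& F \proper U, 3 %| #|F| & [exists k, tight F k]].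
  have T0 : T F0 by rewrite /T andbA P0; apply/existsP; exists k0.
  case: (arg_minnP (fun F : {set V} => #|F|) T0) => F /and3P[pF dF /existsP tF] min.
  exists F; split=> // G lt pG dG i; apply/negP=> tG.
  have TG : T G by rewrite /T pG dG; apply/existsP; exists i.
  by have := min G TG; rewrite leqNgt lt.
have FU := proper_sub pF.
have [j cF] : exists j, #|F| = 3 * j by exists (#|F| %/ 3); rewrite mulnC divnK.
rewrite cF mulKn // in Mk Nk.
have {}Nk i : i != k -> ~~ mt (av c i) F j by move=> ik; apply: (implyP (Nk i)).
have [a0 [b0 u0]] := other_colours k.
have [a0k b0k ab0] : [/\ a0 != k, b0 != k & a0 != b0].
  by move: u0; rewrite /= !inE negb_or => /andP[/andP[-> ->] /andP[-> _]].
have ltjm : j < m.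
  by have := proper_card pF; rewrite cF cardU; clear; lia.
have j2 : 1 < j.
  case: j cF Nk {Mk ltjm} => [|[|//]] cF Nk; first by have := Nk _ a0k.
  have one i : i != k -> c F == i.
    move=> ik; apply: contraR (Nk i ik) => nc; by apply: mt_edge.
  by move: ab0; rewrite -(eqP (one _ a0k)) -(eqP (one _ b0k)) eqxx.
(* By minimality of [F], a smaller part has perfect matchings avoiding two colours. *)
have two_full (G : {set V}) l : G \subset F -> #|G| = 3 * l -> l < j ->
    exists i i', [/\ i != i', mt (av c i) G l & mt (av c i') G l].
  move=> GF cG lj.
  have pG : G \proper U := sub_proper_trans GF pF.
  have [i Mi] := below pG cG; exists i.
  have := minF G _ pG _ i; rewrite cG cF ltn_pmul2l // lj dvdn_mulr // => /(_ isT isT).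
  rewrite /tight cG mulKn // Mi /= negb_forall => /existsP[i'].
  rewrite negb_imply negbK => /andP[ii' Mi']; exists i'; split=> //; by rewrite eq_sym.
have drop (h : {set V}) : h \subset F -> #|h| = 3 -> c h != k /\ mt (av c (c h)) (F :\: h)
  j.-1.
  move=> hF h3; have cD : #|F :\: h| = 3 * j.-1 by rewrite cardsD (setIidPr hF) h3 cF;
    move: (ltnW j2); clear; lia.
  have full i : mt (av c i) (F :\: h) j.-1 -> i != c h -> i = k.
    move=> Mi ih; apply/eqP; apply: contraT => ik; have := Nk i ik.
    rewrite -(prednK (ltnW j2)) (mt_add hF h3 _ Mi) //.
    by rewrite /av eq_sym.
  have [||i [i' [ii' Mi Mi']]] := two_full _ _ _ cD;
    [exact: subsetDl|by move: (ltnW j2); clear; lia|].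
  have [e|ne] := eqVneq i (c h).
    have [e'|ne'] := eqVneq i' (c h); first by rewrite e e' eqxx in ii'.
    by rewrite -{1}e -(full _ Mi' ne') -e; split.
  have [e'|ne'] := eqVneq i' (c h); last by rewrite (full _ Mi ne) (full _ Mi' ne') eqxx
    in ii'.
  by rewrite -(full _ Mi ne) -e' eq_sym; split.
pose Q := U :\: F.
have cQ : #|Q| = 3 * (m - j) by rewrite cardsD (setIidPr FU) cF cardU; clear; lia.
have pQ : Q \proper U.
  by rewrite properE subsetDl /=; apply/negP => /subset_leq_card; rewrite cQ cardU;
    move: j2 ltjm; clear; lia.
have [i Mi] := below pQ cQ.
have ik : i != k.
  by apply/eqP=> e; have := dual FU Mk; rewrite -e => /(_ _ Mi); rewrite subnKC ?ltnn //
    ltnW.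
have [t u] := third_colour ik.
move: (u); rewrite /= !inE negb_or => /andP[/andP[it _] /andP[tk _]].
have F3 (h : {set V}) : h \subset F -> #|h| = 3 -> c h != k by move=> hF /(drop h hF)[].
have on_t (G : {set V}) l : G \subset F -> mt (av c i) G l -> mt (on t) G l.
  move=> GF; apply: mt_sub => // e eG e3 ei.
  have := @cs_all [:: i; t; k] erefl u (c e).
  by rewrite !inE (negbTE ei) (negbTE (F3 e (subset_trans eG GF) e3)) orbF.
have [e [eF e3 ce]] : exists e : {set V}, [/\ e \subset F, #|e| = 3 & c e = i].
  have [/existsP[e /and3P[eF /eqP e3 /eqP ce]]|/existsPn no] :=
    boolP [exists e : {set V}, [&& e \subset F, #|e| == 3 & c e == i]]; first by exists e.
  have := Nk i ik; rewrite (mt_sub _ _ Mk) // => e eF e3 _.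
  by have := no e; rewrite eF e3.
have Me : mt (on t) (F :\: e) j.-1.
  apply: on_t; first exact: subsetDl.
  by have [_] := drop e eF e3; rewrite ce.
have [Q2 [Q3 [a [b [QQ d ab [c2 M2'] [c3 M3']]]]]] := mt_split (on t) Mi.
have M2 : mt (on t) Q2 a by apply: mt_weaken M2' => x /andP[].
have M3 : mt (on k) Q3 b.
  apply: mt_weaken M3' => x /andP[xi xt]; have := @cs_all [:: i; t; k] erefl u (c x).
  by rewrite !inE (negbTE xi); move: xt; rewrite /= /on => /negbTE ->.
have [Q2Q Q3Q] : Q2 \subset Q /\ Q3 \subset Q by move: QQ; rewrite subUset => /andP[].
have dFQ : [disjoint F & Q] by apply: disjointsD.
have bpos : 0 < b.
  case: b ab M3 {c3 M3'} => // ab _; have M : mt (av c k) Q (m - j).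
    by apply: mt_subset Q2Q _; rewrite -ab addn0; apply: on_av M2; rewrite eq_sym.
  by have := dual FU Mk M; rewrite subnKC ?ltnn // ltnW.
(* With a single triple [g] coloured [k], the complement of [e :|: g] is coloured [t]. *)
case: b bpos ab M3 {c3 M3'} => [//|[|b]] _ ab M3.
  have /mtP[g [gQ3 g3 /eqP cg _]] := M3.
  have gQ : g \subset Q by apply: subset_trans Q3Q.
  apply: (neutral_refuted (S := e :|: g) (t := t)).
  - by move: j2 ltjm; clear; lia.
  - by rewrite subUset (subset_trans eF FU) (subset_trans gQ) ?subsetDl.
  - rewrite cardsU (disjoint_setI0 _) ?cards0 ?e3 ?g3 //.
    by apply: disjointWl eF _; apply: disjointWr gQ dFQ.
  - have -> : m - 2 = j.-1 + a by move: ab j2 ltjm; clear; lia.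
    apply: mt_subset (mt_union _ Me M2).
      rewrite subUset -setDDl !subsetD (subset_trans (subsetDl _ _) FU) (subset_trans Q2Q)
        ?subsetDl //=.
      rewrite ![[disjoint _ & e]]disjoint_sym disjointsD (disjointWl eF) ?(disjointWr Q2Q)
        //=.
      rewrite (disjointWr gQ3 d) andbT.
      by apply: disjointWl (subsetDl _ _) _; apply: disjointWr gQ dFQ.
    by apply: disjointWl (subsetDl _ _) _; apply: disjointWr Q2Q dFQ.
have QF2 : Q2 \subset U :\: F := Q2Q; have QF3 : Q3 \subset U :\: F := Q3Q.
have [j3|j3] := leqP j 2.
  have ej : j = 2 by apply/eqP; rewrite eqn_leq j3.
  subst j; case: a ab M2 {c2 M2'} => [|a] ab M2.
    apply: (neutral_refuted (S := F) (t := k) ltjm FU cF).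
    rewrite (_ : m - 2 = b.+2); last by rewrite -ab.
    by apply: mt_subset M3.
  apply: (neutral_with_block_refuted u FU cF _ _ QF2 QF3 d M2 M3).
  - exact: Nk.
  - exact: Nk.
  - by move: ltjm ab; clear; lia.
have [j' ej] : exists j', j = j'.+3 by exists (j - 3); rewrite -addn3 subnK.
subst j.
apply: (two_coloured_part_refuted u FU F3 eF e3 ce Me _ QF2 QF3 d M2 M3);
  last by move: ltjm ab; clear; lia.
move=> f fF f3 cf Mf.
have def : [disjoint e & f] by move: fF; rewrite subsetD disjoint_sym => /andP[].
have fF' : f \subset F by apply: subset_trans fF (subsetDl _ _).
have eff : e :|: f \subset F by rewrite subUset eF.
have cef : #|e :|: f| = 3 * 2 by rewrite cardsU (disjoint_setI0 def) cards0 e3 f3.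
have ni z : mt (av c z) (e :|: f) 2 -> z != i.
  move=> Mz; apply/eqP=> zi; subst z; have := Nk i ik.
  by rewrite (mt_compl eff Mz) // -setDDl; apply: on_av Mf.
have three z : z \in [:: i; t; k] by apply: (@cs_all [:: i; t; k]).
have [x [y [xy Mx My]]] := two_full _ 2 eff cef isT.
move: (three x) (three y); rewrite !inE (negbTE (ni x Mx)) (negbTE (ni y My)) /=.
move=> /orP[/eqP <- //|/eqP xk] /orP[/eqP <- //|/eqP yk].
by rewrite xk yk eqxx in xy.
Qed.

End Minimal.

(** * The theorem *)

(** A set on which no colour can be avoided by a matching of maximal size contains a
    set [G] with [j] disjoint triples avoiding any given colour, where [j] is large
    with respect to the cardinal of [G]. *)
Lemma exists_gadget (V : finType) (c : {set V} -> 'I_3) (U0 : {set V}) :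
  (forall i, ~~ mt (av c i) U0 (#|U0| %/ 3)) ->
  exists (G : {set V}) j, [/\ G \subset U0, 0 < j, 4 * #|G| <= 13 * j & forall i,
    mt (av c i) G j].
Proof.
pose gadget (G : {set V}) j :=
  [&& G \subset U0, 0 < j, 4 * #|G| <= 13 * j & [forall i, mt (av c i) G j]].
move=> N0.
have [/existsP[G /existsP[j /and4P[GU j0 Gj /forallP M]]]|none] :=
  boolP [exists G : {set V}, [exists j : 'I_#|V|.+1, gadget G j]].
  by exists G, (j : nat).
exfalso.
(* A smallest deficient subset of [U0] is a minimal counterexample. *)
pose deficient (F : {set V}) :=
  (F \subset U0) && [forall i, ~~ mt (av c i) F (#|F| %/ 3)].
have D0 : deficient U0 by rewrite /deficient subxx; apply/forallP.
case: (arg_minnP (fun F : {set V} => #|F|) D0) => U /andP[UU0 /forallP NU] min.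
have below (F : {set V}) : F \proper U -> exists i, mt (av c i) F (#|F| %/ 3).
  move=> pF; apply/existsP; apply: contraT; rewrite negb_exists => NF.
  have := min F; rewrite /deficient NF (subset_trans (proper_sub pF) UU0) => /(_ isT).
  by rewrite leqNgt (proper_card pF).
have [m cU] : exists m, #|U| = 3 * m.
  exists (#|U| %/ 3).
  have [x xU] : exists x, x \in U.
    apply/set0Pn; apply/eqP=> U0'; have := NU ord0.
    by rewrite U0' cards0.
  have [i Mi] := below _ (properD1 xU).
  have cx : #|U| = #|U :\ x|.+1 by rewrite (cardsD1 x) xU.
  have : #|U| %/ 3 <> #|U :\ x| %/ 3.
    move=> e; have := NU i; rewrite e (mt_subset _ Mi) //.
    exact: subsetDl.
  by rewrite cx; clear; lia.
apply: (@no_minimal_counterexample _ c U m) => //.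
- by move=> i; have := NU i; rewrite cU mulKn.
- by move=> F j /below[i Mi] cF; exists i; rewrite cF mulKn in Mi.
move=> F j FU j0 Fj; apply/existsP; apply: contraT; rewrite negb_exists => /forallP M.
have {}M i : mt (av c i) F j by have := M i; rewrite negbK.
have jV : j < #|V|.+1.
  rewrite ltnS; apply: leq_trans (max_card (mem F)).
  by apply: leq_trans (mt_card (M ord0)); rewrite leq_pmull.
case/negP: none; apply/existsP; exists F; apply/existsP; exists (Ordinal jV).
by rewrite /gadget (subset_trans FU UU0) j0 Fj; apply/forallP.
Qed.

(** By induction: the set [G] given by [exists_gadget] can be removed, since it
    supplies at least [4 / 13] of a triple per point, whatever the colour to be
    avoided in the rest. *)
Lemma avoiding_matching (V : finType) (c : {set V} -> 'I_3) (F : {set V}) :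
  exists i, mt (av c i) F ((4 * (#|F| + 1)) %/ 13).
Proof.
have [n] := ubnP #|F|; elim: n F => // n IH F; rewrite ltnS => Fn.
have [/existsP[i Mi]|] := boolP [exists i, mt (av c i) F (#|F| %/ 3)].
  by exists i; apply: mt_le Mi; clear; lia.
rewrite negb_exists => /forallP /exists_gadget[G [j [GF j0 Gj M]]].
have cG := mt_card (M ord0); have lGF := subset_leq_card GF.
have cD : #|F :\: G| = #|F| - #|G| by rewrite cardsD (setIidPr GF).
have [|i Mi] := IH (F :\: G); first by rewrite cD; move: j0 cG lGF Fn; clear; lia.
exists i; apply: mt_le (mt_compl GF (M i) Mi).
by rewrite cD; move: Gj lGF; clear; lia.
Qed.

Theorem theorem4 (n : nat) (V : finType) (c : {set V} -> 'I_3) :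
  0 < n -> #|V| = n ->
  exists M : {set {set V}},
    [/\ matching3 M, two_coloured c M & #|M| = (4 * (n + 1)) %/ 13].
Proof.
move=> _ <-; have [i] := avoiding_matching c [set: V]; rewrite cardsT.
move=> /mt_matching[M [M3 _ cM avM]]; exists M; split=> //.
rewrite /two_coloured -ltnS; apply: leq_trans (_ : #|[set: 'I_3]| <= 3); last first.
  by rewrite cardsT card_ord.
apply: proper_card; rewrite properT; apply/eqP=> e.
have : i \in c @: M by rewrite e inE.
by move=> /imsetP[f fM fi]; have := avM f fM; rewrite /av -fi eqxx.
Qed.
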